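(* Let $a,b>0$, $\Phi(\lambda)=a\ln(1+\lambda/b)$, and $f\in C_b(0,\infty)$. Let $r(t,x)\in C^{1,1}(AC(0,\infty),(0,\infty);[0,\infty))$ be the solution to $$\begin{cases}\mathfrak{D}_t^\Phi r(t,x)=-\dfrac{\partial}{\partial x}r(t,x), & t>0,\ x\in(0,\infty),\\[4pt] r(0,x)=f(x), & x\in(0,\infty),\\[2pt] r(t,x)=0, & t>0,\ x\in(-\infty,0].\end{cases}$$ Then $$r(t,x)=\mathbf{E}_0\left[f(x-L_t),\,t<H_x\right].$$
   Context: Fix $a,b>0$. The gamma subordinator $H=\{H_t\}_{t\ge0}$ is the subordinator started at $H_0=0$ with $\mathbf{E}_0[e^{-\lambda H_t}]=e^{-t\Phi(\lambda)}$, $\lambda\ge0$, where $\Phi(\lambda)=a\ln(1+\lambda/b)=a\int_0^\infty(1-e^{-\lambda y})\frac{e^{-by}}{y}\,dy$. The inverse process is $L_t=\inf\{s>0:H_s\notin(0,t)\}$, $t>0$, with $L_0=0$; one has $\mathbf{P}_0(H_t<s)=\mathbf{P}_0(L_s>t)$ for $s,t>0$. The notation $\mathbf{E}_0[X,A]$ means $\mathbf{E}_0[X\,\mathbf{1}_A]$. The tail of the Lévy measure is $\overline{\Pi}(y)=a\int_y^\infty\frac{e^{-bz}}{z}\,dz$, and the Caputo–Dzherbashian type operator, acting in the variable $t$, is $$\mathfrak{D}_t^\Phi\varphi(t)=\int_0^t\varphi'(t-y)\,\overline{\Pi}(y)\,dy,\qquad\varphi\in AC(0,\infty),$$ where $AC(0,\infty)$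 is the set of continuous functions on $(0,\infty)$ with $\varphi'\in L^1(0,\infty)$. $C_b(0,\infty)$ is the space of bounded continuous functions on $(0,\infty)$. The class $C^{1,1}(AC(0,\infty),(0,\infty);[0,\infty))$ consists of functions $(t,x)\mapsto r(t,x)$ with values in $[0,\infty)$, continuously differentiable in $t\in(0,\infty)$ for each fixed $x>0$ and in $x\in(0,\infty)$ for each fixed $t>0$, with $r(\cdot,x)\in AC(0,\infty)$ for each $x>0$. Solutions are taken within the class where Laplace-transform techniques in each variable apply, i.e. for fixed value of the other variable the function is continuous on $(0,\infty)$ and bounded by a constant (the set $\mathcal{M}_0\cap C(0,\infty)$, where $\mathcal{M}_\eta$ denotes piecewise continuous functions with $|\varphi(z)|\le Ce^{\eta z}$). *)

(* Defs.v *)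
From HB Require Import structures.
From mathcomp Require Import all_boot all_order all_algebra.
From mathcomp Require Import all_classical all_reals all_analysis.

Set Implicit Arguments.
Unset Strict Implicit.
Unset Printing Implicit Defensive.

Import Order.TTheory GRing.Theory Num.Theory.
Import numFieldNormedType.Exports.

Local Open Scope classical_set_scope.
Local Open Scope ring_scope.

(* Functions of a variable in (0, oo) are total functions R -> R whose values
   outside (0, oo) are unconstrained unless stated otherwise. *)

Definition Phi (R : realType) (a b lambda : R) : R := a * ln (1 + lambda / b).

(* C_b(0,oo); this is also M_0 `&` C(0,oo), the bound |g z| <= C e^(0 z) being
   a bound by a constant. *)
Definition Cb (R : realType) (g : R -> R) : Prop :=
  {in `]0, +oo[, continuous g} /\
  exists C : R, forall z : R, 0 < z -> `|g z| <= C.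

Definition C1 (R : realType) (g : R -> R) : Prop :=
  {in `]0, +oo[, forall z : R, derivable g z 1} /\
  {in `]0, +oo[, continuous (derive1 g)}.

(* The derivative is the classical one: this is only used together with C1. *)
Definition AC_halfline (R : realType) (g : R -> R) : Prop :=
  {in `]0, +oo[, continuous g} /\
  (@lebesgue_measure R).-integrable `]0, +oo[ (EFin \o derive1 g).

(* In r t x, the first argument is time and the second one is space. *)
Definition C11_AC (R : realType) (r : R -> R -> R) : Prop :=
  [/\ forall t x : R, 0 < t -> 0 < x -> 0 <= r t x,
      forall x : R, 0 < x -> C1 (fun t => r t x),
      forall t : R, 0 < t -> C1 (fun x => r t x) &
      forall x : R, 0 < x -> AC_halfline (fun t => r t x)].

Definition laplace_class (R : realType) (r : R -> R -> R) : Prop :=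
  (forall x : R, 0 < x -> Cb (fun t => r t x)) /\
  (forall t : R, 0 < t -> Cb (fun x => r t x)).

Definition levy_tail (R : realType) (a b y : R) : R :=
  a * \int[@lebesgue_measure R]_(z in `]y, +oo[) (expR (- (b * z)) / z).

Definition caputo_dzherbashian (R : realType) (a b : R) (phi : R -> R) (t : R)
    : R :=
  \int[@lebesgue_measure R]_(y in `]0, t[) (derive1 phi (t - y) * levy_tail a b y).

(* Since r(.,x) and r(t,.) are otherwise only constrained on (0,oo), the initial
   and boundary values are required to be attained as one-sided limits. *)
Definition solves_cauchy_problem (R : realType) (a b : R) (f : R -> R)
    (r : R -> R -> R) : Prop :=
  [/\ forall t x : R, 0 < t -> 0 < x ->
        caputo_dzherbashian a b (fun s => r s x) t
          = - derive1 (fun y => r t y) x,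
      forall x : R, 0 < x -> r 0 x = f x /\ r t x @[t --> 0^'+] --> f x &
      forall t : R, 0 < t ->
        (forall x : R, x <= 0 -> r t x = 0) /\ r t x @[x --> 0^'+] --> (0 : R)].

(* Mutual independence of X 0, ..., X n.-1; the product rule for a subfamily is
   the case where the remaining B i are setT. *)
Definition mutually_independent (d : measure_display) (Omega : measurableType d)
    (R : realType) (P : probability Omega R) (n : nat)
    (X : nat -> Omega -> R) : Prop :=
  forall B : nat -> set R, (forall i, measurable (B i)) ->
    P (\bigcap_(i in `I_n) (X i @^-1` B i))
      = (\prod_(i < n) P (X i @^-1` B i))%E.

(* H s is only meaningful for s >= 0. *)
Definition gamma_subordinator (d : measure_display) (Omega : measurableType d)
    (R : realType) (P : probability Omega R) (a b : R)
    (H : R -> {RV P >-> R}) : Prop :=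
  [/\ {ae P, forall w, [/\ H 0 w = 0,
        forall s t : R, 0 <= s -> s <= t -> H s w <= H t w &
        forall s : R, 0 <= s -> H u w @[u --> s^'+] --> H s w]},
      forall (n : nat) (t : nat -> R), 0 <= t 0%N ->
        (forall i, t i <= t i.+1) ->
        mutually_independent P n (fun i w => H (t i.+1) w - H (t i) w),
      forall (s t : R) (B : set R), 0 <= s -> 0 <= t -> measurable B ->
        P [set w | B (H (s + t) w - H s w)] = P [set w | B (H t w)] &
      forall t lambda : R, 0 <= t -> 0 <= lambda ->
        ('E_P[(fun w => expR (- (lambda * H t w)))%R])%E
          = (expR (- (t * Phi a b lambda)))%:E].

(* For t = 0 this is inf ]0, +oo[ = 0.  The set is almost surely nonempty, and
   it contains x > 0 on the event t < H x, so the value of inf on the empty set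
   plays no role. *)
Definition inverse_process (d : measure_display) (Omega : measurableType d)
    (R : realType) (P : probability Omega R) (H : R -> {RV P >-> R})
    (t : R) (w : Omega) : R :=
  inf [set s : R | 0 < s /\ ~ `]0, t[%classic (H s w)].

Definition expectation_on (d : measure_display) (Omega : measurableType d)
    (R : realType) (P : probability Omega R) (X : Omega -> R)
    (A : set Omega) : \bar R :=
  ('E_P[(fun w => X w * \1_A w)%R])%E.

(* Main.v *)
(* Write [Phi] for the Laplace exponent and [R l x] for the Laplace transform of
   [r] in time.  In Laplace variables the equation says that
     [e^(Phi x) R l x - (Phi / l) int_0^x e^(Phi z) f z dz]
   does not depend on [x], and the forcing [E (f (x - L_t), t <= H_x)] is the
   function for which this invariant is the one at [x = 0]; uniqueness of the
   Laplace transform then concludes.  The bounds on [r] are not uniform in [x],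
   so [R l] cannot be differentiated directly.  Call two points equivalent if
   they have the same invariants.  Equivalence of [x1 < x2] means that [r(., x2)]
   is the convolution of [r(., x1)] with the gamma density of parameter
   [a (x2 - x1)], plus a forcing.  From this:
   - an equivalence interval contains its right endpoint (dominated convergence)
     and its left endpoint [c]: the mass of [r(., x)] cannot concentrate as
     [x -> c], since an atom or a positive singular part of the limit would, the
     gamma density being decreasing, make [r(t, x)] too large near some [t];
   - if the points which have no equivalence neighbourhood existed, by Baire some
     interval would meet them in a nonempty set where the L2 norms of [r] and
     [dr/dx] and the L1 moduli of continuity in time are bounded.  Telescoping
     [e^(Phi x) r(t, x)] along chains of such points, the convolution formula
     bounds the jumps over gaps by their lengths in L2, so the telescoped sums are
     uniformly integrable in [t], their Laplace transforms converge, and the whole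
     interval is equivalent: a contradiction. *)
Require Import Defs.
From HB Require Import structures.
From mathcomp Require Import all_boot all_order all_algebra.
From mathcomp Require Import all_classical all_reals all_analysis.
From mathcomp Require Import measurable_realfun lra ring.

Set Implicit Arguments.
Unset Strict Implicit.
Unset Printing Implicit Defensive.

Import Order.TTheory GRing.Theory Num.Theory.
Import numFieldNormedType.Exports.

Local Open Scope classical_set_scope.
Local Open Scope ring_scope.

(** * Integration *)

(** At each fixed [x] the equation makes dr/dx the convolution of an L1 function with the Levy tail.
    The tail has only a logarithmic singularity at 0, so dr/dx is square integrable against e^(-t).
    An L1 bound would not do: it would allow mass to concentrate in the limit of the telescoped
    sums. The jumps over gaps need an L2 bound too, and it must be linear in the gap length h for
    the sum over all gaps to stay bounded. The gamma density of parameter s = a h has a moment of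
    order 1/2 which is O(s). A bounded slice whose L1 modulus of continuity is O(y) moves by
    O(y^(1/2)) in L2 under a shift by y, hence by O(h) under smoothing with this density. This is
    why the L1 modulus is among the quantities that Baire's theorem controls. The forcing carries
    [t <= H_x] instead of [t < H_x] in order to be left-continuous in [t], so that equality of
    transforms gives equality at every [t]; the two events differ by a null set because [H_x] has no
    atoms. *)

Section real_integral.
Context d (T : measurableType d) (R : realType).
Variable m : {measure set T -> \bar R}.
Implicit Types u v : T -> R.

Definition L1 u : Prop := m.-integrable setT (EFin \o u).

Lemma L1_meas u : L1 u -> measurable_fun setT u.
Proof. by move=> /measurable_int/measurable_EFinP. Qed.

Lemma L1_le u v : measurable_fun setT u -> (forall x, `|u x| <= v x) ->
  L1 v -> L1 u.
Proof.
move=> mu_ uv; apply: le_integrable => //; first exact/measurable_EFinP.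
by move=> x _ /=; rewrite lee_fin (le_trans (uv x))// ler_norm.
Qed.

Lemma L1D u v : L1 u -> L1 v -> L1 (fun x => u x + v x).
Proof. by move=> iu iv; have := integrableD measurableT iu iv; exact. Qed.

Lemma L1B u v : L1 u -> L1 v -> L1 (fun x => u x - v x).
Proof. by move=> iu iv; have := integrableB measurableT iu iv; exact. Qed.

Lemma L1Z k u : L1 u -> L1 (fun x => k * u x).
Proof. by move=> iu; have := integrableZl measurableT k iu; exact. Qed.

Lemma L1_abs u : L1 u -> L1 (fun x => `|u x|).
Proof. exact: integrable_norm. Qed.

Lemma integral_EFin u : L1 u -> (\int[m]_x (u x)%:E)%E = (\int[m]_x u x)%:E.
Proof. by move=> iu; rewrite /Rintegral fineK//; apply: integrable_fin_num. Qed.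

Lemma L1_bound u (B : R) : measurable_fun setT u -> (forall x, 0 <= u x) ->
  (\int[m]_x (u x)%:E <= B%:E)%E -> L1 u /\ \int[m]_x u x <= B.
Proof.
move=> mu_ u0 uB.
have Lu : L1 u.
  apply/integrableP; split; first exact/measurable_EFinP.
  under eq_integral do rewrite /= ger0_norm//.
  by rewrite (le_lt_trans uB)// ltry.
by split => //; rewrite -lee_fin -integral_EFin.
Qed.

Lemma dct (u_ : nat -> T -> R) u g : (forall n, measurable_fun setT (u_ n)) ->
  (forall n x, `|u_ n x| <= g x) -> L1 g ->
  (forall x, u_ n x @[n --> \oo] --> u x) ->
  L1 u /\ (\int[m]_x u_ n x) @[n --> \oo] --> \int[m]_x u x.
Proof.
move=> mu_ ug Lg uu.
have Lu n : L1 (u_ n) by apply: L1_le Lg.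
have mu : measurable_fun setT u.
  by apply: (@measurable_fun_cvg _ _ _ _ u_) => // x _; exact: uu.
have Lu_ : L1 u.
  apply: (L1_le mu _ Lg) => x.
  have h : `|u_ n x| @[n --> \oo] --> `|u x| by apply: cvg_norm; exact: uu.
  rewrite -(cvg_lim _ h)//; apply: limr_le; first by apply/cvg_ex; eexists; exact: h.
  by apply: nearW => n; exact: ug.
split => //.
have : (\int[m]_x (u_ n x)%:E)%E @[n --> \oo] --> (\int[m]_x (u x)%:E)%E.
  apply: (@dominated_cvg _ _ _ m _ measurableT _ _ (EFin \o g)) => //.
  - by move=> n; exact/measurable_EFinP.
  - by move=> x _; apply: cvg_EFin; [exact: nearW|exact: uu].
  - by move=> n x _; rewrite lee_fin.
rewrite integral_EFin//; under eq_fun do rewrite integral_EFin//.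
by move=> /fine_cvgP[].
Qed.

Lemma fatou_real (u_ : nat -> T -> R) u (B : R) : (forall n, L1 (u_ n)) ->
  (forall n x, 0 <= u_ n x) -> (forall x, u_ n x @[n --> \oo] --> u x) ->
  (forall n, \int[m]_x u_ n x <= B) -> L1 u /\ \int[m]_x u x <= B.
Proof.
move=> Lu u0 uu uB.
have mu : measurable_fun setT u.
  by apply: (@measurable_fun_cvg _ _ _ _ u_) => [n|x _]; [exact: L1_meas|exact: uu].
apply: L1_bound => //.
- move=> x; rewrite -(cvg_lim _ (uu x))//; apply: limr_ge.
    by apply/cvg_ex; eexists; exact: uu.
  by apply: nearW => n; exact: u0.
- apply: (@le_trans _ _ (\int[m]_x limn_einf (fun n => (u_ n x)%:E))%E).
    rewrite le_eqVlt; apply/orP; left; apply/eqP; apply: eq_integral => x _.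
    have h : (u_ n x)%:E @[n --> \oo] --> (u x)%:E.
      by apply: cvg_EFin; [exact: nearW|exact: uu].
    by rewrite (cvg_limn_einf_sup h).1.
  apply: (le_trans (fatou m measurableT _ _)).
  + by move=> n; exact/measurable_EFinP/L1_meas.
  + by move=> n x _; rewrite lee_fin.
  + rewrite limn_einf_lim; apply: lime_le; first exact: is_cvg_einfs.
    apply: nearW => n.
    apply: (@le_trans _ _ (\int[m]_x (u_ n x)%:E)%E).
      by apply: ereal_inf_lbound; exists n => //=.
    by rewrite integral_EFin// lee_fin.
Qed.

Lemma le_I u v : L1 u -> L1 v -> (forall x, u x <= v x) ->
  \int[m]_x u x <= \int[m]_x v x.
Proof. by move=> Lu Lv uv; apply: le_Rintegral. Qed.

Lemma ID u v : L1 u -> L1 v ->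
  \int[m]_x (u x + v x) = \int[m]_x u x + \int[m]_x v x.
Proof. by move=> Lu Lv; rewrite RintegralD. Qed.

Lemma IB u v : L1 u -> L1 v ->
  \int[m]_x (u x - v x) = \int[m]_x u x - \int[m]_x v x.
Proof. by move=> Lu Lv; rewrite RintegralB. Qed.

Lemma IZ k u : L1 u -> \int[m]_x (k * u x) = k * \int[m]_x u x.
Proof. by move=> Lu; rewrite RintegralZl. Qed.

Lemma eq_I u v : u =1 v -> \int[m]_x u x = \int[m]_x v x.
Proof. by move=> /funext ->. Qed.

Lemma I_ge0 u : (forall x, 0 <= u x) -> 0 <= \int[m]_x u x.
Proof. by move=> u0; apply: Rintegral_ge0. Qed.

Lemma I_abs u : L1 u -> `|\int[m]_x u x| <= \int[m]_x `|u x|.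
Proof. by move=> Lu; apply: le_normr_Rintegral. Qed.

Lemma I_bound u v : measurable_fun setT u -> (forall x, `|u x| <= v x) ->
  L1 v -> `|\int[m]_x u x| <= \int[m]_x v x.
Proof.
move=> mu uv Lv; have Lu := L1_le mu uv Lv.
by apply: (le_trans (I_abs Lu)); apply: le_I => //; exact: L1_abs.
Qed.

(** From |g| <= 1 + g^2, integrated against the finite measure w dm. *)
Lemma L1_sq (g w : T -> R) : measurable_fun setT g -> L1 w ->
  (forall x, 0 <= w x) -> L1 (fun x => g x ^+ 2 * w x) ->
  L1 (fun x => g x * w x).
Proof.
move=> mg Lw w0 L2.
apply: (@L1_le _ (fun x => w x + g x ^+ 2 * w x)); last exact: L1D.
  by apply: measurable_funM => //; exact: L1_meas.
move=> x; rewrite normrM (ger0_norm (w0 x)) -{2}[w x]mul1r -mulrDl.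
apply: ler_wpM2r; first exact: w0.
by rewrite -(real_normK (num_real (g x))); nra.
Qed.

(** The quadratic form in [t] given by the integral of (t - g)^2 w is nonnegative; evaluating it at
    its minimum B / A gives the inequality. *)
Lemma weighted_cauchy_schwarz (g w : T -> R) : measurable_fun setT g -> L1 w ->
  (forall x, 0 <= w x) -> L1 (fun x => g x ^+ 2 * w x) ->
  (\int[m]_x (g x * w x)) ^+ 2
    <= \int[m]_x w x * \int[m]_x (g x ^+ 2 * w x).
Proof.
move=> mg Lw w0 L2; have L1_ := L1_sq mg Lw w0 L2.
set A := \int[m]_x w x; set B := \int[m]_x (g x * w x).
set C := \int[m]_x (g x ^+ 2 * w x).
have A0 : 0 <= A by exact: I_ge0.
have C0 : 0 <= C by apply: I_ge0 => x; rewrite mulr_ge0// sqr_ge0.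
have key t : 0 <= t ^+ 2 * A - 2 * t * B + C.
  rewrite -IZ// -(IZ (2 * t) L1_) -IB; [|exact: L1Z|exact: L1Z].
  rewrite -ID//; last by apply: L1B; exact: L1Z.
  apply: I_ge0 => x.
  rewrite (_ : _ + _ = (t - g x) ^+ 2 * w x); last by ring.
  by rewrite mulr_ge0// sqr_ge0.
have [A_eq0|A_neq0] := eqVneq A 0.
  suff -> : B = 0 by rewrite expr0n/= mulr_ge0.
  (* For A = 0 the form reduces to C - 2 t B, and this [t] gives it the value -1. *)
  apply/eqP/negP => /negP B0; have := key ((C + 1) / (2 * B)).
  rewrite A_eq0 mulr0 add0r (_ : 2 * _ * B = C + 1); first by lra.
  by field.
have := key (B / A).
rewrite (_ : _ + C = C - B ^+ 2 / A); last by field.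
rewrite subr_ge0 ler_pdivrMr ?lt_def ?A_neq0//.
by rewrite mulrC.
Qed.

(** Vitali's theorem for the finite measure w dm, with uniform integrability coming from an L2
    bound: h <= min(h, A) + h^2 / A for h = |u_n - u|, where the first term is handled by dominated
    convergence and the second has integral at most 4 B / A. *)
Lemma uniformly_integrable_cvg (w : T -> R) (u_ : nat -> T -> R) u (B : R) :
  L1 w -> (forall x, 0 <= w x) -> (forall n, measurable_fun setT (u_ n)) ->
  (forall n, L1 (fun x => u_ n x ^+ 2 * w x)) ->
  (forall n, \int[m]_x (u_ n x ^+ 2 * w x) <= B) ->
  (forall x, u_ n x @[n --> \oo] --> u x) ->
  L1 (fun x => u x * w x) /\
  (\int[m]_x (u_ n x * w x)) @[n --> \oo] --> \int[m]_x (u x * w x).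
Proof.
move=> Lw w0 mu_ L2 uB uu.
have mu : measurable_fun setT u.
  by apply: (@measurable_fun_cvg _ _ _ _ u_) => [n|x _]; [exact: mu_|exact: uu].
have mw := L1_meas Lw.
have [L2u uB'] : L1 (fun x => u x ^+ 2 * w x) /\
    \int[m]_x (u x ^+ 2 * w x) <= B.
  apply: (fatou_real L2 _ _ uB) => [n x|x].
    by rewrite mulr_ge0// sqr_ge0.
  by apply: cvgMl; apply: cvgM; exact: uu.
have Lu : L1 (fun x => u x * w x) by exact: L1_sq.
split => //.
have Lu_ n : L1 (fun x => u_ n x * w x) by exact: L1_sq.
pose h n x : R := `|u_ n x - u x|.
have mh n : measurable_fun setT (h n).
  by apply: measurableT_comp => //; apply: measurable_funB.
have L2h n : L1 (fun x => h n x ^+ 2 * w x).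
  apply: (@L1_le _ (fun x => 2 * (u_ n x ^+ 2 * w x) + 2 * (u x ^+ 2 * w x))).
  - by apply: measurable_funM => //; apply: measurable_funX.
  - move=> x; rewrite ger0_norm; last by rewrite mulr_ge0// sqr_ge0.
    rewrite !mulrA -mulrDl; apply: ler_wpM2r => //.
    rewrite /h real_normK ?num_real//.
    have := sqr_ge0 (u_ n x + u x); rewrite !expr2; nra.
  - by apply: L1D; apply: L1Z.
have hB n : \int[m]_x (h n x ^+ 2 * w x) <= 4 * B.
  apply: (@le_trans _ _
    (\int[m]_x (2 * (u_ n x ^+ 2 * w x) + 2 * (u x ^+ 2 * w x)))).
    apply: le_I => //; first by apply: L1D; apply: L1Z.
    move=> x; rewrite !mulrA -mulrDl; apply: ler_wpM2r => //.
    rewrite /h real_normK ?num_real//.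
    have := sqr_ge0 (u_ n x + u x); rewrite !expr2; nra.
  rewrite ID ?IZ//; [|exact: L1Z|exact: L1Z].
  by have := uB n; lra.
have Lh n : L1 (fun x => h n x * w x) by exact: L1_sq.
have B0 : 0 <= B.
  by apply: le_trans uB'; apply: I_ge0 => x; rewrite mulr_ge0// sqr_ge0.
apply/cvgrPdist_le => e e0.
(* Chosen so that 4 B / A <= e / 2. *)
pose A : R := 8 * (B + 1) / e.
have A0 : 0 < A by rewrite divr_gt0// mulr_gt0//; lra.
have Mm n : measurable_fun setT (fun x => Num.min (h n x) A * w x).
  by apply: measurable_funM => //; exact: measurable_minr.
have mA n x : `|Num.min (h n x) A * w x| <= A * w x.
  rewrite ger0_norm ?ler_wpM2r ?mulr_ge0// ?ge_min ?lexx ?orbT//.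
  by rewrite le_min /h normr_ge0 ltW.
have min0 x : Num.min (h n x) A * w x @[n --> \oo] --> (0 : R).
  rewrite -[X in _ --> X](mul0r (w x)); apply: cvgMl.
  apply: (@squeeze_cvgr _ _ _ _ (fun=> 0) (h ^~ x)).
  - by apply: nearW => n; rewrite le_min /h normr_ge0 (ltW A0)/= ge_min lexx.
  - exact: cvg_cst.
  - rewrite -(normr0 R) -(subrr (u x)); apply: cvg_norm.
    by apply: cvgB; [exact: uu|exact: cvg_cst].
have [_ cv] := dct Mm mA (L1Z A Lw) min0.
move: cv; rewrite Rintegral_cst// mul0r => /cvgrPdist_le /(_ (e / 2)).
rewrite divr_gt0// => /(_ isT); apply: filterS => n; rewrite sub0r normrN => hn.
rewrite -IB//; apply: (le_trans (I_abs (L1B Lu (Lu_ n)))).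
have Lm : L1 (fun x => Num.min (h n x) A * w x) by exact: L1_le (L1Z A Lw).
apply: (@le_trans _ _ (\int[m]_x (Num.min (h n x) A * w x
   + A^-1 * (h n x ^+ 2 * w x)))).
  apply: le_I; [exact/L1_abs/L1B|by apply: L1D => //; exact: L1Z|].
  move=> x; rewrite -mulrBl normrM (ger0_norm (w0 x)) distrC -/(h n x).
  rewrite mulrA -mulrDl; apply: ler_wpM2r => //.
  have h0 : 0 <= h n x by exact: normr_ge0.
  have [hA|hA] := leP (h n x) A.
    by rewrite lerDl mulr_ge0// ?invr_ge0 ?sqr_ge0// ltW.
  rewrite -[leLHS]add0r; apply: lerD; first exact: ltW.
  by rewrite mulrC ler_pdivlMr// expr2 ler_wpM2l// ltW.
rewrite ID ?IZ//; last exact: L1Z.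
rewrite (splitr e); apply: lerD; first exact: le_trans (ler_norm _) hn.
apply: (@le_trans _ _ (A^-1 * (4 * B))).
  by rewrite ler_wpM2l// invr_ge0 ltW.
rewrite /A invf_div mulrAC ler_pdivrMr; last by rewrite mulr_gt0//; lra.
by nra.
Qed.

End real_integral.

(** * Changes of variables and convolution *)

Section affine_change.
Context (R : realType).
Notation mu := (@lebesgue_measure R).

(** The rescaled pushforward agrees with Lebesgue measure on the intervals []x, y]], which
    determines it. For negative [k] the preimage is closed at the other end, with the same
    length. *)
Lemma lebesgue_measure_affine (k c : R) (A : set R) : k != 0 -> measurable A ->
  (`|k|%:E * mu ((fun y : R => (k * y + c)%R) @^-1` A))%E = mu A.
Proof.
move=> k0 mA.
have mphi : measurable_fun setT (fun y : measurableTypeR R => (k * y + c) : measurableTypeR R).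
  by apply: measurable_funD => //; apply: measurable_funM.
have -> : (`|k|%:E * mu ((fun y : R => (k * y + c)%R) @^-1` A))%E =
    pushforward (mscale (NngNum (normr_ge0 k)) mu)
      (fun y : measurableTypeR R => (k * y + c) : measurableTypeR R) A by [].
apply/esym/lebesgue_measure_unique => //= _ [[x y]] _ <-.
rewrite /pushforward /mscale/=.
rewrite lebesgue_measure_itv/=.
have [k_gt0|k_lt0|/eqP] := ltgtP k 0; last by rewrite (negPf k0).
- rewrite (_ : _ @^-1` _ = `[((y - c) / k), ((x - c) / k)[%classic); last first.
    apply/seteqP; split => z /=; rewrite !in_itv/= ler_ndivrMr// ltr_ndivlMr//.
    + by move=> /andP[? ?]; apply/andP; split; lra.
    + by move=> /andP[? ?]; apply/andP; split; lra.
  rewrite lebesgue_measure_itv/= !lte_fin ltr_nM2r ?invr_lt0// ltrD2r.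
  case: ifPn => _; last by rewrite mule0.
  rewrite -!EFinB -EFinM ltr0_norm//; congr (_%:E); field.
  by rewrite lt_eqF.
- rewrite (_ : _ @^-1` _ = `]((x - c) / k), ((y - c) / k)]%classic); last first.
    apply/seteqP; split => z /=; rewrite !in_itv/= ltr_pdivrMr// ler_pdivlMr//.
    + by move=> /andP[? ?]; apply/andP; split; lra.
    + by move=> /andP[? ?]; apply/andP; split; lra.
  rewrite lebesgue_measure_itv/= !lte_fin ltr_pM2r ?invr_gt0// ltrD2r.
  case: ifPn => _; last by rewrite mule0.
  rewrite -!EFinB -EFinM gtr0_norm//; congr (_%:E); field.
  by rewrite gt_eqF.
Qed.

Lemma ge0_integral_affine (k c : R) (f : R -> \bar R) : k != 0 ->
  measurable_fun setT f -> (forall x, 0 <= f x)%E ->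
  (`|k|%:E * \int[mu]_x f (k * x + c)%R = \int[mu]_x f x)%E.
Proof.
move=> k0 mf f0.
have mphi : measurable_fun setT (fun y : measurableTypeR R => (k * y + c) : measurableTypeR R).
  by apply: measurable_funD => //; apply: measurable_funM.
have := @ge0_integral_pushforward _ _ _ _ R _ mphi
  (mscale (NngNum (normr_ge0 k)) mu) setT f measurableT mf (fun y _ => f0 y).
rewrite preimage_setT /comp ge0_integral_mscale//=; last first.
  by apply: measurableT_comp => //; exact: mphi.
move=> <-; apply: eq_measure_integral => //= A mA _.
exact: lebesgue_measure_affine.
Qed.

Lemma L1_affine (k c : R) (u : R -> R) : k != 0 -> L1 mu u ->
  L1 mu (fun x => u (k * x + c)).
Proof.
move=> k0 Lu; apply/integrableP; split.
  apply/measurable_EFinP; apply: measurableT_comp; first exact: L1_meas Lu.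
  by apply: measurable_funD => //; apply: measurable_funM.
have := @ge0_integral_affine k c (fun x => `|u x|%:E) k0.
move=> /(_ _ _)/(congr1 (fun z => (`|k|^-1)%:E * z))%E.
rewrite muleA -EFinM mulVf ?normr_eq0// mul1e => ->//.
- rewrite integral_EFin; last exact: L1_abs.
  by rewrite -EFinM ltry.
- by apply/measurable_EFinP/measurableT_comp => //; exact: L1_meas Lu.
Qed.

Lemma I_affine_ge0 (k c : R) (u : R -> R) : k != 0 -> L1 mu u ->
  (forall x, 0 <= u x) ->
  `|k| * \int[mu]_x u (k * x + c) = \int[mu]_x u x.
Proof.
move=> k0 Lu u0; have := @ge0_integral_affine k c (EFin \o u) k0.
rewrite /comp !integral_EFin//; last exact: L1_affine.
rewrite -EFinM => h; apply: EFin_inj; apply: h => [|x]; last by rewrite lee_fin.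
by apply/measurable_EFinP; exact: L1_meas Lu.
Qed.

(** Difference of the nonnegative cases [|u|] and [|u| - u]. *)
Lemma I_affine (k c : R) (u : R -> R) : k != 0 -> L1 mu u ->
  `|k| * \int[mu]_x u (k * x + c) = \int[mu]_x u x.
Proof.
move=> k0 Lu.
have Lp : L1 mu (fun x => `|u x|) by exact: L1_abs.
have Lq : L1 mu (fun x => `|u x| - u x) by exact: L1B.
have q0 x : 0 <= `|u x| - u x by rewrite subr_ge0 ler_norm.
have := I_affine_ge0 c k0 Lq q0.
rewrite (IB Lp Lu) (IB (L1_affine c k0 Lp) (L1_affine c k0 Lu)) mulrBr.
rewrite (I_affine_ge0 c k0 Lp) => [|x]; last exact: normr_ge0.
by move/addrI/oppr_inj.
Qed.

Lemma L1_shift (y : R) (u : R -> R) : L1 mu u -> L1 mu (fun x => u (x - y)).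
Proof.
move=> Lu; have := @L1_affine 1 (- y) u (oner_neq0 _) Lu.
by under eq_fun do rewrite mul1r.
Qed.

Lemma I_shift (y : R) (u : R -> R) : L1 mu u ->
  \int[mu]_x u (x - y) = \int[mu]_x u x.
Proof.
move=> Lu; have := @I_affine 1 (- y) u (oner_neq0 _) Lu.
by under eq_fun do rewrite mul1r; rewrite normr1 mul1r.
Qed.

Lemma L1_reflect (t : R) (u : R -> R) : L1 mu u -> L1 mu (fun y => u (t - y)).
Proof.
move=> Lu; have := @L1_affine (-1) t u _ Lu.
rewrite oppr_eq0 oner_neq0 => /(_ isT).
by under eq_fun do rewrite mulN1r addrC.
Qed.

Lemma I_reflect (t : R) (u : R -> R) : L1 mu u ->
  \int[mu]_y u (t - y) = \int[mu]_x u x.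
Proof.
move=> Lu; have := @I_affine (-1) t u _ Lu.
rewrite oppr_eq0 oner_neq0 => /(_ isT).
by under eq_fun do rewrite mulN1r addrC; rewrite normrN normr1 mul1r.
Qed.

End affine_change.

(** The inner integral over [y] is finite only for almost every [x]; elsewhere [fine] replaces an
    infinite value by 0. The real iterated integral thus agrees almost everywhere with the extended
    one, which is enough for the outer integral. *)
Lemma fubini_real d1 d2 (T1 : measurableType d1) (T2 : measurableType d2)
    (R : realType) (m1 : {sigma_finite_measure set T1 -> \bar R})
    (m2 : {sigma_finite_measure set T2 -> \bar R}) (F : T1 * T2 -> R) :
  measurable_fun setT F ->
  (forall y, L1 m1 (fun x => F (x, y))) ->
  L1 m2 (fun y => \int[m1]_x `|F (x, y)|) ->
  [/\ L1 m1 (fun x => \int[m2]_y F (x, y)),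
      L1 m2 (fun y => \int[m1]_x F (x, y)),
      \int[m1]_x \int[m2]_y F (x, y) = \int[m2]_y \int[m1]_x F (x, y) &
      {ae m1, forall x, L1 m2 (fun y => F (x, y))}].
Proof.
move=> mF LF1 LF2.
have mFE : measurable_fun setT (EFin \o F) by exact/measurable_EFinP.
have iF : (m1 \x m2)%E.-integrable setT (EFin \o F).
  apply/integrable21ltyP => //=.
  under eq_integral => y _ do rewrite (integral_EFin (L1_abs (LF1 y))).
  by rewrite integral_EFin// ltry.
have aeF := ae_integrable1 iF.
have i1 := integrable_fubini_F iF.
have i1f : L1 m1 (fun x => \int[m2]_y F (x, y)).
  apply: (le_integrable _ _ _ i1) => //.
    apply/measurable_EFinP; apply: measurableT_comp => //.
    exact: measurable_int i1.
  move=> x _ /=; rewrite /Rintegral /fubini_F.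
  rewrite [X in (_ <= `|X|)%E](_ : _ = (\int[m2]_y (F (x, y))%:E)%E)//.
  by case: (\int[m2]_y _)%E => [r||] /=; rewrite ?leey.
have m2f : measurable_fun setT (fun y => \int[m1]_x F (x, y)).
  by apply: measurableT_comp => //; exact: measurable_fubini_G iF.
have i2f : L1 m2 (fun y => \int[m1]_x F (x, y)).
  by apply: (L1_le m2f _ LF2) => y; exact: I_abs.
split => //.
apply: EFin_inj; rewrite -!integral_EFin//.
under [RHS]eq_integral do rewrite -integral_EFin//.
rewrite -(Fubini iF); apply: ae_eq_integral => //.
- by apply/measurable_EFinP; exact: L1_meas i1f.
- exact: measurable_int i1.
- by apply: filterS aeF => x /= /integral_EFin ->.
Qed.

Lemma le_I_ae d (T : measurableType d) (R : realType)
    (m : {measure set T -> \bar R}) (u v : T -> R) :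
  measurable_fun setT u -> (forall x, 0 <= u x) -> (forall x, 0 <= v x) ->
  L1 m v -> {ae m, forall x, u x <= v x} ->
  L1 m u /\ \int[m]_x u x <= \int[m]_x v x.
Proof.
move=> mu u0 v0 Lv uv; apply: L1_bound => //.
rewrite -integral_EFin//; apply: ae_ge0_le_integral => //.
- by move=> x _; rewrite lee_fin.
- exact/measurable_EFinP.
- by move=> x _; rewrite lee_fin.
- by apply/measurable_EFinP; exact: L1_meas Lv.
- by apply: filterS uv => x uv _; rewrite lee_fin.
Qed.

Section convolution.
Context (R : realType).
Notation mu := (@lebesgue_measure R).
Implicit Types u v : R -> R.

Definition conv u v t := \int[mu]_y (u (t - y) * v y).

Lemma measurable_conv2 u v : measurable_fun setT u -> measurable_fun setT v ->
  measurable_fun setT (fun z : R * R => u (z.1 - z.2) * v z.2).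
Proof.
move=> mu_ mv; apply: measurable_funM; apply: measurableT_comp => //.
exact: measurable_funB.
Qed.

Lemma conv_L1 u v : L1 mu u -> L1 mu v ->
  [/\ L1 mu (conv u v),
      \int[mu]_t conv u v t = \int[mu]_t u t * \int[mu]_t v t &
      {ae mu, forall t, L1 mu (fun y => u (t - y) * v y)}].
Proof.
move=> Lu Lv.
pose F (z : R * R) := u (z.1 - z.2) * v z.2.
have mF : measurable_fun setT F.
  by apply: measurable_conv2; [exact: L1_meas Lu|exact: L1_meas Lv].
have LF y : L1 mu (fun x => F (x, y)).
  rewrite /F/=; under eq_fun do rewrite mulrC.
  by apply: L1Z; exact: L1_shift.
have IF (y : R) : \int[mu]_x `|F (x, y)| = `|v y| * \int[mu]_x `|u x|.
  under eq_I do rewrite /F normrM mulrC/=.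
  rewrite IZ; first by rewrite (I_shift y (L1_abs Lu)).
  by apply: L1_abs; exact: L1_shift.
have [|L1F _ FF aeF] := @fubini_real _ _ _ _ R mu mu F mF LF.
  under eq_fun do rewrite IF mulrC.
  by apply: L1Z; exact: L1_abs.
split; [exact: L1F| |exact: aeF].
rewrite /conv FF; under eq_I => y do under eq_I => x do rewrite /F/= mulrC.
under eq_I => y do rewrite (IZ (v y) (L1_shift y Lu)) (I_shift y Lu) mulrC.
by rewrite IZ.
Qed.

End convolution.

(** * The Laplace transform *)

Section halfline.
Context (R : realType).
Notation mu := (@lebesgue_measure R).
Implicit Types (u v psi : R -> R) (l t : R).

(** Values at nonpositive times are unconstrained in the hypotheses, so they are erased before any
    integration or convolution over the whole line. *)
Definition causal u t : R := if 0 < t then u t else 0.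

Lemma causal_restrict u : causal u = u \_ `]0, +oo[.
Proof.
by apply/funext => t; rewrite patchE /causal mem_setE in_itv/= andbT.
Qed.

Lemma measurable_causal u : measurable_fun (`]0%R, +oo[%classic : set R) u -> measurable_fun setT (causal u).
Proof. by move=> mu_; rewrite causal_restrict; apply/(measurable_restrictT _ _).1. Qed.

Lemma measurable_causal_continuous u : {in `]0, +oo[, continuous u} ->
  measurable_fun setT (causal u).
Proof.
move=> cu; apply: measurable_causal; apply: open_continuous_measurable_fun => //.
by move=> x xP; apply: cu; rewrite inE in xP.
Qed.

Lemma L1_causal u : L1 mu (causal u) <-> mu.-integrable `]0, +oo[ (EFin \o u).
Proof.
rewrite /L1 causal_restrict -restrict_EFin; split => h.
  exact/(integrable_mkcond _ _).2.
exact/(integrable_mkcond _ _).1.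
Qed.

Lemma integral_causal u :
  (\int[mu]_t (causal u t)%:E = \int[mu]_(t in `]0%R, +oo[) (u t)%:E)%E.
Proof. by rewrite [RHS]integral_mkcond causal_restrict restrict_EFin. Qed.

Lemma cvg_expRN_pinfty l : 0 < l -> expR (- (l * t)) @[t --> +oo] --> (0 : R).
Proof.
move=> l0; apply/cvgrPdist_lt => e e0; near=> t.
rewrite sub0r normrN ger0_norm ?expR_ge0//.
rewrite -[ltRHS](lnK e0) ltr_expR.
rewrite ltrNl -ltr_pdivrMl// mulrC.
by near: t; apply: nbhs_pinfty_gt; rewrite num_real.
Unshelve. all: by end_near. Qed.

Lemma expR_halfline l : 0 < l ->
  L1 mu (causal (fun t => expR (- (l * t)))) /\
  \int[mu]_t causal (fun t => expR (- (l * t))) t = l^-1.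
Proof.
move=> l0.
have ce : continuous (fun t : R => expR (- (l * t))).
  move=> t; apply: continuous_comp; last exact: continuous_expR.
  by apply: continuousN; apply: mulrl_continuous.
have FTC : (\int[mu]_(t in `[0%R, +oo[) (expR (- (l * t)))%:E =
    0%:E - (- l^-1 * expR (- (l * 0)))%:E)%E.
  apply: (@ge0_continuous_FTC2y R (fun t => expR (- (l * t)))
    (fun t => - l^-1 * expR (- (l * t)))).
  - by move=> x _; exact: expR_ge0.
  - exact: continuous_subspaceT.
  - rewrite -(mulr0 (- l^-1)); apply: cvgM; first exact: cvg_cst.
    exact: cvg_expRN_pinfty.
  - by move=> x _; apply: ex_derive.
  - apply: cvg_at_right_filter; apply: cvgM; first exact: cvg_cst.
    exact: ce.
  - move=> x _; rewrite derive1E derive_val.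
    rewrite /GRing.scale/= mulr1; field.
    by rewrite gt_eqF.
have E : (\int[mu]_t (causal (fun t => expR (- (l * t))) t)%:E = (l^-1)%:E)%E.
  rewrite integral_causal integral_itv_obnd_cbnd; last first.
    apply/measurable_EFinP; apply: measurable_funTS.
    exact: continuous_measurable_fun.
  by rewrite FTC mulr0 oppr0 expR0 mulr1 -EFinB sub0r opprK.
have [|||L _] := @L1_bound _ _ _ mu (causal (fun t => expR (- (l * t)))) l^-1.
- by apply: measurable_causal_continuous => x _; exact: ce.
- by move=> t; rewrite /causal; case: ifP => // _; exact: expR_ge0.
- by rewrite E.
by split => //; apply: EFin_inj; rewrite -integral_EFin.
Qed.

Definition weight l u t := expR (- (l * t)) * causal u t.

Definition lap l u := \int[mu]_t weight l u t.

Lemma measurable_weight l u : measurable_fun setT (causal u) ->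
  measurable_fun setT (weight l u).
Proof.
move=> mu_; apply: measurable_funM => //.
by apply: measurableT_comp => //; apply: measurableT_comp => //; apply: measurable_funM.
Qed.

Lemma weight_causal l u : weight l u = causal (fun t => expR (- (l * t)) * u t).
Proof.
by apply/funext => t; rewrite /weight /causal; case: ifP => // _; rewrite mulr0.
Qed.

Lemma L1_weight l u (C : R) : 0 < l -> measurable_fun setT (causal u) ->
  (forall t, 0 < t -> `|u t| <= C) -> L1 mu (weight l u).
Proof.
move=> l0 mu_ uC.
have LC := L1Z C (expR_halfline l0).1.
apply: L1_le LC => [|t]; first exact: measurable_weight.
rewrite weight_causal /causal; case: ifPn => t0; last by rewrite normr0 mulr0.
by rewrite normrM ger0_norm ?expR_ge0// mulrC ler_wpM2r ?expR_ge0// uC.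
Qed.

Lemma eq_lap l u v : (forall t, 0 < t -> u t = v t) -> lap l u = lap l v.
Proof.
by move=> uv; apply: eq_I => t; rewrite /weight /causal; case: ifPn => // /uv ->.
Qed.

(** The hypothesis says that psi is orthogonal to every e^(-jt), hence to every polynomial in e^(-t)
    without constant term. In the induction, a factor 1 - e^(-nt) turns the transform at [k] into
    the difference of those at [k] and [k + n]. *)
Lemma lap_exp_comb psi (C : R) (n N k : nat) : measurable_fun setT (causal psi) ->
  (forall t, 0 < t -> `|psi t| <= C) ->
  (forall j : nat, (0 < j)%N -> lap j%:R psi = 0) -> (0 < k)%N ->
  lap k%:R (fun t => (1 - expR (- (n%:R * t))) ^+ N * psi t) = 0.
Proof.
move=> mpsi psiC H; elim: N k => [|N IH] k k0.
  rewrite -[RHS](H k)//; apply: eq_lap => t _.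
  by rewrite expr0 mul1r.
pose v t := (1 - expR (- (n%:R * t))) ^+ N * psi t.
have mexp : measurable_fun setT (fun t : R => 1 - expR (- (n%:R * t))).
  apply: measurable_funB => //; apply: measurableT_comp => //.
  by apply: measurableT_comp => //; apply: measurable_funM.
have mv : measurable_fun setT (causal v).
  rewrite (_ : causal v = fun t => (1 - expR (- (n%:R * t))) ^+ N * causal psi t).
    by apply: measurable_funM => //; apply: measurable_funX.
  by apply/funext => t; rewrite /causal /v; case: ifP => // _; rewrite mulr0.
have vC t : 0 < t -> `|v t| <= C.
  move=> t0; rewrite /v normrM.
  have e1 : expR (- (n%:R * t)) <= 1.
    by rewrite -expR0 ler_expR oppr_le0 mulr_ge0// ltW.
  rewrite ger0_norm; last by rewrite exprn_ge0// subr_ge0.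
  rewrite -[leRHS]mul1r; apply: ler_pM => //.
  - by rewrite exprn_ge0// subr_ge0.
  - by rewrite exprn_ile1// ?subr_ge0// lerBlDr lerDl expR_ge0.
  - exact: psiC.
have k0' : 0 < k%:R :> R by rewrite ltr0n.
have kn0' : 0 < (k + n)%:R :> R by rewrite ltr0n addn_gt0 k0.
transitivity (lap k%:R v - lap (k + n)%:R v); last first.
  by rewrite !IH ?subr0// addn_gt0 k0.
rewrite /lap -IB; [|exact: L1_weight mv vC|exact: L1_weight mv vC].
apply: eq_I => t; rewrite !weight_causal /causal; case: ifP => _; last by rewrite subr0.
rewrite natrD mulrDl opprD expRD /v exprS; ring.
Qed.

(** With an exponent of order n e^(nT), the power behaves like exp(- n e^(n(T - t))): it tends to 1
    for t > T and to 0 for t <= T. The additional factor n in the exponent settles the case t =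
    T. *)
Lemma exp_threshold_cvg (T t : R) : 0 <= T -> 0 < t ->
  (1 - expR (- (n.+1%:R * t))) ^+ (n.+1 * (Num.truncn (expR (n.+1%:R * T))).+1)
    @[n --> \oo] --> ((T < t)%R%:R : R).
Proof.
move=> T0 t0.
have e01 (n : nat) : 0 <= 1 - expR (- (n%:R * t)) <= 1.
  rewrite subr_ge0 lerBlDr lerDl expR_ge0 andbT.
  by rewrite -expR0 ler_expR oppr_le0 mulr_ge0// ltW.
have cvgC (C : R) : C * n.+1%:R^-1 @[n --> \oo] --> (0 : R).
  by rewrite -(mulr0 C); apply: cvgM; [exact: cvg_cst|exact: cvg_harmonic].
have [Tt|tT] := ltP T t; rewrite /=.
- pose d := t - T; have d0 : 0 < d by rewrite subr_gt0.
  have bern (x : R) N : 0 <= x -> x <= 1 -> 1 - N%:R * x <= (1 - x) ^+ N.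
    move=> x0 x1; elim: N => [|N IH]; first by rewrite mul0r subr0 expr0.
    rewrite exprS; apply: (@le_trans _ _ ((1 - x) * (1 - N%:R * x))).
      rewrite -natr1; have : 0 <= N%:R * x * x by rewrite !mulr_ge0.
      nra.
    by rewrite ler_wpM2l// subr_ge0.
  (* By Bernoulli's inequality the defect is at most 2 n e^(-nd), and e^(nd) >= (nd / 2)^2 makes
     this at most 8 / (d^2 n). *)
  apply: (@squeeze_cvgr _ _ _ _ (fun n => 1 - 8 / d ^+ 2 * n.+1%:R^-1) (fun=> 1)).
  + apply: nearW => n; have /andP[h0 h1] := e01 n.+1.
    apply/andP; split; last by rewrite exprn_ile1.
    apply: le_trans (bern _ _ (expR_ge0 _) _); last first.
      by rewrite -subr_ge0.
    rewrite lerD2l lerN2 natrM.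
    have hM : (Num.truncn (expR (n.+1%:R * T))).+1%:R <= 2 * expR (n.+1%:R * T).
      have E1 : 1 <= expR (n.+1%:R * T) by rewrite -expR0 ler_expR mulr_ge0.
      have tE : (Num.truncn (expR (n.+1%:R * T)))%:R <= expR (n.+1%:R * T).
        by rewrite truncn_le expR_ge0.
      by rewrite -natr1; lra.
    have hd : n.+1%:R * d / 2 <= expR (n.+1%:R * d / 2).
      by apply: le_trans (expR_ge1Dx _); rewrite lerDr.
    have hd2 : (n.+1%:R * d / 2) ^+ 2 <= expR (n.+1%:R * d).
      rewrite [X in expR X](_ : _ = n.+1%:R * d / 2 + n.+1%:R * d / 2); last first.
        by field.
      have nd0 : 0 <= n.+1%:R * d / 2 by rewrite !mulr_ge0// ltW.
      by rewrite expRD expr2 ler_pM.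
    apply: (@le_trans _ _ (n.+1%:R * (2 * expR (n.+1%:R * T)) *
        expR (- (n.+1%:R * t)))).
      by rewrite ler_wpM2r ?expR_ge0// ler_wpM2l.
    have -> : n.+1%:R * (2 * expR (n.+1%:R * T)) * expR (- (n.+1%:R * t)) =
        2 * n.+1%:R / expR (n.+1%:R * d).
      rewrite -expRN /d mulrBr opprB addrC expRD; ring.
    have n0 : 0 < n.+1%:R :> R by [].
    rewrite ler_pdivrMr ?expR_gt0//.
    apply: (@le_trans _ _ (8 / d ^+ 2 / n.+1%:R * (n.+1%:R * d / 2) ^+ 2)).
      rewrite le_eqVlt; apply/orP; left; apply/eqP; field.
      by rewrite !gt_eqF.
    rewrite ler_wpM2l// divr_ge0// divr_ge0// exprn_ge0//; exact: ltW.
  + by rewrite -[X in _ --> X]subr0; apply: cvgB; [exact: cvg_cst|exact: cvgC].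
  + exact: cvg_cst.
- apply: (@squeeze_cvgr _ _ _ _ (fun=> 0) (fun n => 1 * n.+1%:R^-1)).
  + apply: nearW => n; have /andP[h0 h1] := e01 n.+1.
    rewrite exprn_ge0//=.
    set x := expR _ in h0 h1 *; set M := (Num.truncn _).+1.
    have hM : expR (n.+1%:R * T) <= M%:R by apply: ltW; exact: truncnS_gt.
    have xM : 1 <= x * M%:R.
      apply: (@le_trans _ _ (x * expR (n.+1%:R * T))).
        by rewrite /x -expRD -expR0 ler_expR addrC -mulrBr mulr_ge0// subr_ge0.
      by rewrite ler_wpM2l// expR_ge0.
    (* Here 1 - x <= e^(-x) and x M >= 1, so the power is at most e^(-n), which is below 1 / n. *)
    apply: (@le_trans _ _ (expR (- x) ^+ (n.+1 * M))).
      by apply: lerXn2r; rewrite ?nnegrE ?expR_ge0//; exact: expR_ge1Dx.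
    rewrite -expRM_natr mulNr natrM expRN mul1r lef_pV2 ?posrE ?expR_gt0//.
    apply: (@le_trans _ _ (expR n.+1%:R)).
      by apply: le_trans (expR_ge1Dx _); rewrite lerDr.
    by rewrite ler_expR mulrCA ler_peMr.
  + exact: cvg_cst.
  + exact: cvgC.
Qed.

(** The powers in [exp_threshold_cvg] approximate the indicator of t > T boundedly, and each of them
    is orthogonal to psi by [lap_exp_comb]. *)
Lemma lap_tail0 psi (C T : R) : measurable_fun setT (causal psi) ->
  (forall t, 0 < t -> `|psi t| <= C) ->
  (forall j : nat, (0 < j)%N -> lap j%:R psi = 0) -> 0 <= T ->
  lap 1 (fun t => (T < t)%R%:R * psi t) = 0.
Proof.
move=> mpsi psiC H T0.
pose N n := (n.+1 * (Num.truncn (expR (n.+1%:R * T))).+1)%N.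
pose q n t := (1 - expR (- (n.+1%:R * t))) ^+ (N n).
have mq n : measurable_fun setT (q n).
  apply: measurable_funX; apply: measurable_funB => //; apply: measurableT_comp => //.
  by apply: measurableT_comp => //; apply: measurable_funM.
have Lw := L1_weight (@ltr01 R) mpsi psiC.
have [||||_ cv] := @dct _ _ _ mu (fun n => weight 1 (fun t => q n t * psi t))
   (weight 1 (fun t => (T < t)%R%:R * psi t)) (fun t => `|weight 1 psi t|).
- move=> n; apply: measurable_weight.
  rewrite (_ : causal _ = fun t => q n t * causal psi t); first exact: measurable_funM.
  by apply/funext => t; rewrite /causal; case: ifP => // _; rewrite mulr0.
- move=> n t; rewrite !weight_causal /causal; case: ifPn => t0; last by rewrite normr0.
  rewrite [X in `|X|]mulrCA normrM -[leRHS]mul1r ler_wpM2r//.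
  have e1 : expR (- (n.+1%:R * t)) <= 1.
    by rewrite -expR0 ler_expR oppr_le0 mulr_ge0// ltW.
  rewrite ger0_norm; last by rewrite exprn_ge0// subr_ge0.
  by rewrite exprn_ile1// ?subr_ge0// lerBlDr lerDl expR_ge0.
- exact: L1_abs.
- move=> t; rewrite weight_causal; under eq_fun do rewrite weight_causal.
  rewrite /causal; case: ifPn => t0; last exact: cvg_cst.
  by apply: cvgMr; apply: cvgMl; exact: exp_threshold_cvg.
rewrite -/(lap _ _) in cv.
have c0 : (fun n => \int[mu]_t weight 1 (fun t => q n t * psi t) t) = fun=> 0.
  by apply/funext => n; have := lap_exp_comb n.+1 (N n) mpsi psiC H (ltn0Sn 0).
by rewrite -(cvg_lim _ cv)// c0; apply: lim_cst.
Qed.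

(** Subtracting two tails, the integral of e^(-x) psi(x) over every []S, t]] vanishes. If psi(t)
    were positive, left continuity would keep psi above psi(t) / 2 on such an interval. *)
Lemma lap_inj0 psi (C t : R) : measurable_fun setT (causal psi) ->
  (forall t, 0 < t -> `|psi t| <= C) ->
  (forall j : nat, (0 < j)%N -> lap j%:R psi = 0) -> 0 < t ->
  psi x @[x --> t^'-] --> psi t -> psi t <= 0.
Proof.
move=> mpsi psiC H t0 lc; rewrite leNgt; apply/negP => pt.
have Lw T : L1 mu (weight 1 (fun t => (T < t)%R%:R * psi t)).
  apply: (@L1_weight _ _ C) => //.
    rewrite (_ : causal _ = fun t => (T < t)%R%:R * causal psi t).
      apply: measurable_funM => //.
      rewrite (_ : (fun _ => _) = \1_(`]T, +oo[%classic : set R)).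
        exact: measurable_indic.
      by apply/funext => x; rewrite indicE mem_setE in_itv/= andbT.
    by apply/funext => x; rewrite /causal; case: ifP => // _; rewrite mulr0.
  move=> x x0; rewrite normrM -[leRHS]mul1r ler_pM//; last exact: psiC.
  by case: ltP => _; rewrite ?normr1 ?normr0.
have [S [S0 St SP]] : exists S, [/\ 0 < S, S < t &
    forall x, S < x -> x <= t -> psi t / 2 <= psi x].
  move/cvgrPdist_lt : lc => /(_ (psi t / 2)); rewrite divr_gt0// => /(_ isT).
  move=> [e /= e0 he]; exists (Num.max (t / 2) (t - e / 2)); split.
  - by rewrite lt_max divr_gt0.
  - by rewrite gt_max; apply/andP; split; lra.
  - move=> x; rewrite gt_max => /andP[x1 x2]; rewrite le_eqVlt => /predU1P[->|xt].
      by rewrite ler_pdivrMr// ler_peMr// ?ltW// ltr1n.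
    have := he x; rewrite /ball_/= => /(_ _ xt) => /(_ _)/ltr_normlP[] //.
      by rewrite gtr0_norm ?subr_gt0//; lra.
    by move=> _ ?; lra.
pose g x := weight 1 (fun t => (S < t)%R%:R * psi t) x -
            weight 1 (fun y => (t < y)%R%:R * psi y) x.
have Ig : \int[mu]_x g x = 0.
  rewrite IB//.
  have h1 := @lap_tail0 psi C S mpsi psiC H (ltW S0).
  have h2 := @lap_tail0 psi C t mpsi psiC H (ltW t0).
  by rewrite /lap in h1 h2; rewrite h1 h2 subr0.
pose k := expR (- t) * (psi t / 2).
have k0 : 0 < k by rewrite mulr_gt0 ?expR_gt0// divr_gt0.
have mi : measurable (`]S, t]%classic : set R) by [].
have Lk : L1 mu (fun x => k * \1_(`]S, t]%classic : set R) x).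
  by apply: L1Z; exact: integrable_indic_itv.
have gk x : k * \1_(`]S, t]%classic : set R) x <= g x.
  rewrite /g !weight_causal /causal indicE mem_setE in_itv/=.
  case: (ltP 0 x) => x0; last first.
    by rewrite ltNge (le_trans x0 (ltW S0))/= mulr0 subrr.
  case: (ltP S x) => Sx; case: (leP x t) => xt; rewrite ?mulr1 ?mulr0 ?mul0r ?mul1r ?mulr0 ?subr0 ?subrr//=.
    rewrite /k ler_pM// ?expR_ge0//; first by rewrite divr_ge0// ltW.
      by rewrite ler_expR lerN2.
    exact: SP.
  by have := lt_trans (le_lt_trans Sx St) xt; rewrite ltxx.
have := le_I Lk (L1B (Lw S) (Lw t)) gk.
rewrite -/g Ig IZ; last exact: integrable_indic_itv.
rewrite (_ : \int[mu]_x \1_(`]S, t]%classic : set R) x = t - S).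
  by rewrite leNgt mulr_gt0// subr_gt0.
rewrite /Rintegral integral_indic// setIT /= lebesgue_measure_itv/= lte_fin St.
by rewrite -EFinB.
Qed.

(** Lerch's theorem in pointwise form: transforms at the positive integers determine a bounded
    function at each point of left continuity. *)
Lemma lap_inj u v (C D t : R) : measurable_fun setT (causal u) ->
  measurable_fun setT (causal v) ->
  (forall t, 0 < t -> `|u t| <= C) -> (forall t, 0 < t -> `|v t| <= D) ->
  (forall j : nat, (0 < j)%N -> lap j%:R u = lap j%:R v) -> 0 < t ->
  u x @[x --> t^'-] --> u t -> v x @[x --> t^'-] --> v t -> u t = v t.
Proof.
move=> mu_ mv uC vD H t0 ut vt.
have key (a b : R -> R) (A B : R) : measurable_fun setT (causal a) ->
    measurable_fun setT (causal b) ->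
    (forall t, 0 < t -> `|a t| <= A) -> (forall t, 0 < t -> `|b t| <= B) ->
    (forall j : nat, (0 < j)%N -> lap j%:R a = lap j%:R b) ->
    a x @[x --> t^'-] --> a t -> b x @[x --> t^'-] --> b t -> a t <= b t.
  move=> ma mb aA bB ab at_ bt; rewrite -subr_le0.
  apply: (@lap_inj0 (fun x => a x - b x) (A + B) t) => //.
  - rewrite (_ : causal _ = fun x => causal a x - causal b x); first exact: measurable_funB.
    by apply/funext => x; rewrite /causal; case: ifP => // _; rewrite subr0.
  - move=> x x0; apply: (le_trans (ler_normB _ _)).
    by apply: lerD; [exact: aA|exact: bB].
  - move=> j j0; have j0' : 0 < j%:R :> R by rewrite ltr0n.
    apply/eqP; rewrite -(subrr (lap j%:R b)) -{1}ab// /lap -IB.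
    + apply/eqP/eq_I => x; rewrite !weight_causal /causal; case: ifP => // _.
        by rewrite mulrBr.
      by rewrite subr0.
    + exact: L1_weight ma aA.
    + exact: L1_weight mb bB.
  - exact: cvgB.
by apply/eqP; rewrite eq_le (key u v C D)//= (key v u D C)// => j /H.
Qed.

End halfline.

(** * The gamma density *)

Section fundamental_theorem.
Context (R : realType).
Notation mu := (@lebesgue_measure R).
Implicit Types (f F u : R -> R) (a b c : R).

Lemma L1_restrict (A : set R) u : measurable A ->
  L1 mu (u \_ A) <-> mu.-integrable A (EFin \o u).
Proof.
move=> mA; rewrite /L1 -restrict_EFin; split => h.
  exact/(integrable_mkcond _ _).2.
exact/(integrable_mkcond _ _).1.
Qed.

Lemma integral_restrict (A : set R) u :
  (\int[mu]_x ((u \_ A) x)%:E = \int[mu]_(x in A) (u x)%:E)%E.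
Proof. by rewrite [RHS]integral_mkcond restrict_EFin. Qed.

Lemma integral_FTC f F a b : a < b ->
  (forall x : R, a <= x <= b -> is_derive x 1 F (f x)) ->
  (forall x : R, a <= x <= b -> {for x, continuous f}) ->
  (\int[mu]_(x in `[a, b]) (f x)%:E = (F b - F a)%:E)%E.
Proof.
move=> ab dF cf; rewrite EFinB; apply: continuous_FTC2 => //.
- by apply: continuous_in_subspaceT => x; rewrite inE/= in_itv/=; exact: cf.
- have cF x : a <= x <= b -> {for x, continuous F}.
    move=> /dF [+ _]; move=> /derivable1_diffP; exact: differentiable_continuous.
  split.
  + move=> x; rewrite in_itv/= => /andP[ax xb].
    by have [] := dF x (introT andP (conj (ltW ax) (ltW xb))).
  + by apply: cvg_at_right_filter; apply: cF; rewrite lexx ltW.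
  + by apply: cvg_at_left_filter; apply: cF; rewrite lexx ltW.
- move=> x; rewrite in_itv/= => /andP[ax xb].
  have := dF x (introT andP (conj (ltW ax) (ltW xb))).
  by move=> h; rewrite derive1E derive_val.
Qed.

(** Monotone convergence over the intervals [c / (n + 2), c], since [F] is controlled at 0 only
    through its right limit. *)
Lemma integral_FTC0 f F c : 0 < c ->
  (forall x : R, 0 < x -> is_derive x 1 F (f x)) ->
  (forall x : R, 0 < x -> {for x, continuous f}) ->
  (forall x : R, 0 < x -> 0 <= f x) -> F x @[x --> 0^'+] --> (0 : R) ->
  (\int[mu]_(x in `]0%R, c]) (f x)%:E = (F c)%:E)%E.
Proof.
move=> c0 dF cf f0 F0.
pose A n := `[c / n.+2%:R, c]%classic : set R.
have An0 n : 0 < c / n.+2%:R by rewrite divr_gt0.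
have Anc n : c / n.+2%:R < c by rewrite ltr_pdivrMr// ltr_pMr// ltr1n.
have bigA : \bigcup_n A n = `]0, c]%classic.
  apply/seteqP; split => x.
    move=> [n _]; rewrite /A/= !in_itv/= => /andP[nx ->]; rewrite andbT.
    exact: lt_le_trans nx.
  rewrite /= in_itv/= => /andP[x0 xc].
  exists (Num.truncn (c / x)) => //; rewrite /A/= in_itv/= xc andbT.
  rewrite ler_pdivrMr// -ler_pdivrMl// mulrC.
  apply: ltW; apply: (lt_trans (truncnS_gt _)).
  by rewrite ltr_nat.
have mf : measurable_fun (`]0, c]%classic : set R) f.
  apply: (@measurable_funS _ _ _ _ (`]0, +oo[%classic : set R)) => //.
    by move=> x /=; rewrite !in_itv/= andbT => /andP[].
  apply: open_continuous_measurable_fun => //.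
  by move=> x; rewrite inE/= in_itv/= andbT; exact: cf.
have Asub n : A n `<=` `]0, c]%classic by rewrite -bigA; exact: bigcup_sup.
have cv : (\int[mu]_(x in A i) (f x)%:E)%E @[i --> \oo] -->
    (\int[mu]_(x in \bigcup_i A i) (f x)%:E)%E.
  apply: ge0_nondecreasing_set_cvg_integral => //.
  - move=> m n mn; rewrite subsetEset => x; rewrite /A/= !in_itv/= => /andP[mx ->].
    rewrite andbT; apply: le_trans mx; rewrite ler_pM2l// lef_pV2 ?posrE//.
    by rewrite ler_nat !ltnS.
  - by move=> n; exact: measurable_itv.
  - by move=> n; apply/measurable_EFinP; apply: measurable_funS mf.
  - by move=> n x /Asub/=; rewrite in_itv/= lee_fin => /andP[/f0].
have fE : (fun n => (\int[mu]_(x in A n) (f x)%:E)%E) =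
    (fun n => (F c - F (c / n.+2%:R))%:E).
  apply/funext => n; apply: integral_FTC => // x /andP[nx _].
    by apply: dF; exact: lt_le_trans nx.
  by apply: cf; exact: lt_le_trans nx.
rewrite bigA fE in cv; apply: (cvg_unique _ cv) => //.
apply: cvg_EFin; first exact: nearW.
rewrite -[X in _ --> X]subr0; apply: cvgB; first exact: cvg_cst.
move/cvg_at_rightP : F0 => /(_ (fun n => c / n.+2%:R)); apply; split => //.
rewrite -(mulr0 c); apply: cvgM; first exact: cvg_cst.
by have := @cvg_harmonic R; rewrite -cvg_shiftS; exact.
Unshelve. all: by end_near. Qed.

End fundamental_theorem.

Section gamma_kernel.
Context (R : realType).
Notation mu := (@lebesgue_measure R).
Implicit Types (b s y l : R).

(** The function y^(s - 1) e^(-by) for y > 0, as a single exponential: comparisons of kernels become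
    comparisons of exponents. *)
Definition gamma_kernel b s : R -> R :=
  causal (fun y => expR ((s - 1) * ln y - b * y)).

(** Equal to Gamma(s) / b^s. *)
Definition gamma_cst b s : R := \int[mu]_y gamma_kernel b s y.

Definition gamma_density b s y : R := gamma_kernel b s y / gamma_cst b s.

Lemma gamma_kernelE b s y : 0 < y ->
  gamma_kernel b s y = expR ((s - 1) * ln y - b * y).
Proof. by rewrite /gamma_kernel /causal => ->. Qed.

Lemma gamma_kernel0 b s y : y <= 0 -> gamma_kernel b s y = 0.
Proof. by rewrite /gamma_kernel /causal ltNge => ->. Qed.

Lemma gamma_kernel_ge0 b s y : 0 <= gamma_kernel b s y.
Proof. by rewrite /gamma_kernel /causal; case: ifP => // _; exact: expR_ge0. Qed.

Lemma measurable_gamma_kernel b s : measurable_fun setT (gamma_kernel b s).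
Proof.
apply: measurable_causal_continuous => y; rewrite in_itv/= andbT => y0.
apply: continuous_comp; last exact: continuous_expR.
apply: continuousB; last exact: mulrl_continuous.
by apply: continuousM; [exact: cvg_cst|exact: continuous_ln].
Qed.

Lemma power_integral s : 0 < s ->
  L1 mu ((fun y => expR ((s - 1) * ln y)) \_ `]0, 1]) /\
  \int[mu]_y ((fun y => expR ((s - 1) * ln y)) \_ `]0, 1]) y = s^-1.
Proof.
move=> s0.
have cf x : 0 < x -> {for x, continuous (fun y : R => expR ((s - 1) * ln y))}.
  move=> x0; apply: continuous_comp; last exact: continuous_expR.
  by apply: continuousM; [exact: cvg_cst|exact: continuous_ln].
have E : (\int[mu]_y (((fun y => expR ((s - 1) * ln y)) \_ `]0%R, 1%R]) y)%:E
    = (s^-1)%:E)%E.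
  rewrite integral_restrict.
  transitivity ((fun y => s^-1 * expR (s * ln y)) 1)%:E; last first.
    by rewrite /= ln1 mulr0 expR0 mulr1.
  apply: (@integral_FTC0 _ _ (fun y => s^-1 * expR (s * ln y)) 1).
  - exact: ltr01.
  - move=> x x0; have := is_derive1_ln x0 => dln.
    apply: is_derive_eq; rewrite /GRing.scale/=.
    rewrite mulrBl mul1r expRB lnK ?posrE//; field.
    by rewrite !gt_eqF.
  - exact: cf.
  - by move=> x _; exact: expR_ge0.
  - rewrite -[X in _ --> X](mulr0 s^-1); apply: cvgM; first exact: cvg_cst.
    apply/cvgrPdist_lt => e e0; near=> y.
    have y0 : 0 < y by near: y; exact: nbhs_right_gt.
    rewrite sub0r normrN gtr0_norm ?expR_gt0// -[ltRHS](lnK e0) ltr_expR.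
    rewrite mulrC -ltr_pdivlMr// -[ltRHS]expRK ltr_ln ?posrE ?expR_gt0//.
    by near: y; apply: nbhs_right_lt; exact: expR_gt0.
have [|||L _] := @L1_bound _ _ _ mu
    ((fun y => expR ((s - 1) * ln y)) \_ `]0, 1]) s^-1.
- apply/(measurable_restrictT _ _).1 => //.
  apply: (@measurable_funS _ _ _ _ (`]0, +oo[%classic : set R)) => //.
    by move=> x /=; rewrite !in_itv/= andbT => /andP[].
  apply: open_continuous_measurable_fun => //.
  by move=> x; rewrite inE/= in_itv/= andbT; exact: cf.
- by move=> y; rewrite patchE; case: ifP => // _; exact: expR_ge0.
- by rewrite E.
by split => //; apply: EFin_inj; rewrite -integral_EFin.
Unshelve. all: by end_near. Qed.

Lemma ln_le_linear (k y : R) : 0 < k -> 0 < y -> ln y <= k * y - 1 - ln k.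
Proof.
move=> k0 y0; have : ln (1 + (k * y - 1)) <= k * y - 1.
  by apply: le_ln1Dx; rewrite ltrBrDl subrr mulr_gt0.
by rewrite addrC subrK lnM ?posrE//; lra.
Qed.

Lemma L1_gamma_kernel b s : 0 < b -> 0 < s -> L1 mu (gamma_kernel b s).
Proof.
move=> b0 s0; have [s1|s1] := leP s 1.
- apply: (@L1_le _ _ _ mu _ (fun y =>
      ((fun y => expR ((s - 1) * ln y)) \_ `]0, 1]) y + causal (fun y => expR (- (b * y))) y)).
  + exact: measurable_gamma_kernel.
  + move=> y; rewrite ger0_norm ?gamma_kernel_ge0//.
    rewrite /gamma_kernel /causal patchE mem_setE in_itv/=.
    case: ltP => y0 /=; last by rewrite addr0.
    case: (leP y 1) => y1.
      apply: ler_wpDr; first exact: expR_ge0.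
      by rewrite ler_expR gerBl mulr_ge0// ltW.
    rewrite (_ : point = 0 :> R)// add0r ler_expR gerDr mulr_le0_ge0 ?subr_le0//.
    by rewrite ln_ge0// ltW.
  + by apply: L1D; [exact: (power_integral s0).1|exact: (expR_halfline b0).1].
(* With this slope the bound on [ln] costs half of the exponential decay: (s - 1) ln y <= (b / 2) y
   + constant. *)
- pose k := b / (2 * (s - 1)).
  have s10 : 0 < s - 1 by rewrite subr_gt0.
  have k0 : 0 < k by rewrite divr_gt0// mulr_gt0.
  have b2 : 0 < b / 2 by rewrite divr_gt0.
  apply: (@L1_le _ _ _ mu _ (fun y =>
     expR ((s - 1) * (- 1 - ln k)) * causal (fun y => expR (- (b / 2 * y))) y)).
  + exact: measurable_gamma_kernel.
  + move=> y; rewrite ger0_norm ?gamma_kernel_ge0//.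
    rewrite /gamma_kernel /causal; case: ltP => y0; last by rewrite mulr0.
    rewrite -expRD ler_expR.
    have := ler_wpM2l (ltW s10) (ln_le_linear k0 y0).
    have -> : (s - 1) * (k * y - 1 - ln k) = b / 2 * y + (s - 1) * (- 1 - ln k).
      by rewrite /k; field; rewrite gt_eqF.
    by lra.
  + by apply: L1Z; exact: (expR_halfline b2).1.
Qed.

(** On []0, 1]] the exponential is at least e^(-b), and y^(s - 1) has integral 1 / s there. This is
    the source of all factors [s] below: as s -> 0 the density becomes O(s) away from 0. *)
Lemma gamma_cst_ge b s : 0 < b -> 0 < s -> expR (- b) / s <= gamma_cst b s.
Proof.
move=> b0 s0; have [Lp Ip] := power_integral s0.
rewrite -Ip -IZ//; apply: le_I; [exact: L1Z|exact: L1_gamma_kernel|].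
move=> y; rewrite patchE mem_setE in_itv/= /gamma_kernel /causal.
case: ltP => y0 /=; last by rewrite mulr0.
case: (leP y 1) => y1; last first.
  by rewrite (_ : point = 0 :> R)// mulr0 expR_ge0.
by rewrite -expRD ler_expR addrC lerD2l lerN2 ler_piMr// ltW.
Qed.

Lemma gamma_cst_gt0 b s : 0 < b -> 0 < s -> 0 < gamma_cst b s.
Proof.
move=> b0 s0; apply: lt_le_trans (gamma_cst_ge b0 s0).
by rewrite divr_gt0// expR_gt0.
Qed.

Lemma gamma_cstV_le b s : 0 < b -> 0 < s -> (gamma_cst b s)^-1 <= s * expR b.
Proof.
move=> b0 s0; have c0 := gamma_cst_gt0 b0 s0.
rewrite -[leRHS]invrK lef_pV2 ?posrE ?invr_gt0 ?mulr_gt0 ?expR_gt0//.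
by rewrite invfM -expRN mulrC; exact: gamma_cst_ge.
Qed.

Lemma gamma_density_ge0 b s y : 0 < b -> 0 < s -> 0 <= gamma_density b s y.
Proof.
move=> b0 s0; rewrite divr_ge0 ?gamma_kernel_ge0//.
by rewrite ltW// gamma_cst_gt0.
Qed.

Lemma gamma_density_le b s y : 0 < b -> 0 < s ->
  gamma_density b s y <= s * expR b * gamma_kernel b s y.
Proof.
move=> b0 s0; rewrite /gamma_density mulrC ler_wpM2r ?gamma_kernel_ge0//.
exact: gamma_cstV_le.
Qed.

Lemma gamma_density0 b s y : y <= 0 -> gamma_density b s y = 0.
Proof. by move=> y0; rewrite /gamma_density gamma_kernel0// mul0r. Qed.

Lemma L1_gamma_density b s : 0 < b -> 0 < s -> L1 mu (gamma_density b s).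
Proof.
move=> b0 s0; rewrite /gamma_density; under eq_fun do rewrite mulrC.
by apply: L1Z; exact: L1_gamma_kernel.
Qed.

Lemma I_gamma_density b s : 0 < b -> 0 < s ->
  \int[mu]_y gamma_density b s y = 1.
Proof.
move=> b0 s0; rewrite /gamma_density; under eq_I do rewrite mulrC.
rewrite IZ; last exact: L1_gamma_kernel.
by rewrite mulVf// gt_eqF// gamma_cst_gt0.
Qed.

Lemma weight_gamma_density l b s y :
  weight l (gamma_density b s) y = expR (- (l * y)) * gamma_density b s y.
Proof.
rewrite /weight /causal; case: ltP => // y0.
by rewrite gamma_density0.
Qed.

(** With k = 1 + l / b, the factor e^(-ly) turns the kernel at y into k^(1 - s) times the kernel at
    k y; the change of variables then leaves k^(-s). For s = a h this is e^(-h Phi(l)). *)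
Lemma lap_gamma_density l b s : 0 <= l -> 0 < b -> 0 < s ->
  L1 mu (weight l (gamma_density b s)) /\
  lap l (gamma_density b s) = expR (- (s * ln (1 + l / b))).
Proof.
move=> l0 b0 s0; have c0 := gamma_cst_gt0 b0 s0.
pose k := 1 + l / b.
have k0 : 0 < k by rewrite ltr_wpDr// divr_ge0// ltW.
have Lk := L1_gamma_kernel b0 s0.
have E y : weight l (gamma_density b s) y =
    (gamma_cst b s)^-1 * (expR ((1 - s) * ln k) * gamma_kernel b s (k * y + 0)).
  rewrite weight_gamma_density /gamma_density addr0.
  have [y0|y0] := ltP 0 y; last first.
    by rewrite !gamma_kernel0 ?mul0r ?mulr0// pmulr_rle0.
  rewrite !gamma_kernelE ?mulr_gt0// mulrA [in LHS]mulrC; congr (_ * _).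
  rewrite -!expRD lnM ?posrE//; congr expR.
  have -> : b * (k * y) = b * y + l * y by rewrite /k; field; rewrite gt_eqF.
  ring.
have La := L1_affine 0 (lt0r_neq0 k0) Lk.
have WE : weight l (gamma_density b s) = fun y => (gamma_cst b s)^-1 *
    (expR ((1 - s) * ln k) * gamma_kernel b s (k * y + 0)).
  by apply/funext.
rewrite /lap WE; split; first by apply: L1Z; exact: L1Z.
rewrite IZ; last exact: L1Z.
rewrite IZ//.
have := I_affine 0 (lt0r_neq0 k0) Lk; rewrite gtr0_norm// -/(gamma_cst b s).
move=> /(congr1 (fun z => k^-1 * z)); rewrite mulKf ?gt_eqF// => ->.
rewrite mulrBl mul1r expRB lnK ?posrE// -/k expRN; field.
by rewrite !gt_eqF// expR_gt0.
Qed.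

Lemma gamma_density_noninc b s y z : 0 < b -> 0 < s -> s <= 1 -> 0 < y -> y <= z ->
  gamma_density b s z <= gamma_density b s y.
Proof.
move=> b0 s0 s1 y0 yz; rewrite ler_wpM2r//.
  by rewrite invr_ge0 ltW// gamma_cst_gt0.
rewrite !gamma_kernelE//; last exact: lt_le_trans yz.
rewrite ler_expR; apply: lerB; last by rewrite ler_wpM2l// ltW.
by rewrite ler_wnM2l ?subr_le0// ler_ln ?posrE//; exact: lt_le_trans yz.
Qed.

Lemma gamma_density_small b y : 0 < b -> 0 < y ->
  exists C : R, forall s, 0 < s -> s <= 1 -> gamma_density b s y <= C * s.
Proof.
move=> b0 y0; exists (expR b * expR `|ln y|) => s s0 s1.
apply: (le_trans (gamma_density_le _ b0 s0)).
rewrite [leRHS]mulrC mulrA ler_wpM2l ?mulr_ge0 ?expR_ge0 ?(ltW s0)//.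
rewrite gamma_kernelE// ler_expR.
apply: (@le_trans _ _ ((s - 1) * ln y)).
  by rewrite gerBl mulr_ge0// ltW.
apply: (le_trans (ler_norm _)); rewrite normrM ler_piMl//.
by rewrite ler_norml; apply/andP; split; lra.
Qed.

(** The singularity y^(s - 1) at 0. It rules out atoms in the limit at a left endpoint: an atom
    would make the solution arbitrarily large shortly afterwards. *)
Lemma gamma_density_pinfty b s (B : R) : 0 < b -> 0 < s -> s < 1 ->
  exists2 y0 : R, 0 < y0 & forall y, 0 < y -> y < y0 -> B <= gamma_density b s y.
Proof.
move=> b0 s0 s1; have c0 := gamma_cst_gt0 b0 s0.
pose B' := Num.max 1 (B * gamma_cst b s).
have B'0 : 0 < B' by rewrite lt_max ltr01.
exists (Num.min 1 (expR (- (ln B' + b) / (1 - s)))).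
  by rewrite lt_min ltr01 expR_gt0.
move=> y y0; rewrite lt_min => /andP[y1 yE].
rewrite /gamma_density ler_pdivlMr// gamma_kernelE//.
apply: (@le_trans _ _ B'); first by rewrite le_max lexx orbT.
rewrite -[leLHS](lnK B'0) ler_expR.
have s10 : 0 < 1 - s by rewrite subr_gt0.
have : ln y <= - (ln B' + b) / (1 - s).
  by rewrite -[leRHS]expRK ler_ln ?posrE ?expR_gt0// ltW.
rewrite ler_pdivlMr// => h.
have : b * y <= b by rewrite ler_piMr// ltW.
by nra.
Qed.

(** Splitting at y = 1, y^(1/2) y^(s - 1) is at most y^(-1/2) + y^(1/2), that is, a sum of kernels
    of parameters 1/2 and 3/2 which do not depend on [s]. The factor [s] comes from the normalising
    constant. *)
Lemma gamma_density_sqrt_moment b : 0 < b ->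
  exists C : R, forall s, 0 < s -> s <= 1 ->
    L1 mu (fun y => Num.sqrt y * gamma_density b s y) /\
    \int[mu]_y (Num.sqrt y * gamma_density b s y) <= C * s.
Proof.
move=> b0.
exists (expR b * (gamma_cst b 2^-1 + gamma_cst b (3 / 2))) => s s0 s1.
have h0 : 0 < 2^-1 :> R by lra.
have h1 : 0 < 3 / 2 :> R by lra.
have L : L1 mu (fun y => s * expR b * (gamma_kernel b 2^-1 y + gamma_kernel b (3 / 2) y)).
  by apply: L1Z; apply: L1D; exact: L1_gamma_kernel.
have le y : `|Num.sqrt y * gamma_density b s y| <=
    s * expR b * (gamma_kernel b 2^-1 y + gamma_kernel b (3 / 2) y).
  rewrite ger0_norm; last by rewrite mulr_ge0// gamma_density_ge0.
  apply: (@le_trans _ _ (Num.sqrt y * (s * expR b * gamma_kernel b s y))).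
    by rewrite ler_wpM2l// gamma_density_le.
  rewrite mulrCA ler_wpM2l ?mulr_ge0 ?expR_ge0 ?(ltW s0)//.
  have [y0|y0] := ltP 0 y; last by rewrite !gamma_kernel0// mulr0 addr0.
  have -> : Num.sqrt y = expR (2^-1 * ln y).
    by rewrite -powR12_sqrt ?ltW// /powR gt_eqF.
  rewrite !gamma_kernelE// -expRD.
  have [l0|l0] := leP 0 (ln y).
    apply: ler_wpDl; first exact: expR_ge0.
    by rewrite ler_expR addrA lerD2r; nra.
  apply: ler_wpDr; first exact: expR_ge0.
  by rewrite ler_expR addrA lerD2r; nra.
have m : measurable_fun setT (fun y => Num.sqrt y * gamma_density b s y).
  apply: measurable_funM.
    by apply: continuous_measurable_fun; exact: sqrt_continuous.
  exact: L1_meas (L1_gamma_density b0 s0).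
split; first exact: (@L1_le _ _ _ mu _ _ m le L).
apply: (le_trans (ler_norm _)).
apply: (le_trans (@I_bound _ _ _ mu _ _ m le L)).
rewrite IZ; last by apply: L1D; exact: L1_gamma_kernel.
rewrite ID ?mulrA; [|exact: L1_gamma_kernel|exact: L1_gamma_kernel].
by rewrite -!/(gamma_cst _ _); lra.
Qed.

End gamma_kernel.

(** * The tail of the Levy measure *)

Lemma L1_0 d (T : measurableType d) (R : realType)
  (m : {measure set T -> \bar R}) : L1 m (fun=> 0).
Proof. exact: integrable0. Qed.

Lemma I_0 d (T : measurableType d) (R : realType)
  (m : {measure set T -> \bar R}) : \int[m]_(_ in setT) (0 : R) = 0.
Proof. by rewrite Rintegral_cst ?mul0r. Qed.

Section levy_tail.
Context (R : realType).
Notation mu := (@lebesgue_measure R).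
Implicit Types (a b s y l : R).

(** Times [a], this is Phi(1 / y). By Markov's inequality it bounds the Levy tail, the tail of the
    gamma density and the survival function of the subordinator. *)
Definition log_tail b y : R := ln (1 + 1 / (b * y)).

Definition markov_cst : R := (1 - expR (- 1))^-1.

Lemma markov_cst_gt0 : 0 < markov_cst.
Proof. by rewrite invr_gt0 subr_gt0 -expR0 ltr_expR oppr_lt0. Qed.

Lemma markov_cstE : markov_cst * (1 - expR (- 1)) = 1.
Proof. by rewrite mulVf// gt_eqF// -invr_gt0 markov_cst_gt0. Qed.

Lemma log_tail_ge0 b y : 0 < b -> 0 < y -> 0 <= log_tail b y.
Proof. by move=> b0 y0; rewrite ln_ge0// lerDl divr_ge0// mulr_ge0// ltW. Qed.

(** With w = (b y)^(-1/4): ln(1 + w^4) <= 4 ln(1 + w) <= 4 w. The power 1/4 leaves room for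
    squaring: [log_tail] and its square are dominated by gamma kernels of parameters 3/4 and 1/2. *)
Lemma log_tail_le b y : 0 < b -> 0 < y ->
  log_tail b y <= 4 * expR (- (4^-1 * (ln b + ln y))).
Proof.
move=> b0 y0; pose w := expR (- (4^-1 * (ln b + ln y))).
have w0 : 0 < w by exact: expR_gt0.
have by0 : 0 < b * y by rewrite mulr_gt0.
have -> : log_tail b y = ln (1 + w ^+ 4).
  rewrite /log_tail /w -expRM_natl; congr (ln (1 + _)).
  have -> : 4 * - (4^-1 * (ln b + ln y)) = - (ln b + ln y) by field.
  by rewrite -lnM ?posrE// expRN lnK ?posrE// div1r.
apply: (@le_trans _ _ (ln ((1 + w) ^+ 4))).
  rewrite ler_ln ?posrE ?exprn_gt0 ?addr_gt0 ?exprn_gt0//.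
  rewrite -subr_ge0 (_ : _ - _ = 4 * w + 6 * w ^+ 2 + 4 * w ^+ 3); last by ring.
  by rewrite !addr_ge0// mulr_ge0// ?exprn_ge0// ltW.
rewrite lnXn ?addr_gt0// -[ln _ *+ _]mulr_natl ler_wpM2l//.
by apply: le_ln1Dx; apply: lt_trans w0; rewrite oppr_lt0.
Qed.

Lemma continuous_log_tail b y : 0 < b -> 0 < y -> {for y, continuous (log_tail b)}.
Proof.
move=> b0 y0; have by0 : 0 < b * y by rewrite mulr_gt0.
apply: (@continuous_comp _ _ _ (fun y => 1 + 1 / (b * y)) (@ln R)); last first.
  by apply: continuous_ln; rewrite addr_gt0// divr_gt0.
apply: continuousD; first exact: cvg_cst.
apply: continuousM; first exact: cvg_cst.
by apply: continuousV; [rewrite gt_eqF|exact: mulrl_continuous].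
Qed.

Lemma measurable_log_tail b : 0 < b -> measurable_fun setT (causal (log_tail b)).
Proof.
move=> b0; apply: measurable_causal_continuous => y; rewrite in_itv/= andbT.
exact: continuous_log_tail.
Qed.

Lemma L1_weight_log_tail b l : 0 < b -> 0 < l -> L1 mu (weight l (log_tail b)).
Proof.
move=> b0 l0; have h : 0 < 3 / 4 :> R by lra.
apply: (L1_le _ _ (L1Z (4 * expR (- (4^-1 * ln b))) (L1_gamma_kernel l0 h))).
  exact: (measurable_weight _ (measurable_log_tail b0)).
move=> y; rewrite weight_causal /causal; case: ltP => y0; last first.
  by rewrite normr0 gamma_kernel0// mulr0.
rewrite gamma_kernelE// ger0_norm; last first.
  by rewrite mulr_ge0 ?expR_ge0// log_tail_ge0.
apply: (le_trans (ler_wpM2l (expR_ge0 _) (log_tail_le b0 y0))).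
rewrite mulrCA -mulrA -!expRD ler_wpM2l// ler_expR; lra.
Qed.

Lemma L1_weight_log_tail_sq b l : 0 < b -> 0 < l ->
  L1 mu (weight l (fun y => log_tail b y ^+ 2)).
Proof.
move=> b0 l0; have h : 0 < 2^-1 :> R by lra.
apply: (L1_le _ _ (L1Z (16 * expR (- (2^-1 * ln b))) (L1_gamma_kernel l0 h))).
  apply: measurable_weight.
  rewrite (_ : causal _ = fun y => causal (log_tail b) y ^+ 2).
    by apply: measurable_funX; exact: measurable_log_tail.
  by apply/funext => y; rewrite /causal; case: ifP => //; rewrite expr0n.
move=> y; rewrite weight_causal /causal; case: ltP => y0; last first.
  by rewrite normr0 gamma_kernel0// mulr0.
rewrite gamma_kernelE// ger0_norm; last by rewrite mulr_ge0 ?expR_ge0// sqr_ge0.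
have th0 := log_tail_ge0 b0 y0.
have := lerXn2r 2 _ _ (log_tail_le b0 y0).
rewrite !nnegrE th0 mulr_ge0 ?expR_ge0// => /(_ isT isT) h2.
apply: (le_trans (ler_wpM2l (expR_ge0 _) h2)).
rewrite exprMn -expRM_natl mulrCA -mulrA -!expRD.
by rewrite (_ : 4 ^+ 2 = 16); [rewrite ler_wpM2l// ler_expR; lra|ring].
Qed.

(* Markov's inequality: [1 - e^{-y/T} >= 1 - 1/e] for [y >= T]. *)
Lemma laplace_tail (p : R -> R) T : (forall y, 0 <= p y) ->
  (forall y, y <= 0 -> p y = 0) -> L1 mu p -> 0 < T ->
  L1 mu (p \_ `[T, +oo[) /\
  \int[mu]_y (p \_ `[T, +oo[) y <=
    markov_cst * (\int[mu]_y p y - lap T^-1 p).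
Proof.
move=> p0 p_0 Lp T0.
have pc : p = causal p.
  by apply/funext => y; rewrite /causal; case: ltP => // /p_0.
have mp : measurable_fun setT (causal p) by rewrite -pc; exact: L1_meas Lp.
have Lw : L1 mu (weight T^-1 p).
  apply: L1_le Lp => [|y]; first exact: measurable_weight.
  rewrite weight_causal /causal; case: ltP => y0; last by rewrite normr0.
  rewrite ger0_norm ?mulr_ge0 ?expR_ge0// ler_piMl//.
  by rewrite -expR0 ler_expR oppr_le0 mulr_ge0// ?invr_ge0 ltW.
have Lt : L1 mu (p \_ `[T, +oo[).
  apply: (L1_le _ _ Lp).
    by apply/(measurable_restrictT _ _).1 => //; apply: measurable_funTS; exact: L1_meas Lp.
  by move=> y; rewrite patchE; case: ifP => _; rewrite ?ger0_norm ?normr0.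
split => //.
rewrite -IB// -IZ; last exact: L1B.
apply: le_I => //; first by apply: L1Z; exact: L1B.
move=> y; rewrite patchE mem_setE in_itv/= andbT {2}pc weight_causal /causal.
have k0 := markov_cst_gt0.
case: (leP T y) => Ty.
  rewrite (lt_le_trans T0 Ty) -{2}[p y]mul1r -mulrBl mulrA ler_peMl//.
  rewrite -[leLHS]markov_cstE ler_wpM2l//; first exact: ltW.
  by rewrite lerB// ler_expR lerN2 mulrC ler_pdivlMr// mul1r.
case: ltP => y0; last by rewrite subrr mulr0.
apply: mulr_ge0; first exact: ltW.
rewrite -{1}[p y]mul1r -mulrBl mulr_ge0// subr_ge0.
by rewrite -expR0 ler_expR oppr_le0 mulr_ge0// ?invr_ge0 ltW.
Qed.

(** The transform at 1 / T is exp(- s log_tail(T)), and 1 - e^(-x) <= x. *)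
Lemma gamma_density_tail b s T : 0 < b -> 0 < s -> 0 < T ->
  \int[mu]_y (gamma_density b s \_ `[T, +oo[) y <= markov_cst * (s * log_tail b T).
Proof.
move=> b0 s0 T0.
have [_] := @laplace_tail (gamma_density b s) T
  (fun y => gamma_density_ge0 y b0 s0) (fun y => @gamma_density0 R b s y)
  (L1_gamma_density b0 s0) T0.
move/le_trans; apply; rewrite ler_wpM2l ?(ltW markov_cst_gt0)//.
rewrite I_gamma_density// (lap_gamma_density _ b0 s0).2 ?invr_ge0 ?(ltW T0)//.
have -> : T^-1 / b = 1 / (b * T) by rewrite div1r invfM mulrC.
have := expR_ge1Dx (- (s * log_tail b T)); rewrite /log_tail; lra.
Qed.

(** Frullani's integral: (1 - e^(-lz)) / z is the integral of e^(-sz) for s in [0, l]. Integrating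
    in [z] first leaves 1 / (b + s). *)
Lemma frullani b l : 0 < b -> 0 < l ->
  L1 mu (causal (fun z => expR (- (b * z)) * (1 - expR (- (l * z))) / z)) /\
  \int[mu]_z causal (fun z => expR (- (b * z)) * (1 - expR (- (l * z))) / z) z
    = ln (1 + l / b).
Proof.
move=> b0 l0.
pose F (w : R * R) : R := \1_(`]0, +oo[%classic : set R) w.1 *
  (\1_(`[0, l]%classic : set R) w.2 * expR (- ((b + w.2) * w.1))).
have mF : measurable_fun setT F.
  apply: measurable_funM.
    by apply: (measurableT_comp (@measurable_indic _ _ _ _ _ _)).
  apply: measurable_funM.
    by apply: (measurableT_comp (@measurable_indic _ _ _ _ _ _)).
  apply: measurableT_comp => //; apply: measurableT_comp => //.
  by apply: measurable_funM => //; apply: measurable_funD.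
have F0 w : 0 <= F w by rewrite !mulr_ge0// expR_ge0.
have FE z s : F (z, s) = \1_(`[0, l]%classic : set R) s *
    causal (fun z => expR (- ((b + s) * z))) z.
  rewrite /F/= /causal indicE mem_setE in_itv/= andbT mulrCA.
  by case: ltP => _; rewrite ?mul1r ?mul0r.
have bs s : (\1_(`[0, l]%classic : set R) s : R) != 0 -> 0 < b + s.
  rewrite indicE mem_setE in_itv/=; case: (leP 0 s) => s0; last by rewrite eqxx.
  by move=> _; rewrite ltr_wpDr.
have LF s : L1 mu (fun z => F (z, s)).
  under eq_fun do rewrite FE.
  have [->|/bs h] := eqVneq (\1_(`[0, l]%classic : set R) s : R) 0.
    under eq_fun do rewrite mul0r; exact: L1_0.
  by apply: L1Z; exact: (expR_halfline h).1.
have IF s : \int[mu]_z `|F (z, s)| = ((fun s => (b + s)^-1) \_ `[0, l]) s.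
  under eq_I do rewrite ger0_norm// FE.
  rewrite patchE.
  have [E|/[dup] E /bs h] := eqVneq (\1_(`[0, l]%classic : set R) s : R) 0.
    under eq_I do rewrite E mul0r.
    rewrite I_0.
    by move: E; rewrite indicE; case: (_ \in _) => // /eqP; rewrite oner_eq0.
  rewrite IZ; last exact: (expR_halfline h).1.
  rewrite (expR_halfline h).2.
  by move: E; rewrite indicE; case: (_ \in _); rewrite ?eqxx// mul1r.
have dln s : 0 <= s <= l -> is_derive s 1 (fun s => ln (b + s)) ((b + s)^-1).
  move=> /andP[s0 sl]; have h : 0 < b + s by rewrite ltr_wpDr.
  have := is_derive1_ln h => dln.
  by apply: is_derive_eq; rewrite /GRing.scale/= add0r mulr1.
have I1E : (\int[mu]_s (((fun s => (b + s)^-1) \_ `[0%R, l]) s)%:E =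
    (ln (1 + l / b))%:E)%E.
  rewrite integral_restrict (integral_FTC l0 dln).
    rewrite addr0 -ln_div ?posrE ?addr_gt0//.
    by rewrite mulrDl divff ?gt_eqF.
  move=> s /andP[s0 _]; apply: continuousV.
    by rewrite gt_eqF// ltr_wpDr.
  by apply: continuousD; [exact: cvg_cst|exact: cvg_id].
have [||| LI II] := @L1_bound _ _ _ mu ((fun s => (b + s)^-1) \_ `[0, l]) (ln (1 + l / b)).
- apply/(measurable_restrictT _ _).1 => //.
  apply: (@measurable_funS _ _ _ _ (`](- b), +oo[%classic : set R)) => //.
    move=> s /=; rewrite !in_itv/= andbT => /andP[s0 _].
    by apply: lt_le_trans s0; rewrite oppr_lt0.
  apply: open_continuous_measurable_fun => // s; rewrite inE/= in_itv/= andbT => sb.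
  apply: continuousV; first by rewrite gt_eqF// -ltrBlDl sub0r.
  by apply: continuousD; [exact: cvg_cst|exact: cvg_id].
- move=> s; rewrite patchE mem_setE in_itv/=; case: ifP => // /andP[s0 _].
  by rewrite invr_ge0 addr_ge0// ltW.
- by rewrite I1E.
have [|L2 _ FF _] := @fubini_real _ _ _ _ R mu mu F mF LF.
  by rewrite (_ : (fun _ => _) = (fun s => (b + s)^-1) \_ `[0, l])//; exact/funext.
have inner z : \int[mu]_s F (z, s) =
    causal (fun z => expR (- (b * z)) * (1 - expR (- (l * z))) / z) z.
  rewrite /causal; case: ltP => z0; last first.
    under eq_I do rewrite FE /causal ltNge z0/= mulr0.
    by rewrite I_0.
  apply: EFin_inj; rewrite -integral_EFin.
    have -> : (\int[mu]_s (F (z, s))%:E = \int[mu]_s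
        (((fun s => expR (- ((b + s) * z))) \_ `[0%R, l]) s)%:E)%E.
      apply: eq_integral => s _; congr (_%:E); rewrite FE /causal z0 indicE patchE.
      by case: (_ \in _); rewrite ?mul1r ?mul0r.
    rewrite integral_restrict.
    have de s : 0 <= s <= l -> is_derive s 1 (fun s => - z^-1 * expR (- ((b + s) * z)))
        (expR (- ((b + s) * z))).
      move=> _; apply: is_derive_eq; rewrite /GRing.scale/=; field.
      by rewrite gt_eqF.
    rewrite (integral_FTC l0 de).
      congr (_%:E); rewrite addr0 mulrDl opprD expRD; field.
      by rewrite gt_eqF.
    move=> s _; apply: continuous_comp; last exact: continuous_expR.
    apply: continuousN; apply: continuousM; last exact: cvg_cst.
    by apply: continuousD; [exact: cvg_cst|exact: cvg_id].
  apply: (@L1_le _ _ _ mu _ (\1_(`[0, l]%classic : set R))).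
  - by apply: (measurableT_comp mF); exact: measurable_pair1.
  - move=> s; rewrite FE.
    have [->|/[dup] E /bs h] := eqVneq (\1_(`[0, l]%classic : set R) s : R) 0.
      rewrite mul0r normr0; exact: lexx.
    have i0 : 0 <= (\1_(`[0, l]%classic : set R) s : R) by rewrite indicE.
    rewrite /causal z0 ger0_norm; last by rewrite mulr_ge0// expR_ge0.
    apply: ler_piMr; first exact: i0.
    rewrite -expR0 ler_expR oppr_le0; apply: mulr_ge0; apply: ltW; first exact: h.
    exact: z0.
  - exact: integrable_indic_itv.
rewrite (_ : (fun x => \int[mu]_y F (x, y)) = causal
  (fun z => expR (- (b * z)) * (1 - expR (- (l * z))) / z)) in L2; last exact/funext.
split; first exact: L2.
transitivity (\int[mu]_z \int[mu]_s F (z, s)).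
  by apply: eq_I => z; rewrite inner.
rewrite FF; transitivity (\int[mu]_s ((fun s => (b + s)^-1) \_ `[0, l]) s).
  by apply: eq_I => s; rewrite -IF; apply: eq_I => z; rewrite ger0_norm.
by apply: EFin_inj; rewrite -integral_EFin.
Qed.

(** An indicator depending on [z - y] over a fixed domain makes the integrand jointly measurable in
    [y] and [z], as Fubini's theorem requires. *)
Lemma levy_tailE a b y : 0 < y -> levy_tail a b y =
  a * \int[mu]_z (\1_(`]0, +oo[%classic : set R) (z - y) * (expR (- (b * z)) / z)).
Proof.
move=> y0; rewrite /levy_tail Rintegral_mkcond; congr (_ * _); apply: eq_I => z.
rewrite patchE indicE !mem_setE !in_itv/= !andbT subr_gt0.
by case: ifP => _; rewrite ?mul1r ?mul0r.
Qed.

Lemma expR_interval (z l : R) : 0 < l ->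
  L1 mu ((fun y => expR (- (l * y))) \_ `]0, z[) /\
  (0 < z -> \int[mu]_y ((fun y => expR (- (l * y))) \_ `]0, z[) y =
    (1 - expR (- (l * z))) / l).
Proof.
move=> l0; have Le : L1 mu ((fun y => expR (- (l * y))) \_ `]0, z[).
  apply: (L1_le _ _ (expR_halfline l0).1).
    apply/(measurable_restrictT _ _).1 => //; apply: measurable_funTS.
    by apply: measurableT_comp => //; apply: measurableT_comp.
  move=> y; rewrite patchE mem_setE in_itv/= /causal.
  case: (ltP 0 y) => /= y0; last by rewrite normr0.
  by case: ifP => _; rewrite ?normr0 ?expR_ge0// ger0_norm ?expR_ge0.
split => //.
move=> z0; apply: EFin_inj; rewrite -integral_EFin// integral_restrict.
have ce : continuous (fun y : R => expR (- (l * y))).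
  move=> y; apply: continuous_comp; last exact: continuous_expR.
  by apply: continuousN; exact: mulrl_continuous.
have mce : measurable_fun (`]0, z[%classic : set R) (fun y => (expR (- (l * y)))%:E).
  by apply/measurable_EFinP; apply: measurable_funTS; exact: continuous_measurable_fun.
rewrite -(@integral_itv_bndoo _ 0 z (fun y => (expR (- (l * y)))%:E) true false mce).
have de s : 0 <= s <= z -> is_derive s 1 (fun s => - l^-1 * expR (- (l * s)))
    (expR (- (l * s))).
  move=> _; apply: is_derive_eq; rewrite /GRing.scale/=; field.
  by rewrite gt_eqF.
rewrite (integral_FTC z0 de); last by move=> s _; exact: ce.
by congr (_%:E); rewrite mulr0 oppr0 expR0; field; rewrite gt_eqF.
Qed.

Lemma measurable_levy_density b :
  measurable_fun setT (causal (fun z => expR (- (b * z)) / z)).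
Proof.
apply: measurable_causal_continuous => z; rewrite in_itv/= andbT => z0.
apply: (@continuousM _ _ (fun z => expR (- (b * z))) (fun z => z^-1)); last first.
  by apply: continuousV; [rewrite gt_eqF|exact: cvg_id].
apply: continuous_comp; last exact: continuous_expR.
by apply: continuousN; exact: mulrl_continuous.
Qed.

Lemma measurable_levy_tail_integrand b y : 0 < y -> measurable_fun setT
  (fun z : R => \1_(`]0, +oo[%classic : set R) (z - y) * (expR (- (b * z)) / z)).
Proof.
move=> y0; rewrite (_ : (fun _ => _) = fun z =>
    \1_(`]0, +oo[%classic : set R) (z - y) * causal (fun z => expR (- (b * z)) / z) z).
  apply: measurable_funM; last exact: measurable_levy_density.
  apply: (measurableT_comp (@measurable_indic _ _ _ _ _ _)) => //.
  exact: measurable_funB.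
apply/funext => z; rewrite /causal indicE mem_setE in_itv/= andbT subr_gt0.
case: ltP => yz; last by rewrite !mul0r.
by rewrite (lt_trans y0 yz).
Qed.

Lemma L1_levy_tail_integrand b y : 0 < b -> 0 < y -> L1 mu
  (fun z : R => \1_(`]0, +oo[%classic : set R) (z - y) * (expR (- (b * z)) / z)).
Proof.
move=> b0 y0; apply: (L1_le _ _ (L1Z y^-1 (expR_halfline b0).1)).
  exact: measurable_levy_tail_integrand.
move=> z; rewrite /causal indicE mem_setE in_itv/= andbT subr_gt0.
case: ltP => yz; last first.
  rewrite mul0r normr0 mulr_ge0 ?invr_ge0 ?(ltW y0)//.
  by case: ifP => _ //; exact: expR_ge0.
have z0 := lt_trans y0 yz.
rewrite z0 mul1r ger0_norm; last by rewrite divr_ge0 ?expR_ge0// ltW.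
by rewrite mulrC ler_wpM2r ?expR_ge0// lef_pV2 ?posrE// ltW.
Qed.

(** After exchanging the integrals, the integral of e^(-ly) over y < z is (1 - e^(-lz)) / l, which
    leaves Frullani's integral. *)
Lemma lap_levy_tail a b l : 0 < b -> 0 < l ->
  L1 mu (weight l (levy_tail a b)) /\ lap l (levy_tail a b) = Phi a b l / l.
Proof.
move=> b0 l0.
pose F (w : R * R) : R := (\1_(`]0, +oo[%classic : set R) w.1 * expR (- (l * w.1))) *
  (\1_(`]0, +oo[%classic : set R) (w.2 - w.1) *
   causal (fun z => expR (- (b * z)) / z) w.2).
have mpi : measurable_fun setT (causal (fun z => expR (- (b * z)) / z)).
  exact: measurable_levy_density.
have pi0 z : 0 <= causal (fun z => expR (- (b * z)) / z) z.
  by rewrite /causal; case: ltP => // z0; rewrite divr_ge0 ?expR_ge0// ltW.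
have mF : measurable_fun setT F.
  apply: measurable_funM; apply: measurable_funM.
  - by apply: (measurableT_comp (@measurable_indic _ _ _ _ _ _)).
  - apply: measurableT_comp => //; apply: measurableT_comp => //.
    exact: measurable_funM.
  - apply: (measurableT_comp (@measurable_indic _ _ _ _ _ _)) => //.
    exact: measurable_funB.
  - exact: (measurableT_comp mpi).
have F0 w : 0 <= F w by rewrite !mulr_ge0// expR_ge0.
have FE y z : F (y, z) = causal (fun z => expR (- (b * z)) / z) z *
    ((fun y => expR (- (l * y))) \_ `]0, z[) y.
  rewrite /F/= patchE !indicE !mem_setE !in_itv/= !andbT subr_gt0.
  by case: ltP => _; case: ltP => _; rewrite /= ?mul1r ?mul0r ?mulr0// mulrC.
have Le z : L1 mu ((fun y => expR (- (l * y))) \_ `]0, z[).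
  exact: (expR_interval z l0).1.
have Ie z : 0 < z -> \int[mu]_y ((fun y => expR (- (l * y))) \_ `]0, z[) y =
    (1 - expR (- (l * z))) / l.
  by move=> z0; exact: (expR_interval z l0).2.
have LF z : L1 mu (fun y => F (y, z)).
  by under eq_fun do rewrite FE; exact: L1Z.
have IF z : \int[mu]_y F (y, z) =
    l^-1 * causal (fun z => expR (- (b * z)) * (1 - expR (- (l * z))) / z) z.
  under eq_I do rewrite FE.
  rewrite IZ// /causal; case: ltP => z0; last by rewrite mul0r mulr0.
  by rewrite Ie//; field; rewrite !gt_eqF.
have [Lf If] := frullani b0 l0.
have [|L2 _ FF _] := @fubini_real _ _ _ _ R mu mu F mF LF.
  under eq_fun do (under eq_I do rewrite ger0_norm//).
  by under eq_fun do rewrite IF; exact: L1Z.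
have wE y : weight l (levy_tail a b) y = a * \int[mu]_z F (y, z).
  rewrite weight_causal /causal; case: ltP => y0; last first.
    under eq_I do rewrite /F/= indicE mem_setE in_itv/= andbT ltNge y0/= !mul0r.
    by rewrite I_0 mulr0.
  rewrite (levy_tailE _ _ y0) mulrCA; congr (_ * _).
  rewrite -(IZ _ (L1_levy_tail_integrand b0 y0)); apply: eq_I => z.
  rewrite /F/= (_ : \1_(`]0, +oo[%classic : set R) y = 1 :> R); last first.
    by rewrite indicE mem_setE in_itv/= y0.
  rewrite mul1r; congr (_ * _).
  rewrite indicE mem_setE in_itv/= andbT subr_gt0 /causal.
  case: ltP => yz; last by rewrite !mul0r.
  by rewrite (lt_trans y0 yz).
have WE : weight l (levy_tail a b) = fun y => a * \int[mu]_z F (y, z) by exact/funext.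
rewrite /lap WE; split; first exact: L1Z.
rewrite (IZ _ L2) FF; under eq_I do rewrite IF.
rewrite (IZ _ Lf) If /Phi; ring.
Qed.

Lemma levy_tail_ge0 a b y : 0 <= a -> 0 < y -> 0 <= levy_tail a b y.
Proof.
move=> a0 y0; rewrite levy_tailE// mulr_ge0//; apply: I_ge0 => z.
rewrite indicE mem_setE in_itv/= andbT subr_gt0.
case: ltP => yz; rewrite ?mul0r// mul1r divr_ge0 ?expR_ge0//.
by rewrite ltW// (lt_trans y0 yz).
Qed.

(** Markov's inequality for the Levy measure: 1 - e^(-z/y) is at least 1 - 1/e for z > y, and its
    integral is Frullani's with l = 1 / y. *)
Lemma levy_tail_le a b y : 0 <= a -> 0 < b -> 0 < y ->
  levy_tail a b y <= markov_cst * (a * log_tail b y).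
Proof.
move=> a0 b0 y0; rewrite levy_tailE// mulrCA ler_wpM2l//.
have l0 : 0 < y^-1 by rewrite invr_gt0.
have [Lf If] := frullani b0 l0.
have -> : log_tail b y = ln (1 + y^-1 / b).
  by rewrite /log_tail div1r invfM mulrC.
have k0 := markov_cst_gt0.
rewrite -If -IZ//.
have le z : `|\1_(`]0, +oo[%classic : set R) (z - y) * (expR (- (b * z)) / z)| <=
    markov_cst * causal (fun z => expR (- (b * z)) * (1 - expR (- (y^-1 * z))) / z) z.
  rewrite /causal indicE mem_setE in_itv/= andbT subr_gt0.
  case: ltP => yz; last first.
    rewrite mul0r normr0 mulr_ge0// ?(ltW k0)//; case: ltP => // z0.
    rewrite divr_ge0// ?(ltW z0)// mulr_ge0 ?expR_ge0// subr_ge0.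
    by rewrite -expR0 ler_expR oppr_le0 mulr_ge0// ltW.
  have z0 := lt_trans y0 yz.
  rewrite z0 mul1r ger0_norm; last by rewrite divr_ge0 ?expR_ge0// ltW.
  rewrite mulrA ler_wpM2r ?invr_ge0 ?(ltW z0)// mulrCA ler_peMr ?expR_ge0//.
  rewrite -[leLHS]markov_cstE ler_wpM2l//; first exact: ltW.
  by rewrite lerB// ler_expR lerN2 ler_pdivlMl// mulr1 ltW.
apply: (le_trans (ler_norm _)).
apply: (@I_bound _ _ _ mu _ _ _ le (L1Z markov_cst Lf)).
exact: measurable_levy_tail_integrand.
Qed.

End levy_tail.

(** * The Caputo-Dzherbashian operator *)

Section scaling.
Context d (T : measurableType d) (R : realType) (m : {measure set T -> \bar R}).

(** A measurable function with finite integral is integrable, so here the extended integral is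
    infinite and [fine] sends it to 0. Scaling therefore holds without integrability, in particular
    at the times where a convolution diverges. *)
Lemma I_not_L1 (u : T -> R) : measurable_fun setT u -> ~ L1 m u ->
  \int[m]_x u x = 0.
Proof.
move=> mu nL; have := integral_fin_num_abs m measurableT mu.
rewrite /Rintegral; case: (\int[m]_x (u x)%:E)%E => //= r.
move=> /idP h; exfalso; apply: nL; apply/integrableP; split => //.
exact/measurable_EFinP.
Qed.

Lemma IZ_measurable k (u : T -> R) : measurable_fun setT u ->
  \int[m]_x (k * u x) = k * \int[m]_x u x.
Proof.
move=> mu; have [->|k0] := eqVneq k 0.
  by rewrite mul0r -[RHS](I_0 m); apply: eq_I => x; rewrite mul0r.
have [Lu|nLu] := pselect (L1 m u); first exact: IZ.
rewrite (I_not_L1 mu nLu) mulr0; apply: I_not_L1.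
  exact: measurable_funM.
move=> Lku; apply: nLu; have := L1Z k^-1 Lku.
by under eq_fun do rewrite mulKf//.
Qed.

Lemma ae_imp (P Q : T -> Prop) : {ae m, forall x, P x} ->
  (forall x, P x -> Q x) -> {ae m, forall x, Q x}.
Proof. by move=> aeP PQ; apply: filterS aeP. Qed.

Lemma ae_imp2 (P Q S : T -> Prop) : {ae m, forall x, P x} ->
  {ae m, forall x, Q x} -> (forall x, P x -> Q x -> S x) ->
  {ae m, forall x, S x}.
Proof. by move=> aeP aeQ PQ; apply: filterS2 aeP aeQ. Qed.

End scaling.

Section laplace_convolution.
Context (R : realType).
Notation mu := (@lebesgue_measure R).
Implicit Types (u v phi : R -> R) (l t : R).

Lemma causalE u t : 0 < t -> causal u t = u t.
Proof. by rewrite /causal => ->. Qed.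

Lemma causal0 u t : t <= 0 -> causal u t = 0.
Proof. by rewrite /causal ltNge => ->. Qed.

Lemma causal_ge0 u t : (forall s, 0 < s -> 0 <= u s) -> 0 <= causal u t.
Proof. by move=> u0; rewrite /causal; case: ifP => // /u0. Qed.

Lemma conv_causal u v t :
  conv (causal u) (causal v) t = \int[mu]_(y in `]0, t[) (u (t - y) * v y).
Proof.
rewrite Rintegral_mkcond /conv; apply: eq_I => y.
rewrite /causal patchE mem_setE in_itv/= subr_gt0.
by case: ltP => _; case: ltP => _; rewrite /= ?mul0r ?mulr0.
Qed.

Lemma caputo_conv a b phi t : caputo_dzherbashian a b phi t =
  conv (causal (derive1 phi)) (causal (levy_tail a b)) t.
Proof. by rewrite conv_causal. Qed.

Lemma measurable_causal_weight l u :
  measurable_fun setT (weight l u) -> measurable_fun setT (causal u).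
Proof.
move=> mw; rewrite (_ : causal u = fun t => expR (l * t) * weight l u t).
  by apply: measurable_funM => //; apply: measurableT_comp.
by apply/funext => t; rewrite /weight mulrA -expRD subrr expR0 mul1r.
Qed.

(** Because e^(-lt) = e^(-l(t - y)) e^(-ly). It holds at every [t], a divergent convolution being 0
    on both sides. *)
Lemma weight_conv l u v t : measurable_fun setT (causal u) ->
  measurable_fun setT (causal v) ->
  conv (weight l u) (weight l v) t =
  weight l (conv (causal u) (causal v)) t.
Proof.
move=> mu_ mv; rewrite /weight /causal; case: ltP => t0; last first.
  rewrite mulr0 -[RHS](I_0 mu) /conv; apply: eq_I => y.
  rewrite subr_gt0; case: (ltP y t) => yt; last by rewrite mulr0 mul0r.
  by rewrite (ltNge 0 y) (le_trans (ltW yt) t0)/= !mulr0.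
rewrite -/(causal u) -/(causal v) -IZ_measurable.
  apply: eq_I => y; rewrite -/(causal u (t - y)) -/(causal v y).
  rewrite mulrACA -expRD; congr (expR _ * _); ring.
apply: measurable_funM => //; apply: (measurableT_comp mu_).
exact: measurable_funB.
Qed.

Lemma lap_conv l u v : L1 mu (weight l u) -> L1 mu (weight l v) ->
  [/\ L1 mu (weight l (conv (causal u) (causal v))),
      lap l (conv (causal u) (causal v)) = lap l u * lap l v &
      {ae mu, forall t, L1 mu (fun y => causal u (t - y) * causal v y)}].
Proof.
move=> Lu Lv; have mu_ := measurable_causal_weight (L1_meas Lu).
have mv := measurable_causal_weight (L1_meas Lv).
have [Lc Ic aec] := conv_L1 Lu Lv.
have E : conv (weight l u) (weight l v) = weight l (conv (causal u) (causal v)).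
  by apply/funext => t; exact: weight_conv.
rewrite E in Lc Ic; split => //.
apply: (ae_imp aec) => t /(L1Z (expR (l * t))).
congr (L1 mu _); apply/funext => y.
have -> : expR (l * t) * (weight l u (t - y) * weight l v y) =
    expR (l * t) * expR (- (l * (t - y))) * expR (- (l * y)) *
    (causal u (t - y) * causal v y) by rewrite /weight; ring.
rewrite -!expRD (_ : l * t + - (l * (t - y)) + - (l * y) = 0); last by ring.
by rewrite expR0 mul1r.
Qed.

Lemma lap_cst l (c : R) : 0 < l -> lap l (fun=> c) = c / l.
Proof.
move=> l0; rewrite /lap -(expR_halfline l0).2 -IZ; last exact: (expR_halfline l0).1.
apply: eq_I => t; rewrite weight_causal /causal.
by case: ifP => _; rewrite ?mulr0// mulrC.
Qed.

Lemma L1_weight_cst l (c : R) : 0 < l -> L1 mu (weight l (fun=> c)).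
Proof.
move=> l0; apply: (@L1_weight _ _ _ `|c|) => //.
by apply: measurable_causal_continuous => x _; exact: cvg_cst.
Qed.

Definition primitive u t := \int[mu]_(y in `]0, t[) u y.

Lemma primitive_conv u t : primitive u t = conv (causal (fun=> 1)) (causal u) t.
Proof. by rewrite conv_causal; apply: eq_Rintegral => y _; rewrite mul1r. Qed.

Lemma lap_primitive l u : 0 < l -> L1 mu (weight l u) ->
  L1 mu (weight l (primitive u)) /\ lap l (primitive u) = lap l u / l.
Proof.
move=> l0 Lu.
have -> : primitive u = conv (causal (fun=> 1)) (causal u).
  by apply/funext => t; rewrite primitive_conv.
have [? -> _] := lap_conv (L1_weight_cst 1 l0) Lu; split => //.
by rewrite lap_cst// div1r mulrC.
Qed.

End laplace_convolution.

Section caputo_laplace.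
Context (R : realType).
Notation mu := (@lebesgue_measure R).
Variables (phi : R -> R) (phi0 : R).
Hypothesis phiC1 : C1 phi.
Hypothesis phiL1 : L1 mu (causal (derive1 phi)).
Hypothesis phi_0 : phi t @[t --> 0^'+] --> phi0.

Lemma C1_increment s t : 0 < s -> s < t ->
  L1 mu ((derive1 phi) \_ `[s, t]) /\
  \int[mu]_y ((derive1 phi) \_ `[s, t]) y = phi t - phi s.
Proof.
move=> s0 st; have [dphi cphi] := phiC1.
have L : L1 mu ((derive1 phi) \_ `[s, t]).
  apply: (L1_le _ _ (L1_abs phiL1)).
    rewrite (_ : _ \_ _ = (causal (derive1 phi)) \_ `[s, t]).
      apply/(measurable_restrictT _ _).1 => //; apply: measurable_funTS.
      exact: L1_meas phiL1.
    apply/funext => y; rewrite !patchE mem_setE in_itv/= /causal.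
    by case: ifP => // /andP[/(lt_le_trans s0) ->].
  move=> y; rewrite patchE mem_setE in_itv/= /causal.
  by case: ifP => [/andP[/(lt_le_trans s0) ->//]|_]; rewrite normr0.
split => //; apply: EFin_inj; rewrite -integral_EFin// integral_restrict.
apply: integral_FTC => // x /andP[sx xt].
  have x0 := lt_le_trans s0 sx.
  have dx : derivable phi x 1 by apply: dphi; rewrite in_itv/= andbT.
  by rewrite derive1E; apply/derivableP.
by apply: cphi; rewrite in_itv/= andbT; exact: lt_le_trans sx.
Qed.

(** The fundamental theorem on [t / (n + 2), t], then n -> oo; the initial value that appears is the
    right limit [phi0], whatever [phi 0] may be. *)
Lemma C1_primitive t : 0 < t -> phi t = phi0 + primitive (derive1 phi) t.
Proof.
move=> t0.
pose s n := t / n.+2%:R.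
have s0 n : 0 < s n by rewrite divr_gt0.
have st n : s n < t by rewrite ltr_pdivrMr// ltr_pMr// ltr1n.
have scvg : s n @[n --> \oo] --> (0 : R).
  rewrite -[X in _ --> X](mulr0 t); apply: cvgM; first exact: cvg_cst.
  by have := @cvg_harmonic R; rewrite -cvg_shiftS; exact.
have [||||_ cv] := @dct _ _ _ mu (fun n => (derive1 phi) \_ `[s n, t])
   ((derive1 phi) \_ `]0, t]) (fun y => `|causal (derive1 phi) y|).
- by move=> n; exact: L1_meas (C1_increment (s0 n) (st n)).1.
- move=> n y; rewrite patchE mem_setE in_itv/= /causal.
  by case: ifP => [/andP[/(lt_le_trans (s0 n)) ->//]|_]; rewrite normr0.
- exact: L1_abs.
- move=> y; rewrite patchE mem_setE in_itv/=.
  have [y0|y0] := ltP 0 y; last first.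
    rewrite /= (_ : (fun n => _) = fun=> 0); first exact: cvg_cst.
    apply/funext => n; rewrite patchE mem_setE in_itv/=.
    by rewrite leNgt (le_lt_trans y0).
  apply: cvg_near_cst; near=> n.
  rewrite patchE mem_setE in_itv/= (_ : s n <= y)//.
  near: n; move/cvgrPdist_lt : scvg => /(_ y y0); apply: filterS => n.
  by rewrite sub0r normrN gtr0_norm// => /ltW.
have cv2 : \int[mu]_y ((derive1 phi) \_ `[s n, t]) y @[n --> \oo] --> phi t - phi0.
  under eq_fun do rewrite (C1_increment (s0 _) (st _)).2.
  apply: cvgB; first exact: cvg_cst.
  by move/cvg_at_rightP : phi_0; apply.
have E : \int[mu]_y ((derive1 phi) \_ `]0, t]) y = primitive (derive1 phi) t.
  rewrite -Rintegral_mkcond /primitive -Rintegral_itv_bndo_bndc//.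
  apply: (integrableS _ _ _ ((L1_causal _).1 phiL1)) => //.
  by move=> y /=; rewrite !in_itv/= => /andP[->].
by rewrite -E (cvg_unique _ cv cv2)// addrC subrK.
Unshelve. all: by end_near. Qed.

Lemma L1_weight_L1 l (u : R -> R) : 0 <= l -> L1 mu (causal u) -> L1 mu (weight l u).
Proof.
move=> l0 Lu; apply: (L1_le _ _ (L1_abs Lu)).
  by apply: measurable_weight; exact: L1_meas Lu.
move=> t; rewrite weight_causal /causal; case: ltP => t0; last by rewrite normr0.
rewrite normrM ger0_norm ?expR_ge0// ler_piMl//.
by rewrite -expR0 ler_expR oppr_le0 mulr_ge0// ltW.
Qed.

Lemma lap_C1 l : 0 < l -> l * lap l phi = phi0 + lap l (derive1 phi).
Proof.
move=> l0; have Lw := L1_weight_L1 (ltW l0) phiL1.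
have [Lp Ip] := lap_primitive l0 Lw.
have -> : lap l phi = lap l (fun=> phi0) + lap l (primitive (derive1 phi)).
  rewrite /lap -ID//; last exact: L1_weight_cst.
  apply: eq_I => t; rewrite !weight_causal /causal; case: ltP => t0.
    by rewrite -mulrDr C1_primitive.
  by rewrite addr0.
by rewrite Ip lap_cst// mulrDr; congr (_ + _); field; rewrite gt_eqF.
Qed.

(** The operator is the convolution of phi' with the Levy tail, whose transforms are l lap(phi) -
    phi0 and Phi(l) / l. *)
Lemma lap_caputo a b l : 0 < b -> 0 < l ->
  L1 mu (weight l (caputo_dzherbashian a b phi)) /\
  lap l (caputo_dzherbashian a b phi) = Phi a b l * (lap l phi - phi0 / l).
Proof.
move=> b0 l0.
have -> : caputo_dzherbashian a b phi =
    conv (causal (derive1 phi)) (causal (levy_tail a b)).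
  by apply/funext => t; exact: caputo_conv.
have [Lt It] := @lap_levy_tail R a b l b0 l0.
have [? -> _] := lap_conv (L1_weight_L1 (ltW l0) phiL1) Lt; split => //.
rewrite It (_ : lap l (derive1 phi) = l * lap l phi - phi0).
  by field; rewrite gt_eqF.
by rewrite lap_C1// addrC addKr.
Qed.

(** Young's inequality for L1 and L2, by Cauchy-Schwarz with weight |phi'|: the square of the
    convolution is at most the L1 norm of phi' times the convolution of |phi'| with the squared Levy
    tail. The latter has a finite transform, its singularity being a squared logarithm. *)
Lemma caputo_L2 a b : 0 <= a -> 0 < b ->
  L1 mu (weight 1 (fun t => caputo_dzherbashian a b phi t ^+ 2)).
Proof.
move=> a0 b0; have l1 : 0 < 1 :> R by [].
have La := L1_abs phiL1.
have Eabs : (fun t => `|causal (derive1 phi) t|) = causal (fun t => `|derive1 phi t|).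
  by apply/funext => t; rewrite /causal; case: ifP => // _; rewrite normr0.
rewrite Eabs in La.
pose A := \int[mu]_t causal (fun t => `|derive1 phi t|) t.
have Lt2 : L1 mu (weight 1 (fun y => levy_tail a b y ^+ 2)).
  apply: (L1_le _ _ (L1Z ((markov_cst R * a) ^+ 2) (L1_weight_log_tail_sq b0 l1))).
    apply: measurable_weight.
    rewrite (_ : causal _ = fun y => causal (levy_tail a b) y ^+ 2).
      apply: measurable_funX; apply: measurable_causal_weight.
      exact: L1_meas (lap_levy_tail a b0 l1).1.
    by apply/funext => y; rewrite /causal; case: ifP => // _; rewrite expr0n.
  move=> y; rewrite !weight_causal /causal; case: ltP => y0; last first.
    by rewrite normr0 mulr0.
  rewrite ger0_norm; last by rewrite mulr_ge0 ?expR_ge0// sqr_ge0.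
  rewrite [leRHS]mulrCA; apply: ler_wpM2l; first exact: expR_ge0.
  rewrite -exprMn -mulrA; apply: lerXn2r; rewrite ?nnegrE ?levy_tail_ge0//.
    by rewrite !mulr_ge0 ?log_tail_ge0// ltW// markov_cst_gt0.
  exact: levy_tail_le.
have [Lc _ aec] := lap_conv (L1_weight_L1 (ltW l1) La) Lt2.
have [Lk _] := lap_caputo a b0 l1.
have [Ld _ aed] := lap_conv (L1_weight_L1 (ltW l1) phiL1) (lap_levy_tail a b0 l1).1.
have mk := measurable_causal_weight (L1_meas Lk).
have [|||||//] := @le_I_ae _ _ _ mu
  (weight 1 (fun t => caputo_dzherbashian a b phi t ^+ 2))
  (fun t => A * weight 1 (conv (causal (fun t => `|derive1 phi t|))
                         (causal (fun y => levy_tail a b y ^+ 2))) t).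
- apply: measurable_weight.
  rewrite (_ : causal _ = fun y => causal (caputo_dzherbashian a b phi) y ^+ 2).
    exact: measurable_funX.
  by apply/funext => y; rewrite /causal; case: ifP => // _; rewrite expr0n.
- move=> t; rewrite weight_causal /causal; case: ifP => // _.
  by rewrite mulr_ge0 ?expR_ge0// sqr_ge0.
- move=> t; apply: mulr_ge0; first by apply: I_ge0 => y; exact: causal_ge0.
  apply: mulr_ge0; first exact: expR_ge0.
  apply: causal_ge0 => s _; apply: I_ge0 => y.
  by apply: mulr_ge0; apply: causal_ge0 => z _; rewrite ?sqr_ge0.
- exact: L1Z.
- apply: (ae_imp2 aec aed) => t hc hd.
  rewrite !weight_causal; have [t0|t0] := ltP 0 t; last first.
    by rewrite !(causal0 _ t0) mulr0.
  rewrite !(causalE _ t0) [leRHS]mulrCA.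
  apply: ler_wpM2l; first exact: expR_ge0.
  rewrite caputo_conv.
  have Lw : L1 mu (fun y => causal (fun t => `|derive1 phi t|) (t - y)).
    exact: L1_reflect.
  have w0 y : 0 <= causal (fun t => `|derive1 phi t|) (t - y).
    by rewrite /causal; case: ifP.
  have mg : measurable_fun setT (causal (levy_tail a b)).
    by apply: measurable_causal_weight; exact: L1_meas (lap_levy_tail a b0 l1).1.
  have sqE y : causal (fun y => levy_tail a b y ^+ 2) y = causal (levy_tail a b) y ^+ 2.
    by rewrite /causal; case: ifP => // _; rewrite expr0n.
  have Lg : L1 mu (fun y => causal (levy_tail a b) y ^+ 2 *
      causal (fun t => `|derive1 phi t|) (t - y)).
    by move: hc; congr (L1 mu _); apply/funext => y; rewrite sqE mulrC.
  have := @weighted_cauchy_schwarz _ _ _ mu _ _ mg Lw w0 Lg.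
  rewrite (I_reflect t La) -/A => h.
  rewrite [X in _ <= _ * X](_ : _ = \int[mu]_y (causal (levy_tail a b) y ^+ 2 *
      causal (fun t => `|derive1 phi t|) (t - y))); last first.
    by apply: eq_I => y; rewrite sqE mulrC.
  apply: le_trans h.
  rewrite -[leLHS]real_normK ?num_real//; apply: lerXn2r; rewrite ?nnegrE//.
    apply: I_ge0 => y; apply: mulr_ge0; last exact: w0.
    by apply: causal_ge0 => s s0; exact: levy_tail_ge0.
  apply: (I_bound (L1_meas hd)) => [y|]; last exact: (@L1_sq _ _ _ mu _ _ mg Lw w0 Lg).
  rewrite normrM mulrC; apply: ler_pM => //.
    rewrite /causal; case: ltP => y0; last by rewrite normr0.
    by rewrite ger0_norm// levy_tail_ge0.
  by rewrite -Eabs.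
Qed.

(** The difference is at most the integral of |phi'| over [t - h, t], which is the convolution of
    |phi'| with the indicator of [0, h]. Times t <= h are left out because phi(t - h) carries no
    information there. *)
Lemma C1_translation h : 0 < h ->
  L1 mu (fun t => if h < t then `|phi t - phi (t - h)| else 0) /\
  \int[mu]_t (if h < t then `|phi t - phi (t - h)| else 0) <=
    (\int[mu]_t `|causal (derive1 phi) t|) * h.
Proof.
move=> h0; have La := L1_abs phiL1.
have Li : L1 mu (\1_(`[0, h]%classic : set R)) by exact: integrable_indic_itv.
have [Lc Ic _] := conv_L1 La Li.
have Ih : \int[mu]_t \1_(`[0, h]%classic : set R) t = h.
  rewrite /Rintegral integral_indic// setIT /= lebesgue_measure_itv/= lte_fin h0.
  by rewrite -EFinB subr0.
rewrite [X in _ * X](_ : _ = \int[mu]_t \1_(`[0, h]%classic : set R) t)// -Ic.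
have [dphi cphi] := phiC1.
have cf : {in `]0, +oo[, continuous phi}.
  move=> t t0; apply: differentiable_continuous; apply/derivable1_diffP.
  exact: dphi.
have mp := measurable_causal_continuous cf.
have E t : (if h < t then `|phi t - phi (t - h)| else 0) =
  (fun t => `|causal phi t - causal phi (t - h)|) \_ `]h, +oo[ t.
  rewrite patchE mem_setE in_itv/= andbT; case: ifP => // ht.
  by rewrite /causal (lt_trans h0 ht) subr_gt0 ht.
have md : measurable_fun setT (fun t => if h < t then `|phi t - phi (t - h)| else 0).
  rewrite (_ : (fun t => _) = (fun t => `|causal phi t - causal phi (t - h)|) \_ `]h, +oo[).
    apply/(measurable_restrictT _ _).1 => //; apply: measurable_funTS.
    apply: measurableT_comp => //; apply: measurable_funB => //.
    by apply: (measurableT_comp mp); exact: measurable_funB.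
  exact/funext.
have le t : `|if h < t then `|phi t - phi (t - h)| else 0| <=
    conv (fun t => `|causal (derive1 phi) t|) (\1_(`[0, h]%classic : set R)) t.
  case: ltP => ht; last first.
    by rewrite normr0; apply: I_ge0 => y; rewrite mulr_ge0// indicE.
  rewrite normr_id.
  have th0 : 0 < t - h by rewrite subr_gt0.
  have tht : t - h < t by rewrite ltrBlDr ltrDl.
  have [L <-] := C1_increment th0 tht.
  apply: (le_trans (I_abs L)).
  rewrite -(I_reflect t (L1_abs L)).
  rewrite le_eqVlt; apply/orP; left; apply/eqP; apply: eq_I => y.
  rewrite patchE indicE !mem_setE !in_itv/=.
  have -> : (t - h <= t - y <= t) = (0 <= y <= h).
    by rewrite lerD2l lerN2 gerBl andbC.
  case: ifP => [/andP[y0 yh]|_]; last by rewrite normr0 mulr0.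
  by rewrite mulr1 /causal subr_gt0 (le_lt_trans yh).
split; first exact: (@L1_le _ _ _ mu _ _ md le Lc).
by apply: le_trans (@I_bound _ _ _ mu _ _ md le Lc); exact: ler_norm.
Qed.

End caputo_laplace.

(** * Integration up to null sets *)

Section null_sets.
Context d (T : measurableType d) (R : realType) (m : {measure set T -> \bar R}).

Import HBNNSimple.

(* No measurability of the integrands: [inverse_process H t] is not known to be
   measurable. *)
Lemma null_integral_le (f g : T -> \bar R) (N : set T) : measurable N ->
  m N = 0%E -> (forall x, 0 <= f x)%E -> (forall x, 0 <= g x)%E ->
  (forall x, ~ N x -> f x = g x) ->
  (\int[m]_x f x <= \int[m]_x g x)%E.
Proof.
move=> mN N0 f0 g0 fg; rewrite !ge0_integralTE//.
apply: ge_ereal_sup => _ [h /= hf <-].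
have mNC : measurable (~` N) by exact: measurableC.
apply: ereal_sup_ge; exists (sintegral m (proj_nnsfun h mNC)).
  exists (proj_nnsfun h mNC) => //= x.
  have [Nx|nNx] := pselect (N x).
    by rewrite mindicE memNset ?mulr0//; apply.
  by rewrite mindicE mem_set// mulr1 -fg.
rewrite -!integralT_nnsfun.
rewrite (ge0_negligible_integral mN measurableT _ _ N0); last 2 first.
- by apply/measurable_EFinP.
- by move=> x _; rewrite lee_fin.
rewrite integral_mkcond; apply: ge0_le_integral => //.
- by move=> x _; apply: erestrict_ge0 => y _; rewrite lee_fin.
- apply/(measurable_restrictT _ _).1; first by rewrite setTD.
  by apply: measurable_funTS; apply/measurable_EFinP.
- by apply/measurable_EFinP.
- move=> x _; rewrite patchE setTD /=; case: ifPn => [xN|_].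
    by rewrite mindicE xN mulr1.
  by rewrite lee_fin mulr_ge0.
Qed.

Lemma null_integral_eq (f g : T -> \bar R) (N : set T) : measurable N ->
  m N = 0%E -> (forall x, ~ N x -> f x = g x) ->
  (\int[m]_x f x = \int[m]_x g x)%E.
Proof.
move=> mN N0 fg.
have key (h k : T -> \bar R) : (forall x, 0 <= h x)%E -> (forall x, 0 <= k x)%E ->
    (forall x, ~ N x -> h x = k x) -> (\int[m]_x h x = \int[m]_x k x)%E.
  move=> h0 k0 hk; apply/eqP; rewrite eq_le.
  by rewrite !(@null_integral_le _ _ N)// => x /hk.
rewrite integralE [RHS]integralE; congr (_ - _)%E; apply: key => // x Nx.
  by rewrite !funeposE fg.
by rewrite !funenegE fg.
Qed.

Lemma dct_ae (u_ : nat -> T -> R) (u g : T -> R) : (forall n, measurable_fun setT (u_ n)) ->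
  measurable_fun setT u ->
  (forall n x, `|u_ n x| <= g x) -> L1 m g ->
  {ae m, forall x, u_ n x @[n --> \oo] --> u x} ->
  L1 m u /\ (\int[m]_x u_ n x) @[n --> \oo] --> \int[m]_x u x.
Proof.
move=> mu_ mu ug Lg uu.
have Lu n : L1 m (u_ n) by apply: L1_le Lg.
have [Lu_ _ cv] := @dominated_convergence _ _ _ m _ measurableT
  (fun n x => (u_ n x)%:E) (fun x => (u x)%:E) (EFin \o g)
  (fun n => (measurable_EFinP _ _).2 (mu_ n)) ((measurable_EFinP _ _).2 mu)
  ltac:(apply: filterS uu => x h _; apply: cvg_EFin; [exact: nearW|exact: h])
  Lg ltac:(apply: aeW => x n _; rewrite lee_fin; exact: ug).
split => //.
move: cv; rewrite (integral_EFin Lu_).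
rewrite (_ : [sequence _]_n = (fun n => (\int[m]_x u_ n x)%:E)).
  by move=> /fine_cvgP[].
by apply/funext => n; rewrite /= integral_EFin.
Qed.

Lemma I_eq0_ae (u : T -> R) : L1 m u -> (forall x, 0 <= u x) ->
  \int[m]_x u x = 0 -> {ae m, forall x, u x = 0}.
Proof.
move=> Lu u0 Iu.
have [h _] := @ae_eq_integral_abs _ _ _ m setT measurableT (EFin \o u) (measurable_int _ Lu).
have : ae_eq m setT (EFin \o u) (cst 0%E).
  apply: h; rewrite -[RHS]/(0%:E) -Iu -integral_EFin//.
  by apply: eq_integral => x _; rewrite /= ger0_norm.
by apply: filterS => x /(_ I)[].
Qed.

Lemma eq_I_ae (u v : T -> R) : measurable_fun setT u -> measurable_fun setT v ->
  {ae m, forall x, u x = v x} -> \int[m]_x u x = \int[m]_x v x.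
Proof.
move=> mu mv uv; congr fine; apply: ae_eq_integral => //.
- exact/measurable_EFinP.
- exact/measurable_EFinP.
- by apply: filterS uv => x ->.
Qed.

Lemma measurable_natmul_bool (g : T -> bool) : measurable_fun setT g ->
  measurable_fun setT (fun x => (g x)%:R : R).
Proof.
move=> mg; rewrite (_ : (fun _ => _) = \1_(g @^-1` [set true])).
  apply: measurable_indic; rewrite -[X in measurable X]setTI; exact: mg.
apply/funext => x; rewrite indicE (_ : (x \in _) = g x)//.
by apply/idP/idP => [|gx]; rewrite inE.
Qed.

End null_sets.

Lemma primitive_left_continuous (R : realType) (u : R -> R) (t : R) :
  L1 (@lebesgue_measure R) (causal u) ->
  primitive u x @[x --> t^'-] --> primitive u t.
Proof.
move=> Lu; apply/cvg_at_leftP => s [st scvg].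
rewrite /primitive; under eq_fun do rewrite Rintegral_mkcond.
rewrite Rintegral_mkcond.
have E z : u \_ `]0, z[ = (causal u) \_ `]0, z[.
  apply/funext => y; rewrite !patchE mem_setE in_itv/= /causal.
  by case: ltP.
have [||||_ //] := @dct _ _ _ (@lebesgue_measure R) (fun n => u \_ `]0, s n[)
  (u \_ `]0, t[) (fun y => `|causal u y|).
- move=> n; rewrite E; apply/(measurable_restrictT _ _).1 => //.
  by apply: measurable_funTS; exact: L1_meas Lu.
- move=> n y; rewrite E patchE; case: ifP => // _; rewrite normr0; exact: normr_ge0.
- exact: L1_abs.
- move=> y; have [yt|ty] := ltP y t.
    apply: cvg_near_cst; near=> n.
    rewrite !patchE !mem_setE !in_itv/= yt (_ : y < s n)//.
    near: n; move/cvgrPdist_lt : scvg => /(_ (t - y)); rewrite subr_gt0 => /(_ yt).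
    by apply: filterS => n; rewrite gtr0_norm ?subr_gt0//; lra.
  rewrite (_ : (fun n => _) = fun=> (u \_ `]0, t[) y); first exact: cvg_cst.
  apply/funext => n; rewrite !patchE !mem_setE !in_itv/=.
  by rewrite (ltNge y t) ty (ltNge y (s n)) (le_trans (ltW (st n)) ty).
Unshelve. all: by end_near. Qed.

(** * Riemann-Stieltjes sums against a single unit jump *)

Section step_approximation.
Context (R : realType).
Variables (h phi : R -> R) (delta t l C : R).
Hypotheses (delta0 : 0 < delta) (h0 : h 0 < t).
Hypothesis hmono : forall u v, 0 <= u -> u <= v -> v <= delta -> h u <= h v.
Hypothesis phiC : forall u, 0 <= u -> u < delta -> `|phi u| <= C.

Definition grid n k : R := delta * k%:R / n.+1%:R.

(** The Riemann-Stieltjes sum of [phi] against u |-> 1(t <= h u). It is linear in the indicators, so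
    that for a random path [h] its expectation involves only the survival probabilities at the grid
    points. *)
Definition step n : R := \sum_(k < n.+1) phi (grid n k) *
  ((t <= h (grid n k.+1))%R%:R - (t <= h (grid n k))%R%:R).

Lemma grid_ge0 n k : 0 <= grid n k.
Proof. by rewrite divr_ge0// mulr_ge0// ltW. Qed.

Lemma grid0 n : grid n 0 = 0.
Proof. by rewrite /grid mulr0 mul0r. Qed.

Lemma grid_end n : grid n n.+1 = delta.
Proof. by rewrite /grid mulfK. Qed.

Lemma grid_le n k : (k <= n.+1)%N -> grid n k <= delta.
Proof. by move=> kn; rewrite ler_pdivrMr// ler_pM2l// ler_nat. Qed.

Lemma grid_lt n k : (k < n.+1)%N -> grid n k < delta.
Proof. by move=> kn; rewrite ltr_pdivrMr// ltr_pM2l// ltr_nat. Qed.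

Lemma gridS n k : grid n k.+1 = grid n k + delta / n.+1%:R.
Proof. by rewrite /grid -natr1; field; rewrite addrC natr1. Qed.

Let jump n k : R := (t <= h (grid n k.+1))%R%:R - (t <= h (grid n k))%R%:R.

Let jump_ge0 n k : (k < n.+1)%N -> 0 <= jump n k.
Proof.
move=> kn; rewrite subr_ge0 ler_nat.
have : h (grid n k) <= h (grid n k.+1).
  apply: hmono; [exact: grid_ge0| |exact: grid_le].
  by rewrite gridS lerDl divr_ge0// ltW.
by case: (leP t (h (grid n k))) => // th hh; rewrite (le_trans th hh).
Qed.

Let sum_jump n : \sum_(k < n.+1) jump n k = (t <= h delta)%R%:R.
Proof.
rewrite -(big_mkord xpredT (fun k => jump n k))/= telescope_sumr//.
by rewrite grid_end grid0 (leNgt t (h 0)) h0 subr0.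
Qed.

Lemma step_bound n : `|step n| <= C * (t <= h delta)%R%:R.
Proof.
rewrite -(sum_jump n) mulr_sumr; apply: (le_trans (ler_norm_sum _ _ _)).
apply: ler_sum => k _; rewrite normrM (ger0_norm (jump_ge0 (ltn_ord k))).
by rewrite ler_wpM2r ?jump_ge0// phiC ?grid_ge0// grid_lt.
Qed.

(** The indicators jump in one cell of the grid, and the first two hypotheses place [l] in that
    cell; the sum is then the value of [phi] at its left end, and [phi] is continuous at [l]. *)
Lemma step_cvg :
  (forall u, 0 <= u -> u <= delta -> t <= h u -> l <= u) ->
  (forall u, 0 <= u -> u <= delta -> h u < t -> u <= l) ->
  (t <= h delta -> {for l, continuous phi}) ->
  step n @[n --> \oo] --> phi l * (t <= h delta)%R%:R.
Proof.
move=> hl1 hl2 cphi; have [th|th] := leP t (h delta); last first.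
  rewrite mulr0 (_ : step = fun=> 0); first exact: cvg_cst.
  apply/funext => n; apply/eqP; rewrite -normr_le0.
  by have := step_bound n; rewrite (leNgt t) th/= mulr0.
have := cphi th; rewrite /= mulr1 => /cvgrPdist_le cl.
apply/cvgrPdist_le => e e0.
have [eta /= eta0 he] := cl e e0.
near=> n.
have -> : phi l - step n = \sum_(k < n.+1) (phi l - phi (grid n k)) * jump n k.
  under eq_bigr do rewrite mulrBl.
  by rewrite sumrB -mulr_sumr sum_jump th mulr1.
apply: (le_trans (ler_norm_sum _ _ _)).
rewrite -[leRHS]mulr1 -[X in _ <= _ * X](_ : (t <= h delta)%R%:R = 1); last by rewrite th.
rewrite -(sum_jump n) mulr_sumr; apply: ler_sum => k _.
have j0 := jump_ge0 (ltn_ord k).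
rewrite normrM (ger0_norm j0); have [->|jn0] := eqVneq (jump n k) 0.
  by rewrite !mulr0.
rewrite ler_wpM2r//.
have gk := grid_ge0 n k; have gkn := grid_le (ltnW (ltn_ord k)).
have gk1 := grid_ge0 n k.+1; have gk1n := grid_le (ltn_ord k).
move: jn0; rewrite /jump.
case: (leP t (h (grid n k.+1))) => t1; case: (leP t (h (grid n k))) => t2;
  rewrite ?subrr ?eqxx//= ?sub0r => _.
  apply: he; rewrite /ball_/=.
  have a1 := hl1 _ gk1 gk1n t1; have a2 := hl2 _ gk gkn t2.
  rewrite gridS in a1; rewrite ger0_norm ?subr_ge0//.
  apply: (@le_lt_trans _ _ (delta / n.+1%:R)); first by rewrite lerBlDl.
  near: n; exists (Num.truncn (delta / eta)) => // n /= hn.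
  rewrite ltr_pdivrMr// -ltr_pdivrMl// mulrC.
  by apply: (lt_le_trans (truncnS_gt _)); rewrite ler_nat ltnS.
have : h (grid n k) <= h (grid n k.+1).
  apply: hmono => //; by rewrite gridS lerDl divr_ge0// ltW.
by rewrite leNgt (lt_le_trans t1 t2).
Unshelve. all: by end_near. Qed.

End step_approximation.

(** * The gamma subordinator and its inverse *)

Section finite_sums.
Context d (T : measurableType d) (R : realType) (m : {measure set T -> \bar R}).

Lemma L1_sum (I : Type) (r : seq I) (c : I -> R) (g : I -> T -> R) :
  (forall k, L1 m (g k)) -> L1 m (fun x => \sum_(k <- r) c k * g k x).
Proof.
move=> Lg; elim: r => [|k r IH].
  by under eq_fun do rewrite big_nil; exact: L1_0.
under eq_fun do rewrite big_cons.
by apply: L1D => //; exact: L1Z.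
Qed.

Lemma I_sum (I : Type) (r : seq I) (c : I -> R) (g : I -> T -> R) :
  (forall k, L1 m (g k)) ->
  \int[m]_x \sum_(k <- r) c k * g k x = \sum_(k <- r) c k * \int[m]_x g k x.
Proof.
move=> Lg; elim: r => [|k r IH].
  by under eq_I do rewrite big_nil; rewrite big_nil I_0.
under eq_I do rewrite big_cons.
by rewrite big_cons ID ?IZ ?IH//; [exact: L1Z|exact: L1_sum].
Qed.

End finite_sums.

Lemma L1_probability d (T : measurableType d) (R : realType) (P : probability T R)
    (u : T -> R) (C : R) : measurable_fun setT u -> (forall w, `|u w| <= C) -> L1 P u.
Proof.
move=> mu uC; apply: (L1_le mu uC).
exact: (finite_measure_integrable_cst P C measurableT).
Qed.

Lemma natb_le1 (R : realType) (c : bool) : c%:R <= 1 :> R.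
Proof. by case: c; rewrite ?lexx ?ler01. Qed.

Lemma normr_natb_le1 (R : realType) (c : bool) : `|c%:R| <= 1 :> R.
Proof. by rewrite ger0_norm ?natb_le1. Qed.

Section one_sided_sequences.
Context (R : realType).

(** The denominators start at 2, which keeps every term strictly between [c] and [d]. *)
Definition left_seq (c d : R) n : R := d - (d - c) / n.+2%:R.

Definition right_seq (c d : R) n : R := c + (d - c) / n.+2%:R.

Let cvg0 (k : R) : k / n.+2%:R @[n --> \oo] --> 0.
Proof.
rewrite -(mulr0 k); apply: cvgMr.
apply/cvgrPdist_lt => e e0; have := near_infty_natSinv_lt (PosNum e0).
apply: filterS => n /=; rewrite sub0r normrN gtr0_norm ?invr_gt0//.
by apply: le_lt_trans; rewrite lef_pV2 ?posrE// ler_nat.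
Qed.

Let gap (c d : R) n : c < d -> 0 < (d - c) / n.+2%:R < d - c.
Proof.
move=> cd; rewrite divr_gt0 ?subr_gt0//= ltr_pdivrMr// ltr_pMr ?subr_gt0//.
by rewrite ltr1n.
Qed.

Lemma left_seq_itv c d n : c < d -> c < left_seq c d n < d.
Proof. by rewrite /left_seq => /(gap n); set k := _ / _ => /andP[h1 h2]; apply/andP; split; lra. Qed.

Lemma right_seq_itv c d n : c < d -> c < right_seq c d n < d.
Proof. by rewrite /right_seq => /(gap n); set k := _ / _ => /andP[h1 h2]; apply/andP; split; lra. Qed.

Lemma cvg_left_seq c d : left_seq c d n @[n --> \oo] --> d.
Proof.
rewrite -[X in _ --> X]subr0; apply: cvgB; first exact: cvg_cst.
exact: cvg0.
Qed.

Lemma cvg_right_seq c d : right_seq c d n @[n --> \oo] --> c.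
Proof.
rewrite -[X in _ --> X]addr0; apply: cvgD; first exact: cvg_cst.
exact: cvg0.
Qed.

Lemma left_seq_le c d n m : c <= d -> (n <= m)%N -> left_seq c d n <= left_seq c d m.
Proof.
move=> cd nm; rewrite lerB// ler_wpM2l ?subr_ge0// lef_pV2 ?posrE ?ltr0n//.
by rewrite ler_nat !ltnS.
Qed.

Lemma right_seq_ge c d n m : c <= d -> (n <= m)%N -> right_seq c d m <= right_seq c d n.
Proof.
move=> cd nm; rewrite lerD2l ler_wpM2l ?subr_ge0// lef_pV2 ?posrE ?ltr0n//.
by rewrite ler_nat !ltnS.
Qed.

End one_sided_sequences.

Lemma causal_expR_le (R : realType) (l z : R) : 0 < l -> 0 <= z ->
  let u := fun t : R => causal (fun t => expR (- (l * t))) t * (t <= z)%R%:R in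
  L1 (@lebesgue_measure R) u /\
  \int[@lebesgue_measure R]_t u t = (1 - expR (- (l * z))) / l.
Proof.
move=> l0 z0 u; have mu_ : measurable_fun setT u.
  apply: measurable_funM; first exact: L1_meas (expR_halfline l0).1.
  by apply: measurable_natmul_bool; exact: measurable_fun_ler.
split.
  apply: (@L1_le _ _ _ (@lebesgue_measure R) _ _ mu_ _ (expR_halfline l0).1) => t.
  rewrite /u normrM.
  rewrite ger0_norm; last by rewrite causal_ge0// => s _; exact: expR_ge0.
  by rewrite ler_piMr ?normr_natb_le1// causal_ge0// => s _; exact: expR_ge0.
have uE t : u t = ((fun t => expR (- (l * t))) \_ `]0, z]) t.
  rewrite /u /causal patchE mem_setE in_itv/=.
  by case: (ltP 0 t) => _; case: (leP t z) => _; rewrite /= ?mulr1 ?mul0r ?mulr0.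
under eq_I do rewrite uE.
have [k0|k0] := ltP 0 z; last first.
  have -> : z = 0 by apply/eqP; rewrite eq_le k0 z0.
  rewrite mulr0 oppr0 expR0 subrr mul0r -Rintegral_mkcond set_itv_ge.
    by rewrite Rintegral_set0.
  by rewrite bnd_simp ltxx.
have [Li /(_ k0) Ii] := expR_interval z l0.
rewrite -Ii -!Rintegral_mkcond Rintegral_itv_bndo_bndc//.
exact: (L1_restrict _ _).1.
Qed.

Section subordinator.
Context (R : realType) (a b : R) (a0 : 0 < a) (b0 : 0 < b).
Context d (Omega : measurableType d) (P : probability Omega R).
Notation mu := (@lebesgue_measure R).
(** A modification of the subordinator whose path properties hold for every outcome;
    [subordinator_version] provides one. *)
Variable K : R -> Omega -> R.
Hypothesis mK : forall u, measurable_fun setT (K u).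
Hypothesis K0 : forall w, K 0 w = 0.
Hypothesis K_mono : forall w s t, 0 <= s -> s <= t -> K s w <= K t w.
Hypothesis K_gt0 : forall w s, 0 < s -> 0 < K s w.
Hypothesis K_laplace : forall u l, 0 <= u -> 0 <= l ->
  \int[P]_w expR (- (l * K u w)) = expR (- (u * Phi a b l)).

Let K_ge0 w u : 0 <= u -> 0 <= K u w.
Proof. by move=> u0; rewrite -(K0 w); exact: K_mono. Qed.

Definition first_passage t w : R := inf [set s : R | 0 < s /\ ~ `]0, t[%classic (K s w)].

(** The non-strict inequality makes this left-continuous in [t], as [lap_inj] demands. *)
Definition survival u t : R := \int[P]_w (t <= K u w)%R%:R.

Lemma Phi_gt0 l : 0 < l -> 0 < Phi a b l.
Proof. by move=> l0; rewrite mulr_gt0// ln_gt0// ltrDl divr_gt0. Qed.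

Lemma Phi_inv t : Phi a b t^-1 = a * log_tail b t.
Proof. by congr (_ * ln (1 + _)); rewrite div1r invfM mulrC. Qed.

Lemma measurable_alive u t : measurable_fun setT (fun w => (t <= K u w)%R%:R : R).
Proof. by apply: measurable_natmul_bool; exact: measurable_fun_ler. Qed.

Lemma L1_alive u t : L1 P (fun w => (t <= K u w)%R%:R : R).
Proof.
apply: (@L1_probability _ _ _ _ _ 1); first exact: measurable_alive.
by move=> w; exact: normr_natb_le1.
Qed.

Lemma L1_expK u l : 0 <= u -> 0 <= l -> L1 P (fun w => expR (- (l * K u w))).
Proof.
move=> u0 l0; apply: (@L1_probability _ _ _ _ _ 1).
  apply: measurableT_comp => //; apply: measurableT_comp => //.
  exact: measurable_funM.
move=> w; rewrite ger0_norm ?expR_ge0// -expR0 ler_expR oppr_le0.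
by rewrite mulr_ge0// K_ge0.
Qed.

Lemma survival_ge0 u t : 0 <= survival u t.
Proof. exact: I_ge0. Qed.

Lemma I_probability_cst (c : R) : \int[P]_w c = c.
Proof. by rewrite Rintegral_cst//= probability_setT/= mulr1. Qed.

Lemma survival_le1 u t : survival u t <= 1.
Proof.
rewrite -[leRHS]I_probability_cst; apply: le_I.
- exact: L1_alive.
- exact: (finite_measure_integrable_cst P 1 measurableT).
- by move=> w; exact: natb_le1.
Qed.

(** Fubini's theorem: for each outcome, the integral of e^(-lt) over 0 < t <= K_u is (1 - e^(-l
    K_u)) / l. *)
Lemma lap_survival u l : 0 <= u -> 0 < l ->
  L1 mu (weight l (survival u)) /\
  lap l (survival u) = (1 - expR (- (u * Phi a b l))) / l.
Proof.
move=> u0 l0.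
pose F (z : R * Omega) : R := causal (fun t => expR (- (l * t))) z.1 *
  (z.1 <= K u z.2)%R%:R.
have mF : measurable_fun setT F.
  apply: measurable_funM.
    by apply: (measurableT_comp (L1_meas (expR_halfline l0).1)).
  apply: measurable_natmul_bool; apply: measurable_fun_ler => //.
  exact: measurableT_comp.
have KIE w : \int[mu]_t F (t, w) = l^-1 * (1 - expR (- (l * K u w))).
  by rewrite mulrC; exact: (causal_expR_le l0 (K_ge0 w u0)).2.
have LF w : L1 mu (fun t => F (t, w)) by exact: (causal_expR_le l0 (K_ge0 w u0)).1.
have Le := L1_expK u0 (ltW l0).
have L1c : L1 P (fun=> 1) by exact: (finite_measure_integrable_cst P 1 measurableT).
have F0 z : 0 <= F z.
  by rewrite mulr_ge0// causal_ge0// => s _; exact: expR_ge0.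
have [|L2 _ FF _] := @fubini_real _ _ _ _ R mu P F mF LF.
  under eq_fun do (under eq_I do rewrite ger0_norm//).
  by under eq_fun do rewrite KIE; apply: L1Z; exact: L1B.
have WE : weight l (survival u) = fun t => \int[P]_w F (t, w).
  apply/funext => t; rewrite /F/= IZ; last exact: L1_alive.
  by rewrite /weight /causal; case: ifP => _; rewrite ?mulr0 ?mul0r.
rewrite /lap WE; split; first exact: L2.
rewrite FF; under eq_I do rewrite KIE.
rewrite IZ; last exact: L1B.
by rewrite IB// I_probability_cst K_laplace ?(ltW l0)// mulrC.
Qed.

Lemma survival_le u t : 0 <= u -> 0 < t ->
  survival u t <= markov_cst R * (u * (a * log_tail b t)).
Proof.
move=> u0 t0; have ti0 : 0 <= t^-1 by rewrite invr_ge0 ltW.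
have k0 := markov_cst_gt0 R.
have Le := L1_expK u0 ti0.
have L1c : L1 P (fun=> 1) by exact: (finite_measure_integrable_cst P 1 measurableT).
apply: (@le_trans _ _ (markov_cst R * \int[P]_w (1 - expR (- (t^-1 * K u w))))).
  rewrite -IZ; last exact: L1B.
  apply: le_I; [exact: L1_alive|by apply: L1Z; exact: L1B|move=> w].
  case: (leP t (K u w)) => tK /=.
    rewrite -[leLHS](markov_cstE R); apply: ler_wpM2l; first exact: ltW.
    by rewrite lerB// ler_expR lerN2 ler_pdivlMl// mulr1.
  apply: mulr_ge0; first exact: ltW.
  by rewrite subr_ge0 -expR0 ler_expR oppr_le0 mulr_ge0// K_ge0.
apply: ler_wpM2l; first exact: ltW.
rewrite IB// I_probability_cst K_laplace// -Phi_inv.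
by have := expR_ge1Dx (- (u * Phi a b t^-1)); lra.
Qed.

Lemma survival_left_continuous u t : survival u x @[x --> t^'-] --> survival u t.
Proof.
apply/cvg_at_leftP => s [st scvg].
have [||||_ //] := @dct _ _ _ P (fun n w => (s n <= K u w)%R%:R : R)
  (fun w => (t <= K u w)%R%:R) (fun=> 1).
- by move=> n; exact: measurable_alive.
- by move=> n w; exact: normr_natb_le1.
- exact: (finite_measure_integrable_cst P 1 measurableT).
- move=> w; apply: cvg_near_cst; have [tK|Kt] := leP t (K u w).
    by apply: nearW => n; rewrite (le_trans (ltW (st n)) tK).
  near=> n; rewrite (_ : s n <= K u w = false)//; apply/negP/negP; rewrite -ltNge.
  near: n; move/cvgrPdist_lt : scvg => /(_ (t - K u w)); rewrite subr_gt0 => /(_ Kt).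
  by apply: filterS => n; rewrite gtr0_norm ?subr_gt0//; lra.
Unshelve. all: by end_near. Qed.

(** Both sides are bounded and left-continuous in [t] and have the same transform. This identifies
    the law of [K u] as a gamma law. *)
Lemma survival_density u t : 0 < u -> 0 < t ->
  survival u t = 1 - primitive (gamma_density b (a * u)) t.
Proof.
move=> u0 t0; have s0 : 0 < a * u by rewrite mulr_gt0.
pose p := gamma_density b (a * u).
have pc : causal p = p.
  apply/funext => y; rewrite /causal; case: ltP => // y0.
  by rewrite /p gamma_density0.
have Lp : L1 mu (causal p) by rewrite pc; exact: L1_gamma_density.
have p0 y : 0 <= p y by exact: gamma_density_ge0.
have prim01 z : 0 <= primitive p z <= 1.
  rewrite Rintegral_ge0//= /primitive -(I_gamma_density b0 s0) Rintegral_mkcond.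
  apply: le_I; last 1 first.
  - by move=> y; rewrite patchE; case: ifP => // _; exact: p0.
  - apply: (@L1_le _ _ _ mu _ p); last exact: L1_gamma_density.
      apply/(measurable_restrictT _ _).1 => //; apply: measurable_funTS.
      exact: L1_meas (L1_gamma_density b0 s0).
    by move=> y; rewrite patchE; case: ifP => _; rewrite ?normr0 ?ger0_norm.
  - exact: L1_gamma_density.
have l1 : 0 < 1 :> R by [].
have mS := measurable_causal_weight (L1_meas (lap_survival (ltW u0) l1).1).
have mprim : measurable_fun setT (causal (primitive p)).
  apply: measurable_causal_weight.
  exact: L1_meas (lap_primitive l1 (L1_weight_L1 (ltW l1) Lp)).1.
apply: (@lap_inj R (survival u) (fun y => 1 - primitive p y) 1 1 t) => //.
- rewrite (_ : causal _ = fun y => causal (fun=> 1) y - causal (primitive p) y).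
    apply: measurable_funB => //; apply: measurable_causal_continuous => x _.
    exact: cvg_cst.
  by apply/funext => y; rewrite /causal; case: ifP => // _; rewrite subr0.
- by move=> s _; rewrite ger0_norm ?survival_ge0 ?survival_le1.
- move=> s _; have /andP[h0 h1] := prim01 s.
  by rewrite ger0_norm ?subr_ge0// lerBlDr lerDl.
- move=> j j0; have l0 : 0 < j%:R :> R by rewrite ltr0n.
  rewrite (lap_survival (ltW u0) l0).2.
  have [Lw Iw] := lap_primitive l0 (L1_weight_L1 (ltW l0) Lp).
  transitivity (lap j%:R (fun=> 1) - lap j%:R (primitive p)).
    rewrite Iw lap_cst// (lap_gamma_density (ltW l0) b0 s0).2 -mulrBl.
    by congr ((1 - expR (- _)) / _); rewrite /Phi; ring.
  rewrite /lap -IB//; last exact: L1_weight_cst.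
  apply: eq_I => y; rewrite !weight_causal /causal; case: ifP => // _.
    by rewrite mulrBr.
  by rewrite subr0.
- exact: survival_left_continuous.
- by apply: cvgB; [exact: cvg_cst|exact: primitive_left_continuous].
Qed.

(** The probability of K_u = t is at most that of t <= K_u < t + 1/n, the integral of the gamma
    density over an interval shrinking to a point. *)
Lemma no_atom u t : 0 < u -> 0 < t -> {ae P, forall w, K u w <> t}.
Proof.
move=> u0 t0; have s0 : 0 < a * u by rewrite mulr_gt0.
pose p := gamma_density b (a * u).
have Lp : L1 mu p by exact: L1_gamma_density.
have meq : measurable_fun setT (fun w => (K u w == t)%:R : R).
  apply: measurable_natmul_bool; apply: measurable_fun_eqr => //.
have Leq : L1 P (fun w => (K u w == t)%:R : R).
  apply: (@L1_probability _ _ _ _ _ 1) => // w.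
  exact: normr_natb_le1.
have [|Lae] := pselect (\int[P]_w (K u w == t)%:R = 0 :> R).
  move=> /(I_eq0_ae Leq (fun w => ler0n _ _)) Z; apply: (ae_imp Z) => w /eqP.
  by rewrite pnatr_eq0 eqb0 => /eqP.
exfalso; apply: Lae; apply/eqP; rewrite eq_le I_ge0// andbT.
have tn n : t < t + n.+1%:R^-1 by rewrite ltrDl invr_gt0.
pose q n y : R := (p \_ `[t, t + n.+1%:R^-1[) y.
have [||||_ qcvg] := @dct _ _ _ mu q (p \_ [set t]) p.
- move=> n; apply/(measurable_restrictT _ _).1 => //; apply: measurable_funTS.
  exact: L1_meas Lp.
- move=> n y; rewrite /q patchE; case: ifP => _; rewrite ?normr0 ?ger0_norm//;
  exact: gamma_density_ge0.
- exact: Lp.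
- move=> y; have [->|yt] := eqVneq y t; last first.
    rewrite [X in _ --> X]patchE memNset; last exact/eqP.
    have [ty|ty] := leP t y; last first.
      apply: cvg_near_cst; apply: nearW => n.
      by rewrite /q patchE mem_setE in_itv/= leNgt ty.
    have {}ty : 0 < y - t by rewrite subr_gt0 lt_neqAle eq_sym yt.
    apply: cvg_near_cst; near=> n.
    rewrite /q patchE mem_setE in_itv/= ifF//; apply/negP => /andP[_].
    have : n.+1%:R^-1 < y - t by near: n; exact: near_infty_natSinv_lt (PosNum ty).
    by rewrite ltrBrDl => h /(lt_trans h); rewrite ltxx.
  apply: cvg_near_cst; apply: nearW => n.
  rewrite /q !patchE mem_setE in_itv/= lexx tn.
  by rewrite ifT//; exact/mem_set.
rewrite -Rintegral_mkcond Rintegral_set1 in qcvg.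
rewrite -(cvg_lim (@Rhausdorff R) qcvg).
apply: limr_ge; first exact: (cvgP _ qcvg).
apply: nearW => n; pose e : R := n.+1%:R^-1; have te : t < t + e := tn n.
have Li z : mu.-integrable `]0%R, z[ (EFin \o p).
  exact: (integrableS _ _ _ Lp).
apply: (@le_trans _ _ (survival u t - survival u (t + e))).
  rewrite -IB; [|exact: L1_alive|exact: L1_alive].
  apply: le_I => //; first by apply: L1B; exact: L1_alive.
  move=> w; case: eqP => [->|_]/=.
    by rewrite lexx (lt_geF te) subr0 lexx.
  rewrite subr_ge0 ler_nat; case: (leP (t + e) (K u w)) => // teK.
  by rewrite (le_trans (ltW (tn n)) teK).
have te0 : 0 < t + e by rewrite (lt_trans t0).
rewrite !survival_density// opprB addrC addrA subrK.
have pE z : primitive p z = \int[mu]_y (p \_ `]0, z[) y by exact: Rintegral_mkcond.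
rewrite lerBlDl !pE.
have Lr D : measurable D -> L1 mu (p \_ D).
  by move=> mD; apply/L1_restrict => //; exact: integrableS Lp.
rewrite -ID; [|exact: Lr|exact: Lr].
rewrite le_eqVlt; apply/orP; left; apply/eqP; apply: eq_I => y; rewrite /q !patchE !mem_setE !in_itv/=.
case: (ltP y t) => yt /=.
  rewrite (lt_trans yt (tn n)) andbT; by case: ifP; rewrite ?addr0.
by rewrite (lt_le_trans t0 yt)/= add0r.
Unshelve. all: by end_near.
Qed.

Lemma first_passage_ge0 t w : 0 <= first_passage t w.
Proof.
rewrite /first_passage; set S := [set s | _].
have [->|/set0P S0] := eqVneq S set0; first by rewrite inf0.
by apply: lb_le_inf => // s [/ltW].
Qed.

Lemma first_passage_le u t w : 0 < u -> t <= K u w -> first_passage t w <= u.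
Proof.
move=> u0 tK; apply: ge_inf; first by exists 0 => s [/ltW].
by split => //; rewrite /= in_itv/= => /andP[_]; rewrite ltNge tK.
Qed.

(** That the level is reached at some [s] has to be assumed, as the infimum of the empty set is
    0. *)
Lemma first_passage_ge u s t w : 0 < s -> t <= K s w ->
  (forall v, 0 < v -> t <= K v w -> u <= v) -> u <= first_passage t w.
Proof.
move=> s0 tK uv; apply: lb_le_inf.
  by exists s; split => //; rewrite /= in_itv/= => /andP[_]; rewrite ltNge tK.
move=> v [v0 /= H]; apply: uv => //; rewrite leNgt; apply/negP => Kt.
by apply: H; rewrite in_itv/= K_gt0.
Qed.

Lemma first_passage_none t w : (forall s, 0 < s -> K s w < t) -> first_passage t w = 0.
Proof.
move=> Kt; rewrite /first_passage (_ : [set s | _] = set0) ?inf0//.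
rewrite -subset0 => s [s0 /=]; apply.
by rewrite in_itv/= K_gt0// Kt.
Qed.

Lemma lt_first_passage u t w : first_passage t w < u -> 0 < t ->
  (exists2 v, 0 < v < u & t <= K v w) \/ forall s, 0 < s -> K s w < t.
Proof.
move=> Lu t0; have [[s /andP[s0 tK]]|H] := pselect (exists s, (0 < s) && (t <= K s w)).
  left; apply: contrapT => H; move: Lu; rewrite ltNge => /negP; apply.
  apply: (first_passage_ge s0 tK) => v v0 tv; rewrite leNgt; apply/negP => vu.
  by apply: H; exists v => //; rewrite v0.
right => s s0; rewrite ltNge; apply/negP => tK.
by apply: H; exists s; rewrite s0.
Qed.

(** By monotonicity, passage before [u] can be tested at rational times. The event that the level is
    never reached must be added, for then the passage time is 0 by convention. *)
Lemma measurable_first_passage t : measurable_fun setT (first_passage t).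
Proof.
have [t0|t0] := leP t 0.
  rewrite (_ : first_passage t = cst (inf [set s : R | 0 < s])); first exact: measurable_cst.
  apply/funext => w; congr inf; apply/seteqP; split => s /= [] //.
  by move=> s0; split => //; rewrite in_itv/= => /andP[/lt_trans h /h]; rewrite ltNge t0.
apply: (measurability _ (RGenInftyO.measurableE R)) => // _ [_ [u ->] <-].
rewrite setTI.
have mle v : measurable [set w | t <= K v w].
  rewrite -[X in measurable X]setTI (_ : [set w | _] = K v @^-1` `[t, +oo[).
    exact: (mK v).
  by apply/seteqP; split => w; rewrite /= in_itv/= andbT.
have [u0|u0] := leP u 0.
  rewrite (_ : _ @^-1` _ = set0)// -subset0 => w /=.
  by rewrite in_itv/= ltNge (le_trans u0)// first_passage_ge0.
rewrite (_ : _ @^-1` _ =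
  (\bigcup_(q : rat) (if 0 < (ratr q : R) < u then [set w | t <= K (ratr q) w] else set0))
  `|` (\bigcap_(n : nat) ~` [set w | t <= K n%:R w])).
  apply: measurableU; last first.
    by apply: bigcapT_measurable => n; exact: measurableC.
  by apply: bigcupT_measurable_rat => q; case: ifP.
apply/seteqP; split => w /=; rewrite in_itv/=.
  move=> /lt_first_passage -/(_ t0)[[v /andP[v0 vu] tv]|H]; [left|right].
    have [q] := rat_in_itvoo vu; rewrite in_itv/= => /andP[vq qu].
    exists q => //; rewrite (lt_trans v0 vq) qu /=.
    by apply: (le_trans tv); apply: K_mono; exact: ltW.
  move=> [|n] _ /=; apply/negP; rewrite -ltNge; first by rewrite K0.
  by apply: H; rewrite ltr0n.
move=> [[q _]|H].
  by case: ifP => // /andP[q0 qu] /= tq; apply: le_lt_trans qu; exact: first_passage_le.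
rewrite first_passage_none// => s s0.
have /negP := H (Num.truncn s).+1 I; rewrite -ltNge; apply: le_lt_trans.
by apply: K_mono; [exact: ltW|exact/ltW/truncnS_gt].
Qed.

(** With L the passage time of [t], the path is still below [t] at time L - e, hence below s_n for
    large n; so the level s_n is passed no earlier than L - e. *)
Lemma first_passage_left_continuous t w (s_ : nat -> R) (de : R) : 0 < de ->
  t <= K de w -> (forall n, s_ n < t) -> s_ n @[n --> \oo] --> t ->
  first_passage (s_ n) w @[n --> \oo] --> first_passage t w.
Proof.
move=> de0 tK st scvg; apply/cvgrPdist_le => e e0.
have up n : first_passage (s_ n) w <= first_passage t w.
  apply: (first_passage_ge de0 tK) => v v0 tv; apply: first_passage_le => //.
  exact: le_trans (ltW (st n)) tv.
set L := first_passage t w.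
suff : \forall n \near \oo, L - e <= first_passage (s_ n) w.
  by apply: filterS => n h; rewrite ger0_norm ?subr_ge0//; lra.
have [Le|Le] := leP (L - e) 0.
  by apply: nearW => n; exact: le_trans Le (first_passage_ge0 _ _).
have Kt : K (L - e) w < t.
  rewrite ltNge; apply/negP => /(first_passage_le Le); rewrite -/L.
  by apply/negP; rewrite -ltNge ltrBlDr ltrDl.
move/cvgrPdist_lt : scvg => /(_ (t - K (L - e) w)); rewrite subr_gt0 => /(_ Kt).
apply: filterS => n; rewrite gtr0_norm ?subr_gt0// => h.
apply: (first_passage_ge de0); first exact: le_trans (ltW (st n)) tK.
move=> v v0 sv; rewrite leNgt; apply/negP => vL.
have := K_mono w (ltW v0) (ltW vL); lra.
Qed.

(** A fixed time is almost surely not a jump time. The limit of exp(-K) along times increasing to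
    [dd] is at least exp(-K_dd), and the expectations agree because u |-> e^(-u Phi(1)) is
    continuous; so the two coincide almost surely. *)
Lemma no_jump dd : 0 < dd ->
  {ae P, forall w, forall t, t < K dd w -> exists2 u, 0 < u < dd & t < K u w}.
Proof.
move=> dd0; pose d_ := left_seq 0 dd.
have d_lt n : 0 < d_ n < dd by exact: left_seq_itv.
have d_le n m : (n <= m)%N -> d_ n <= d_ m by apply: left_seq_le; exact: ltW.
pose g n w : R := expR (- (1 * K (d_ n) w)).
have Lg n : L1 P (g n) by apply: L1_expK => //; have /andP[/ltW] := d_lt n.
have Ld : L1 P (fun w => expR (- (1 * K dd w))) by apply: L1_expK => //; exact: ltW.
have gd n w : expR (- (1 * K dd w)) <= g n w.
  have /andP[/ltW d0 /ltW d1] := d_lt n.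
  by rewrite ler_expR lerN2 !mul1r K_mono.
have gcv w : cvgn (g ^~ w).
  apply: nonincreasing_is_cvgn.
    move=> n m nm; rewrite ler_expR lerN2 !mul1r K_mono ?d_le//.
    by have /andP[/ltW] := d_lt n.
  by exists 0 => _ [n _ <-]; exact: expR_ge0.
have [||||LG IG] := @dct _ _ _ P g (fun w => limn (g ^~ w)) (fun=> 1).
- by move=> n; exact: L1_meas (Lg n).
- move=> n w; rewrite ger0_norm ?expR_ge0// -expR0 ler_expR oppr_le0 mul1r.
  by apply: K_ge0; have /andP[/ltW] := d_lt n.
- exact: (finite_measure_integrable_cst P 1 measurableT).
- by move=> w; exact: gcv.
have dcv : d_ n @[n --> \oo] --> dd by exact: cvg_left_seq.
have eqI : \int[P]_w (limn (g ^~ w) - expR (- (1 * K dd w))) = 0.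
  rewrite IB// K_laplace ?(ltW dd0)//; apply/eqP; rewrite subr_eq0; apply/eqP.
  apply: (cvg_unique (@Rhausdorff R) IG).
  rewrite [X in X @ _](_ : _ = fun n => expR (- (d_ n * Phi a b 1))); last first.
    by apply/funext => n; rewrite /g K_laplace//; have /andP[/ltW] := d_lt n.
  have cE : {for dd, continuous (fun u : R => expR (- (u * Phi a b 1)))}.
    apply: continuous_comp; last exact: continuous_expR.
    by apply: continuousN; exact: mulrr_continuous.
  exact: (@cvg_comp _ _ _ d_ (fun u : R => expR (- (u * Phi a b 1))) _ _ _ dcv cE).
have ge0 w : 0 <= limn (g ^~ w) - expR (- (1 * K dd w)).
  by rewrite subr_ge0; apply: limr_ge => //; apply: nearW => n; exact: gd.
have Z := I_eq0_ae (L1B LG Ld) ge0 eqI.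
apply: (ae_imp Z) => w /eqP; rewrite subr_eq0 => /eqP glim t tK.
have : expR (- (1 * K dd w)) < expR (- t) by rewrite ltr_expR ltrN2 mul1r.
rewrite -glim => /(cvgr_lt (limn (g ^~ w)) (gcv w)) [N _ /(_ N)].
rewrite /= leqnn => /(_ isT); rewrite ltr_expR ltrN2 mul1r => tN.
by exists (d_ N).
Qed.

(** Without atoms the level is exceeded strictly at [dd], and without a jump at [dd] already before
    it. Hence dd - L_t is positive, in the region where [f] is continuous. *)
Lemma first_passage_lt_ae dd t : 0 < dd -> 0 < t ->
  {ae P, forall w, t <= K dd w -> first_passage t w < dd}.
Proof.
move=> dd0 t0; apply: (ae_imp2 (no_jump dd0) (no_atom dd0 t0)) => w nj na tK.
have [|u /andP[u0 ud] /ltW tu] := nj t; last exact: le_lt_trans (first_passage_le u0 tu) ud.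
by rewrite lt_neqAle tK andbT; apply/eqP => /esym.
Qed.

(** * Initial data carried by the inverse process, and its Laplace transform *)

Section forcing.
Variables (f : R -> R) (Cf : R).
Hypothesis cf : {in `]0, +oo[, continuous f}.
Hypothesis fC : forall z, 0 < z -> `|f z| <= Cf.

Let Cf0 : 0 <= Cf. Proof. exact: le_trans (normr_ge0 _) (fC ltr01). Qed.

Let fb z : `|causal f z| <= Cf.
Proof. by rewrite /causal; case: ifP => [/fC//|_]; rewrite normr0. Qed.

Let cfc z : 0 < z -> {for z, continuous (causal f)}.
Proof.
move=> z0; have zP : z \in `]0, +oo[ by rewrite in_itv/= z0.
rewrite /prop_for /continuous_at /causal z0; apply: cvg_trans (cf zP).
apply: near_eq_cvg; near=> y; rewrite ifT//; near: y; exact: lt_nbhsr.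
Unshelve. all: by end_near. Qed.

Let integrand dd de t w := causal f (dd - first_passage t w) * (t <= K de w)%R%:R.

(** This is E[f(dd - L_t), t <= K_de]: the contribution at position [dd] of the initial data between
    dd - de and dd. For de = dd it is the claimed solution, up to null events. *)
Definition forcing dd de t : R := \int[P]_w integrand dd de t w.

Let measurable_integrand dd de t : measurable_fun setT (integrand dd de t).
Proof.
apply: measurable_funM; last exact: measurable_alive.
apply: (measurableT_comp (measurable_causal_continuous cf)).
by apply: measurable_funB => //; exact: measurable_first_passage.
Qed.

Let integrand_bound dd de t w : `|integrand dd de t w| <= Cf * (t <= K de w)%R%:R.
Proof. by rewrite normrM [X in _ * X]ger0_norm// ler_wpM2r. Qed.

Lemma L1_forcing_integrand dd de t :
  L1 P (fun w => causal f (dd - first_passage t w) * (t <= K de w)%R%:R).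
Proof.
apply: (@L1_le _ _ _ P _ _ (measurable_integrand dd de t) (integrand_bound dd de t)).
by apply: L1Z; exact: L1_alive.
Qed.

Lemma forcing_le dd de t : `|forcing dd de t| <= Cf * survival de t.
Proof.
rewrite /survival -IZ; last exact: L1_alive.
by apply: (@I_bound _ _ _ P) => //; apply: L1Z; exact: L1_alive.
Qed.

Lemma forcing_left_continuous dd de t : 0 < de -> de <= dd -> 0 < t ->
  forcing dd de x @[x --> t^'-] --> forcing dd de t.
Proof.
move=> de0 ded t0; have dd0 : 0 < dd by exact: lt_le_trans ded.
apply/cvg_at_leftP => s [st scvg].
have [|||||_ //] := @dct_ae _ _ _ P (fun n => integrand dd de (s n))
  (integrand dd de t) (fun=> Cf).
- by move=> n; exact: measurable_integrand.
- exact: measurable_integrand.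
- move=> n w; apply: (le_trans (integrand_bound _ _ _ _)).
  by rewrite -[leRHS]mulr1 ler_wpM2l// natb_le1.
- exact: (finite_measure_integrable_cst P Cf measurableT).
apply: (ae_imp (first_passage_lt_ae dd0 t0)) => w Ld.
rewrite /integrand; have [tK|Kt] := leP t (K de w).
  have Ltd : first_passage t w < dd.
    by apply: Ld; apply: (le_trans tK); apply: K_mono => //; exact: ltW.
  have E n : (s n <= K de w) = true by rewrite (le_trans (ltW (st n))).
  under eq_fun do rewrite E mulr1; rewrite mulr1.
  apply: (@cvg_comp _ _ _ (fun n => dd - first_passage (s n) w) (causal f)); last first.
    by apply: cfc; rewrite subr_gt0.
  apply: cvgB; first exact: cvg_cst.
  exact: first_passage_left_continuous de0 tK st scvg.
rewrite mulr0; apply: cvg_near_cst; near=> n.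
rewrite (_ : s n <= K de w = false) ?mulr0//; apply/negP/negP; rewrite -ltNge.
near: n; move/cvgrPdist_lt : scvg => /(_ (t - K de w)); rewrite subr_gt0 => /(_ Kt).
by apply: filterS => n; rewrite gtr0_norm ?subr_gt0//; lra.
Unshelve. all: by end_near. Qed.

Let approx dd de n t : R := \sum_(k < n.+1) causal f (dd - grid de n k) *
  (survival (grid de n k.+1) t - survival (grid de n k) t).

Let S dd de t n w := step (K ^~ w) (fun u => causal f (dd - u)) de t n.

Let LS dd de t n : L1 P (S dd de t n).
Proof. by apply: L1_sum => k; apply: L1B; exact: L1_alive. Qed.

Let SI dd de t n : approx dd de n t = \int[P]_w S dd de t n w.
Proof.
rewrite /S /step I_sum => [|k]; last by apply: L1B; exact: L1_alive.
by apply: eq_bigr => k _; rewrite IB//; exact: L1_alive.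
Qed.

Let S_le dd de t n w : 0 < de -> 0 < t -> `|S dd de t n w| <= Cf * (t <= K de w)%R%:R.
Proof.
move=> de0 t0; apply: step_bound => //; first by rewrite K0.
by move=> u v u0 uv _; exact: K_mono.
Qed.

Let approx_le dd de t n : 0 < de -> 0 < t -> `|approx dd de n t| <= Cf * survival de t.
Proof.
move=> de0 t0; rewrite SI /survival -IZ; last exact: L1_alive.
apply: (@I_bound _ _ _ P) => [|w|]; [exact: L1_meas (LS _ _ _ _)|exact: S_le|].
by apply: L1Z; exact: L1_alive.
Qed.

Lemma approx_cvg dd de t : 0 < de -> de <= dd -> 0 < t ->
  approx dd de n t @[n --> \oo] --> forcing dd de t.
Proof.
move=> de0 ded t0; have dd0 : 0 < dd by exact: lt_le_trans ded.
rewrite [X in X @ _](_ : _ = fun n => \int[P]_w S dd de t n w); last first.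
  by apply/funext => n; rewrite SI.
have K0t w : K 0 w < t by rewrite K0.
have mono w u v : 0 <= u -> u <= v -> v <= de -> K u w <= K v w.
  by move=> u0 uv _; exact: K_mono.
have [|||||_ //] := @dct_ae _ _ _ P (S dd de t) (integrand dd de t) (fun=> Cf).
- by move=> n; exact: L1_meas (LS _ _ _ n).
- exact: measurable_integrand.
- move=> n w; apply: (@le_trans _ _ (Cf * (t <= K de w)%R%:R)); first exact: S_le.
  by rewrite -[leRHS]mulr1 ler_wpM2l// natb_le1.
- exact: (finite_measure_integrable_cst P Cf measurableT).
apply: (ae_imp (first_passage_lt_ae dd0 t0)) => w Ld.
have [tK|Kt] := leP t (K de w); last first.
  have := @step_cvg _ (K ^~ w) (fun u => causal f (dd - u)) de t de Cf de0 (K0t w) (mono w).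
  rewrite /integrand /= (lt_geF Kt) !mulr0; apply => // u u0 ud tK.
  by have := le_lt_trans (K_mono w u0 ud) Kt; rewrite ltNge tK.
have Ltd : first_passage t w < dd.
  by apply: Ld; apply: (le_trans tK); apply: K_mono => //; exact: ltW.
apply: (@step_cvg _ (K ^~ w) (fun u => causal f (dd - u)) de t _ Cf de0 (K0t w) (mono w)).
- by move=> u _ _; exact: fb.
- move=> u u0 _ tu; apply: first_passage_le => //; rewrite lt_neqAle u0 andbT.
  by apply/eqP => u0'; move: tu; rewrite -u0' leNgt K0t.
- move=> u u0 ud Kt; apply: (first_passage_ge de0 tK) => v v0 tv.
  rewrite leNgt; apply/negP => /ltW vu.
  by have := le_lt_trans (K_mono w (ltW v0) vu) Kt; rewrite ltNge tv.
- move=> _; apply: continuous_comp; last by apply: cfc; rewrite subr_gt0.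
  by apply: cvgB; [exact: cvg_cst|exact: cvg_id].
Qed.

(** The passage time of an independent exponential level of rate l is exponential of rate Phi(l),
    since it exceeds u with probability E[e^(-l K_u)]. In terms of step sums: the transforms in [t]
    of the increments of [survival] are the increments of the exponential distribution function
    divided by l, and the sums converge on both sides. *)
Lemma lap_forcing dd de l : 0 < de -> de <= dd -> 0 < l ->
  measurable_fun setT (causal (forcing dd de)) /\
  lap l (forcing dd de) = Phi a b l / l *
    \int[mu]_(u in `]0, de[) (expR (- (u * Phi a b l)) * f (dd - u)).
Proof.
move=> de0 ded l0; have dd0 : 0 < dd by exact: lt_le_trans ded.
have F0 := Phi_gt0 l0; set F := Phi a b l in F0 *.
have Ls u : 0 <= u -> L1 mu (weight l (survival u)) by move=> /lap_survival -/(_ l l0) [].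
have Lsk n k : L1 mu (weight l (survival (grid de n k))).
  by apply: Ls; exact: grid_ge0.
pose A n t : R := \sum_(k < n.+1) causal f (dd - grid de n k) *
  (weight l (survival (grid de n k.+1)) t - weight l (survival (grid de n k)) t).
have WE n t : weight l (approx dd de n) t = A n t.
  rewrite /weight /causal; case: ltP => t0; last first.
    rewrite mulr0 /A big1// => k _.
    by rewrite /weight /causal (le_gtF t0)// !mulr0 subrr mulr0.
  have ws u : weight l (survival u) t = expR (- (l * t)) * survival u t.
    by rewrite /weight /causal t0.
  by rewrite mulr_sumr; apply: eq_bigr => k _; rewrite !ws -mulrBr mulrCA.
have LA n : L1 mu (A n) by apply: L1_sum => k; exact: L1B.
have IA n : \int[mu]_t A n t = (\sum_(k < n.+1) causal f (dd - grid de n k) *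
    (expR (- (grid de n k * F)) - expR (- (grid de n k.+1 * F)))) / l.
  rewrite I_sum => [|k]; last exact: L1B.
  rewrite mulr_suml; apply: eq_bigr => k _.
  rewrite IB// -mulrA; congr (_ * _).
  have := (lap_survival (grid_ge0 de0 n k) l0).2; rewrite /lap => ->.
  have := (lap_survival (grid_ge0 de0 n k.+1) l0).2; rewrite /lap => ->.
  by rewrite -mulrBl -/F; congr (_ / _); ring.
have [||||LW IW] := @dct _ _ _ mu A (weight l (forcing dd de))
  (fun t => Cf * weight l (survival de) t).
- by move=> n; exact: L1_meas (LA n).
- move=> n t; rewrite -WE /weight /causal; case: (ltP 0 t) => t0; last first.
    by rewrite !mulr0 normr0.
  rewrite normrM ger0_norm ?expR_ge0// mulrCA.
  by apply: ler_wpM2l; [exact: expR_ge0|exact: approx_le].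
- by apply: L1Z; apply: Ls; exact: ltW.
- move=> t; under eq_fun do rewrite -WE; rewrite /weight /causal.
  case: ltP => t0; last by rewrite mulr0; exact: cvg_cst.
  by apply: cvgMr; exact: approx_cvg.
split; first exact: measurable_causal_weight (L1_meas LW).
(* The same step sum for the identity path, against the exponential density of rate F. Its integral
   agrees term by term with [IA], up to the factor [l]. *)
pose D n u : R := F * causal (fun u => expR (- (F * u))) u *
  step id (fun u => causal f (dd - u)) de u n.
have ID' n : \int[mu]_u D n u = l * \int[mu]_t A n t /\ L1 mu (D n).
  pose e z u : R := causal (fun u => expR (- (F * u))) u * (u <= z)%R%:R.
  have DE u : D n u = F * \sum_(k < n.+1) causal f (dd - grid de n k) *
      (e (grid de n k.+1) u - e (grid de n k) u).
    rewrite /D /step -mulrA mulr_sumr; congr (_ * _); apply: eq_bigr => k _.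
    by rewrite /e; ring.
  have Le k : L1 mu (e (grid de n k)) by exact: (causal_expR_le F0 (grid_ge0 de0 n k)).1.
  have LDe : L1 mu (fun u => \sum_(k < n.+1) causal f (dd - grid de n k) *
      (e (grid de n k.+1) u - e (grid de n k) u)).
    by apply: L1_sum => k; exact: L1B.
  have -> : D n = fun u => F * \sum_(k < n.+1) causal f (dd - grid de n k) *
      (e (grid de n k.+1) u - e (grid de n k) u) by apply/funext => u; exact: DE.
  split; last exact: L1Z.
  rewrite IZ// I_sum => [|k]; last exact: L1B.
  rewrite IA mulrCA divff ?gt_eqF// mulr1 mulr_sumr; apply: eq_bigr => k _.
  rewrite IB// mulrCA; congr (_ * _).
  have := (causal_expR_le F0 (grid_ge0 de0 n k)).2 => /= ->.
  have := (causal_expR_le F0 (grid_ge0 de0 n k.+1)).2 => /= ->.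
  rewrite -mulrBl mulrC divfK ?gt_eqF//; rewrite ![F * _]mulrC; ring.
pose J : R -> R := (fun u => expR (- (u * F)) * f (dd - u)) \_ `]0, de[.
have cfm : measurable_fun setT (causal f) by exact: measurable_causal_continuous.
have JE u : J u = ((fun u => expR (- (u * F)) * causal f (dd - u)) \_ `]0, de[) u.
  rewrite /J !patchE; case: ifP => //; rewrite mem_setE in_itv/= => /andP[u0 ud].
  by rewrite /causal subr_gt0 (lt_le_trans ud ded).
have mJ : measurable_fun setT J.
  have -> : J = (fun u => expR (- (u * F)) * causal f (dd - u)) \_ `]0, de[.
    by apply/funext => u; exact: JE.
  apply/(measurable_restrictT _ _).1 => //; apply: measurable_funTS.
  apply: measurable_funM.
    apply: measurableT_comp => //; apply: measurableT_comp => //.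
    exact: measurable_funM.
  apply: (measurableT_comp cfm); exact: measurable_funB.
have [|||||LG IG] := @dct_ae _ _ _ mu D (fun u => F * J u)
    (fun u => Cf * (F * causal (fun u => expR (- (F * u))) u)).
- by move=> n; exact: L1_meas (ID' n).2.
- exact: measurable_funM.
- move=> n u; rewrite /causal; case: (ltP 0 u) => u0; last first.
    by rewrite /D /causal (le_gtF u0) !mulr0 mul0r normr0.
  rewrite /D /causal u0 normrM mulrC (@ger0_norm _ (F * _)); last first.
    by rewrite mulr_ge0 ?expR_ge0// ltW.
  apply: ler_wpM2r; first by rewrite mulr_ge0 ?expR_ge0// ltW.
  apply: (@le_trans _ _ (Cf * (u <= de)%R%:R)).
    by apply: step_bound => // v _ _; exact: fb.
  by rewrite -[leRHS]mulr1 ler_wpM2l// natb_le1.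
- by apply: L1Z; apply: L1Z; exact: (expR_halfline F0).1.
(* At u = de the indicators of u <= de and of []0, de[] differ, and for de = dd the function f(dd -
   u), extended by 0, may be discontinuous there. *)
- exists [set de]; split => //; first exact: lebesgue_measure_set1.
  move=> u /= H; apply: contrapT => /eqP ude; apply: H.
  have [u0|u0] := leP u 0.
    rewrite (_ : J u = 0); last by rewrite /J patchE mem_setE in_itv/= (le_gtF u0).
    apply: cvg_near_cst; apply: nearW => n.
    by rewrite /D /causal (le_gtF u0) mulr0 mul0r.
  have sc : step id (fun v => causal f (dd - v)) de u n @[n --> \oo] -->
      causal f (dd - u) * (u <= de)%R%:R.
    apply: (@step_cvg _ id (fun v => causal f (dd - v)) de u u Cf de0 u0) => //.
    - by move=> v _ _ /ltW.
    - move=> ud; apply: continuous_comp; last first.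
        apply: cfc; rewrite subr_gt0; apply: lt_le_trans ded.
        by rewrite lt_neqAle ude.
      by apply: cvgB; [exact: cvg_cst|exact: cvg_id].
  have -> : F * J u = F * causal (fun u => expR (- (F * u))) u *
      (causal f (dd - u) * (u <= de)%R%:R).
    rewrite JE patchE mem_setE in_itv/= u0 le_eqVlt (negbTE ude)/=.
    rewrite (causalE (fun v => expR (- (F * v))) u0) [F * u]mulrC.
    by case: (u < de); rewrite ?mulr1 ?mulr0// mulrA.
  by rewrite /D; apply: cvgMr.
apply: (mulfI (lt0r_neq0 l0)).
have -> : l * lap l (forcing dd de) = \int[mu]_u (F * J u).
  apply: (cvg_unique (@Rhausdorff R) _ IG).
  rewrite [X in X @ _](_ : _ = fun n => l * \int[mu]_t A n t); last first.
    by apply/funext => n; exact: (ID' n).1.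
  by apply: cvgMr; exact: IW.
by rewrite IZ_measurable// [RHS]mulrA mulrCA divff ?gt_eqF// mulr1 /J -Rintegral_mkcond.
Qed.

End forcing.

End subordinator.

(** * The renewal equation *)

Lemma I_interval (R : realType) (x y : R) : x <= y ->
  L1 (@lebesgue_measure R) (fun z => (x <= z < y)%R%:R) /\
  \int[@lebesgue_measure R]_z ((x <= z < y)%R%:R : R) = y - x.
Proof.
move=> xy; have E z : (x <= z < y)%R%:R = (\1_`[x, y[ : R -> R) z.
  by rewrite indicE mem_setE.
have mI : lebesgue_measure (`[x, y[%classic : set R) = (y - x)%:E.
  rewrite lebesgue_measure_itv/= lte_fin; case: (ltP x y) => // yx.
  by have -> : x = y; [apply/eqP; rewrite eq_le xy yx|rewrite subrr].
split.
  have := integrable_indic_itv x y true true; congr (L1 _ _).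
  by apply/funext => z; rewrite -E.
under eq_I do rewrite E.
transitivity (fine (lebesgue_measure (`[x, y[%classic : set R))); last by rewrite mI.
by rewrite /Rintegral integral_indic// setIT.
Qed.

Section laplace_sum.
Context (R : realType).
Notation mu := (@lebesgue_measure R).
Implicit Types u v : R -> R.

Lemma lapD l u v : L1 mu (weight l u) -> L1 mu (weight l v) ->
  L1 mu (weight l (fun t => u t + v t)) /\
  lap l (fun t => u t + v t) = lap l u + lap l v.
Proof.
move=> Lu Lv; have E : weight l (fun t => u t + v t) = fun t => weight l u t + weight l v t.
  by apply/funext => t; rewrite /weight /causal; case: ifP => _; rewrite -mulrDr// addr0.
by rewrite /lap E; split; [exact: L1D|exact: ID].
Qed.

Lemma lapZ l u (k : R) : L1 mu (weight l u) ->
  L1 mu (weight l (fun t => k * u t)) /\ lap l (fun t => k * u t) = k * lap l u.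
Proof.
move=> Lu; have E : weight l (fun t => k * u t) = fun t => k * weight l u t.
  by apply/funext => t; rewrite /weight /causal; case: ifP => _; rewrite ?mulr0// mulrCA.
by rewrite /lap E; split; [exact: L1Z|exact: IZ].
Qed.

Lemma lap_dct l (u_ : nat -> R -> R) u g : L1 mu (weight l g) ->
  (forall n, measurable_fun setT (causal (u_ n))) ->
  (forall n t, 0 < t -> `|u_ n t| <= g t) ->
  (forall t, 0 < t -> u_ n t @[n --> \oo] --> u t) ->
  L1 mu (weight l u) /\ lap l (u_ n) @[n --> \oo] --> lap l u.
Proof.
move=> Lg mu_ ug uu.
have [||||L I] := @dct _ _ _ mu (fun n => weight l (u_ n)) (weight l u) (weight l g).
- by move=> n; apply: measurable_weight.
- move=> n t; rewrite !weight_causal /causal; case: ltP => t0; last by rewrite normr0.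
  by rewrite normrM ger0_norm ?expR_ge0// ler_wpM2l ?expR_ge0 ?ug.
- exact: Lg.
- move=> t; rewrite /weight /causal; case: ltP => t0; last exact: cvg_cst.
  by apply: cvgMr; exact: uu.
by split.
Qed.

End laplace_sum.

Section gamma_convolution.
Context (R : realType) (b s : R) (b0 : 0 < b) (s0 : 0 < s).
Notation mu := (@lebesgue_measure R).
Notation p := (gamma_density b s).
Variables (u : R -> R) (M : R).
Hypothesis mu_ : measurable_fun setT (causal u).
Hypothesis u0 : forall t, 0 < t -> 0 <= u t.
Hypothesis uM : forall t, 0 < t -> u t <= M.

Lemma causal_gamma_density : causal p = p.
Proof.
apply/funext => y; rewrite /causal; case: ltP => // y0.
by rewrite gamma_density0.
Qed.

Let p0 y : 0 <= p y. Proof. exact: gamma_density_ge0. Qed.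

Let M0 : 0 <= M. Proof. exact: le_trans (u0 ltr01) (uM ltr01). Qed.

Let uc0 t : 0 <= causal u t. Proof. exact: causal_ge0. Qed.

Let ucM t : causal u t <= M.
Proof. by rewrite /causal; case: ltP => // /uM. Qed.

Lemma L1_conv_gamma t : L1 mu (fun y => causal u (t - y) * p y).
Proof.
apply: (@L1_le _ _ _ mu _ _ _ _ (L1Z M (L1_gamma_density b0 s0))).
  apply: measurable_funM; last exact: L1_meas (L1_gamma_density b0 s0).
  by apply: measurableT_comp => //; exact: measurable_funB.
by move=> y; rewrite normrM !ger0_norm// ler_wpM2r.
Qed.

Lemma conv_gamma_ge0 t : 0 <= conv (causal u) p t.
Proof. by apply: I_ge0 => y; rewrite mulr_ge0. Qed.

Lemma conv_gamma_le t : conv (causal u) p t <= M.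
Proof.
rewrite -[leRHS]mulr1 -(I_gamma_density b0 s0) -IZ; last exact: L1_gamma_density.
apply: le_I; [exact: L1_conv_gamma|by apply: L1Z; exact: L1_gamma_density|].
by move=> y; rewrite ler_wpM2r.
Qed.

(** The extension of [u] by 0 may jump at time 0 but is left-continuous there: for y >= t, all the
    arguments approaching t - y from below are negative. *)
Lemma conv_gamma_left_continuous t : {in `]0, +oo[, continuous u} ->
  conv (causal u) p x @[x --> t^'-] --> conv (causal u) p t.
Proof.
move=> cu; apply/cvg_at_leftP => x_ [xt xcvg].
have [||||_ //] := @dct _ _ _ mu (fun n y => causal u (x_ n - y) * p y)
  (fun y => causal u (t - y) * p y) (fun y => M * p y).
- by move=> n; exact: L1_meas (L1_conv_gamma _).
- by move=> n y; rewrite normrM !ger0_norm// ler_wpM2r.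
- by apply: L1Z; exact: L1_gamma_density.
move=> y; apply: cvgMl; have [ty|ty] := leP t y.
  rewrite causal0 ?subr_le0//; apply: cvg_near_cst; apply: nearW => n.
  by rewrite causal0// subr_le0 (le_trans (ltW (xt n))).
rewrite -subr_gt0 in ty; rewrite causalE//.
have tyP : t - y \in `]0, +oo[ by rewrite in_itv/= ty.
have xycvg : x_ n - y @[n --> \oo] --> t - y by apply: cvgB => //; exact: cvg_cst.
have := @cvg_comp _ _ _ (fun n => x_ n - y) u _ _ _ xycvg (cu _ tyP).
apply: cvg_trans; apply: near_eq_cvg; near=> n; rewrite causalE//.
near: n; move/cvgrPdist_lt : xycvg => /(_ _ ty); apply: filterS => n.
by rewrite ltr_norml => /andP[_]; lra.
Unshelve. all: by end_near. Qed.

Lemma lap_conv_gamma l : 0 < l ->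
  L1 mu (weight l (conv (causal u) p)) /\
  lap l (conv (causal u) p) = lap l u * expR (- (s * ln (1 + l / b))).
Proof.
move=> l0; have [Lp <-] := lap_gamma_density (ltW l0) b0 s0.
have Lu : L1 mu (weight l u).
  apply: (@L1_weight _ _ _ M) => // t t0.
  by rewrite ger0_norm ?uM ?u0.
by have [] := lap_conv Lu Lp; rewrite causal_gamma_density.
Qed.

End gamma_convolution.

(* The forcing term [C x h] collects the contribution of the initial data
   between [x - h] and [x]; only the listed properties of it matter. *)
Record forced_solution (R : realType) (a b : R) (f : R -> R) (Cf : R)
    (r : R -> R -> R) (C : R -> R -> R -> R) : Prop := ForcedSolution {
  fs_a0 : 0 < a;
  fs_b0 : 0 < b;
  fs_cf : {in `]0, +oo[, continuous f};
  fs_fC : forall z, 0 < z -> `|f z| <= Cf;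
  fs_r0 : forall t x, 0 < t -> 0 < x -> 0 <= r t x;
  fs_rt : forall x, 0 < x -> C1 (r ^~ x);
  fs_rx : forall t, 0 < t -> C1 (r t);
  fs_rL1 : forall x, 0 < x -> L1 (@lebesgue_measure R) (causal (derive1 (r ^~ x)));
  fs_rM : forall x, 0 < x -> exists M, forall t, 0 < t -> `|r t x| <= M;
  fs_eq : forall t x, 0 < t -> 0 < x ->
    caputo_dzherbashian a b (r ^~ x) t = - derive1 (r t) x;
  fs_init : forall x, 0 < x -> r t x @[t --> 0^'+] --> f x;
  fs_bd0 : forall t, 0 < t -> r t 0 = 0;
  fs_bd : forall t, 0 < t -> r t x @[x --> 0^'+] --> (0 : R);
  fs_mC : forall x h, 0 < h -> h <= x -> measurable_fun setT (causal (C x h));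
  fs_CC : forall x h t, 0 < h -> h <= x -> 0 < t -> `|C x h t| <= Cf;
  fs_Cs : forall x h t, 0 < h -> h <= x -> 0 < t ->
    `|C x h t| <= Cf * (markov_cst R * (h * (a * log_tail b t)));
  fs_Cl : forall x h t, 0 < h -> h <= x -> 0 < t ->
    C x h s @[s --> t^'-] --> C x h t;
  fs_lapC : forall x h l, 0 < h -> h <= x -> 0 < l ->
    lap l (C x h) = Phi a b l / l *
      \int[@lebesgue_measure R]_(u in `]0, h[) (expR (- (u * Phi a b l)) * f (x - u)) }.

Section forced_solution.
Context (R : realType) (a b : R) (f : R -> R) (Cf : R) (r : R -> R -> R)
  (C : R -> R -> R -> R) (S : forced_solution a b f Cf r C).
Notation mu := (@lebesgue_measure R).
Let a0 := fs_a0 S.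
Let b0 := fs_b0 S.

Lemma fs_Cf0 : 0 <= Cf.
Proof. exact: le_trans (normr_ge0 _) (fs_fC S ltr01). Qed.

Lemma continuous_slice x : 0 < x -> {in `]0, +oo[, continuous (r ^~ x)}.
Proof.
move=> x0 t tP; have [d _] := fs_rt S x0.
exact/differentiable_continuous/derivable1_diffP/d.
Qed.

Lemma continuous_profile t : 0 < t -> {in `]0, +oo[, continuous (r t)}.
Proof.
move=> t0 x xP; have [d _] := fs_rx S t0.
exact/differentiable_continuous/derivable1_diffP/d.
Qed.

Lemma slice_ge0 t x : 0 <= x -> 0 < t -> 0 <= r t x.
Proof.
rewrite le_eqVlt => /predU1P[<- t0|x0 t0]; first by rewrite (fs_bd0 S).
exact: (fs_r0 S).
Qed.

Lemma slice0 : causal (r ^~ 0) = fun=> 0.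
Proof.
by apply/funext => t; rewrite /causal; case: ltP => // t0; rewrite (fs_bd0 S).
Qed.

Lemma measurable_slice x : 0 <= x -> measurable_fun setT (causal (r ^~ x)).
Proof.
rewrite le_eqVlt => /predU1P[<-|x0]; first by rewrite slice0; exact: measurable_cst.
exact: measurable_causal_continuous (continuous_slice x0).
Qed.

Lemma slice_bound x : 0 <= x -> exists2 M, 0 <= M & forall t, 0 < t -> r t x <= M.
Proof.
rewrite le_eqVlt => /predU1P[<-|x0].
  by exists 0 => // t t0; rewrite (fs_bd0 S).
have [M rM] := fs_rM S x0; exists M => [|t t0].
  exact: le_trans (normr_ge0 _) (rM _ ltr01).
exact: le_trans (ler_norm _) (rM _ t0).
Qed.

Lemma L1_slice l x : 0 < l -> 0 <= x -> L1 mu (weight l (r ^~ x)).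
Proof.
move=> l0 x0; have [M M0 rM] := slice_bound x0.
apply: (@L1_weight _ _ _ M) => //; first exact: measurable_slice.
by move=> t t0; rewrite ger0_norm ?rM// slice_ge0.
Qed.

Lemma profile_cvg (x_ : nat -> R) (c t : R) : (forall n, 0 < x_ n) -> 0 <= c ->
  x_ n @[n --> \oo] --> c -> 0 < t -> r t (x_ n) @[n --> \oo] --> r t c.
Proof.
move=> x0 c0 xc t0; move: c0; rewrite le_eqVlt => /predU1P[c0|c0]; last first.
  have cP : c \in `]0, +oo[ by rewrite in_itv/= c0.
  exact: (@cvg_comp _ _ _ x_ (r t) _ _ _ xc (continuous_profile t0 cP)).
rewrite -c0 (fs_bd0 S)//; have /cvg_at_rightP := fs_bd S t0.
by apply; split => //; rewrite c0.
Qed.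

Definition source l x : R := \int[mu]_z (expR (Phi a b l * z) * causal f z * (z < x)%R%:R).

Let source_meas l x :
  measurable_fun setT (fun z => expR (Phi a b l * z) * causal f z * (z < x)%R%:R).
Proof.
apply: measurable_funM; last by apply: measurable_natmul_bool; exact: measurable_fun_ltr.
apply: measurable_funM; last exact: measurable_causal_continuous (fs_cf S).
by apply: measurableT_comp => //; exact: measurable_funM.
Qed.

Let causal_f_le z : `|causal f z| <= Cf.
Proof.
by rewrite /causal; case: ifP => [/(fs_fC S)//|_]; rewrite normr0 fs_Cf0.
Qed.

Lemma L1_source l x : 0 < l ->
  L1 mu (fun z => expR (Phi a b l * z) * causal f z * (z < x)%R%:R).
Proof.
move=> l0; have F0 := Phi_gt0 a0 b0 l0.
have [x0|x0] := leP x 0.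
  rewrite (_ : (fun z => _) = fun=> 0); first exact: L1_0.
  apply/funext => z; rewrite /causal; case: (ltP 0 z) => z0; last by rewrite mulr0 mul0r.
  by rewrite ltNge (le_trans x0 (ltW z0)) mulr0.
have [Lx _] := I_interval (ltW x0).
apply: (@L1_le _ _ _ mu _ _ (source_meas l x) _ (L1Z (expR (Phi a b l * x) * Cf) Lx)) => z.
rewrite !normrM; have [z0|z0] := leP z 0.
  by rewrite causal0// normr0 mulr0 mul0r !mulr_ge0 ?expR_ge0 ?fs_Cf0.
rewrite (ltW z0)/= (@ger0_norm _ _%:R)//; case: (ltP z x) => zx; last by rewrite !mulr0.
rewrite !mulr1 ger0_norm ?expR_ge0// ler_pM ?expR_ge0//.
by rewrite ler_expR; apply: ler_wpM2l; exact: ltW.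
Qed.

Lemma source_le l x y : 0 < l -> 0 <= x -> x <= y ->
  `|source l y - source l x| <= expR (Phi a b l * y) * Cf * (y - x).
Proof.
move=> l0 x0 xy; have F0 := Phi_gt0 a0 b0 l0.
have [Lxy Ixy] := I_interval xy.
rewrite /source -IB; [|exact: L1_source|exact: L1_source].
rewrite -Ixy -IZ//; apply: (@I_bound _ _ _ mu) => [|z|]; last exact: L1Z.
  by apply: measurable_funB; exact: source_meas.
rewrite -mulrBr !normrM; case: (leP x z) => xz /=; last first.
  by rewrite (lt_le_trans xz xy) subrr normr0 !mulr0.
rewrite subr0 (@ger0_norm _ _%:R)//; case: (ltP z y) => zy; last by rewrite !mulr0.
rewrite !mulr1 ger0_norm ?expR_ge0// ler_pM ?expR_ge0//.
by rewrite ler_expR; apply: ler_wpM2l; exact: ltW.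
Qed.

(** The substitution z = y - u. The difference of the sources lives on x <= z < y and the reflected
    integral on x < z < y, whence the null set {x}. *)
Lemma source_forcing l x y : 0 < l -> 0 <= x -> x < y ->
  \int[mu]_(u in `]0, y - x[) (expR (- (u * Phi a b l)) * f (y - u)) =
  expR (- (Phi a b l * y)) * (source l y - source l x).
Proof.
move=> l0 x0 xy; rewrite /source -IB; [|exact: L1_source|exact: L1_source].
set F := Phi a b l; pose h z : R := expR (F * z) * causal f z * (x < z < y)%R%:R.
transitivity (expR (- (F * y)) * \int[mu]_z h z); last first.
  congr (_ * _); apply: eq_I_ae.
  - apply: measurable_funM.
      apply: measurable_funM; last exact: measurable_causal_continuous (fs_cf S).
      by apply: measurableT_comp => //; exact: measurable_funM.
    apply: measurable_natmul_bool; apply: measurable_and; exact: measurable_fun_ltr.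
  - by apply: measurable_funB; exact: source_meas.
  - exists [set x]; split => //; first exact: lebesgue_measure_set1.
    move=> z /= H; apply: contrapT => /eqP zx; apply: H.
    rewrite /h -mulrBr; congr (_ * _); rewrite [x < z]lt_neqAle eq_sym zx/=.
    case: (leP x z) => xz/=; first by rewrite subr0.
    by rewrite (lt_trans xz xy) subrr.
have Lh : L1 mu h.
  have F0 := Phi_gt0 a0 b0 l0; have [Lxy _] := I_interval (ltW xy).
  apply: (@L1_le _ _ _ mu _ _ _ _ (L1Z (expR (F * y) * Cf) Lxy)) => [|z].
    apply: measurable_funM.
      apply: measurable_funM; last exact: measurable_causal_continuous (fs_cf S).
      by apply: measurableT_comp => //; exact: measurable_funM.
    apply: measurable_natmul_bool; apply: measurable_and; exact: measurable_fun_ltr.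
  rewrite /h !normrM (@ger0_norm _ _%:R)//.
  case: (ltP x z) => xz /=; last by rewrite mulr0 !mulr_ge0 ?expR_ge0 ?fs_Cf0.
  rewrite (ltW xz)/=; case: (ltP z y) => zy; last by rewrite !mulr0.
  rewrite !mulr1 ger0_norm ?expR_ge0// ler_pM ?expR_ge0//.
  by rewrite ler_expR; apply: ler_wpM2l; exact: ltW.
rewrite -(I_reflect y Lh) -IZ; last exact: L1_reflect.
rewrite Rintegral_mkcond; apply: eq_I => u; rewrite patchE mem_setE in_itv/= /h.
rewrite ltrBrDr -ltrBrDl ltrBlDr ltrDl andbC.
case: ifP => [/andP[u0 uy]|_]; last by rewrite !mulr0.
rewrite mulr1 causalE; last first.
  exact: le_lt_trans x0 u0.
by rewrite mulrA -expRD; congr (expR _ * _); ring.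
Qed.

Definition invariant l x : R :=
  expR (Phi a b l * x) * lap l (r ^~ x) - Phi a b l / l * source l x.

(** The range l >= 1 contains the integers that [lap_inj] tests, and e^(-lt) <= e^(-t) there, so
    that estimates with the weight e^(-t) serve every [l]. *)
Definition eqv x y := forall l, 1 <= l -> invariant l x = invariant l y.

Lemma eqv_sym x y : eqv x y -> eqv y x.
Proof. by move=> xy l l1; rewrite xy. Qed.

Lemma eqv_trans y x z : eqv x y -> eqv y z -> eqv x z.
Proof. by move=> xy yz l l1; rewrite xy// yz. Qed.

(** Dividing the equality of invariants by e^(Phi x2) expresses the transform at x2 through e^(-Phi
    (x2 - x1)), which is the transform of the gamma density, and through the transform of the
    forcing. Both sides are bounded and left-continuous in time. *)
Lemma renewal x1 x2 t : 0 <= x1 -> x1 < x2 -> eqv x1 x2 -> 0 < t ->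
  r t x2 = conv (causal (r ^~ x1)) (gamma_density b (a * (x2 - x1))) t +
    C x2 (x2 - x1) t.
Proof.
move=> x10 x12 x12E t0; have x20 : 0 < x2 by exact: le_lt_trans x12.
have h0 : 0 < x2 - x1 by rewrite subr_gt0.
have hx : x2 - x1 <= x2 by rewrite lerBlDr lerDl.
have s0 : 0 < a * (x2 - x1) by rewrite mulr_gt0.
have [M1 M10 r1M] := slice_bound x10; have [M2 M20 r2M] := slice_bound (ltW x20).
have m1 := measurable_slice x10; have r10 s := @slice_ge0 s _ x10.
have LC l : 0 < l -> L1 mu (weight l (C x2 (x2 - x1))).
  by move=> l0; apply: (@L1_weight _ _ _ Cf) => //; [exact: (fs_mC S)|move=> s; exact: (fs_CC S)].
apply: (@lap_inj R (r ^~ x2) (fun t => conv (causal (r ^~ x1))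
  (gamma_density b (a * (x2 - x1))) t + C x2 (x2 - x1) t) M2 (M1 + Cf) t) => //.
- exact: measurable_slice (ltW x20).
- apply: measurable_causal_weight.
  exact: L1_meas (lapD (lap_conv_gamma b0 s0 m1 r10 r1M ltr01).1 (LC _ ltr01)).1.
- by move=> s s0'; rewrite ger0_norm ?r2M ?slice_ge0// ltW.
- move=> s s0'; apply: (le_trans (ler_normD _ _)); apply: lerD; last exact: (fs_CC S).
  by rewrite ger0_norm; [exact: conv_gamma_le|exact: conv_gamma_ge0].
- move=> j j0; have l1 : 1 <= j%:R :> R by rewrite ler1n.
  have l0 : 0 < j%:R :> R by rewrite ltr0n.
  have [Lc Ic] := lap_conv_gamma b0 s0 m1 r10 r1M l0.
  rewrite (lapD Lc (LC _ l0)).2 Ic (fs_lapC S)// source_forcing//.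
  have := x12E _ l1; rewrite /invariant.
  have -> : a * (x2 - x1) * ln (1 + j%:R / b) = Phi a b j%:R * x2 - Phi a b j%:R * x1.
    by rewrite /Phi; ring.
  rewrite opprB expRD expRN; set X1 := expR (_ * x1); set X2 := expR (_ * x2) => H.
  have X20 : X2 != 0 by rewrite gt_eqF// expR_gt0.
  apply: (mulfI X20); rewrite mulrDr.
  have -> : X2 * (lap j%:R (r^~ x1) * (X1 / X2)) = X1 * lap j%:R (r ^~ x1).
    by field.
  have -> : X2 * (Phi a b j%:R / j%:R * (X2^-1 * (source j%:R x2 - source j%:R x1)))
      = Phi a b j%:R / j%:R * source j%:R x2 - Phi a b j%:R / j%:R * source j%:R x1.
    by field; rewrite X20 gt_eqF.
  by lra.
- have tP : t \in `]0, +oo[ by rewrite in_itv/= t0.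
  by apply: cvg_at_left_filter; exact: continuous_slice.
- apply: cvgD; last exact: (fs_Cl S).
  move: x10; rewrite le_eqVlt => /predU1P[x10'|x10']; last first.
    exact: (conv_gamma_left_continuous b0 s0 m1 r10 r1M) (continuous_slice x10').
  rewrite -x10' slice0 (_ : conv _ _ = fun=> 0); first exact: cvg_cst.
  apply/funext => x; rewrite /conv -[RHS](I_0 mu); apply: eq_I => y.
  by rewrite mul0r.
Qed.

Lemma invariant_cvg (x_ : nat -> R) (c l : R) : 0 < l -> (forall n, 0 < x_ n) -> 0 <= c ->
  x_ n @[n --> \oo] --> c ->
  lap l (r ^~ (x_ n)) @[n --> \oo] --> lap l (r ^~ c) ->
  invariant l (x_ n) @[n --> \oo] --> invariant l c.
Proof.
move=> l0 x0 c0 xc lapc; have F0 := Phi_gt0 a0 b0 l0.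
rewrite /invariant; apply: cvgB.
  apply: cvgM => //.
  apply: (@cvg_comp _ _ _ x_ (fun x => expR (Phi a b l * x)) _ _ _ xc).
  apply: continuous_comp; last exact: continuous_expR.
  exact: mulrl_continuous.
apply: cvgMr; apply/cvgrPdist_le => e e0.
pose K := expR (Phi a b l * (c + 1)) * Cf.
have K0 : 0 <= K by rewrite mulr_ge0 ?expR_ge0 ?fs_Cf0.
have d0 : 0 < Num.min 1 (e / (K + 1)) by rewrite lt_min ltr01 divr_gt0// ltr_wpDl.
move/cvgrPdist_lt : xc => /(_ _ d0); apply: filterS => n.
rewrite lt_min => /andP[h1 h2].
have key x y : 0 <= x -> x <= y -> y <= c + 1 -> `|x - y| < e / (K + 1) ->
    `|source l y - source l x| <= e.
  move=> x0' xy yc xye; apply: (le_trans (source_le l0 x0' xy)).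
  apply: (@le_trans _ _ (K * (y - x))).
    apply: ler_wpM2r; first by rewrite subr_ge0.
    by apply: ler_wpM2r; [exact: fs_Cf0|rewrite ler_expR ler_wpM2l// ltW].
  move: xye; rewrite distrC ger0_norm ?subr_ge0// ltr_pdivlMr ?ltr_wpDl// => /ltW.
  by apply: le_trans; rewrite mulrC ler_wpM2l ?subr_ge0// lerDl.
have [xc'|cx] := leP (x_ n) c.
  by apply: key => //; [exact: ltW|rewrite lerDl|rewrite distrC].
rewrite distrC; apply: key => //; first exact: ltW.
by move: h1; rewrite ltr_norml => /andP[h _]; lra.
Qed.

(** The renewal equation started at x1 bounds all slices between x1 and d by the same M + Cf; this
    supplies the domination that the hypotheses on [r] do not give. *)
Lemma eqv_left_limit x1 d : 0 <= x1 -> x1 < d ->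
  (forall x, x1 <= x -> x < d -> eqv x1 x) -> eqv x1 d.
Proof.
move=> x10 x1d x1E l l1; have l0 : 0 < l by exact: lt_le_trans l1.
have d0 : 0 < d by exact: le_lt_trans x1d.
pose x_ := left_seq x1 d.
have x_lt n : x1 < x_ n < d by exact: left_seq_itv.
have x_0 n : 0 < x_ n by have /andP[h _] := x_lt n; exact: le_lt_trans h.
have xd : x_ n @[n --> \oo] --> d by exact: cvg_left_seq.
have [M M0 rM] := slice_bound x10.
apply: (cvg_unique (@Rhausdorff R) _ (@invariant_cvg x_ d l l0 x_0 (ltW d0) xd _)).
  apply: cvg_near_cst; apply: nearW => n; have /andP[h1 h2] := x_lt n.
  by rewrite -(x1E (x_ n))// ltW.
have [||||_ //] := @lap_dct _ l (fun n => r ^~ (x_ n)) (r ^~ d) (fun=> M + Cf).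
- exact: L1_weight_cst.
- by move=> n; exact: measurable_slice (ltW (x_0 n)).
- move=> n t t0; have /andP[h1 h2] := x_lt n.
  rewrite (renewal x10 h1)//; last by apply: x1E => //; exact: ltW.
  apply: (le_trans (ler_normD _ _)); have h0 : 0 < x_ n - x1 by rewrite subr_gt0.
  have s0 : 0 < a * (x_ n - x1) by rewrite mulr_gt0.
  apply: lerD; last by apply: (fs_CC S) => //; rewrite lerBlDr lerDl.
  have m1 := measurable_slice x10; have r10 s := @slice_ge0 s _ x10.
  by rewrite ger0_norm; [exact: conv_gamma_le|exact: conv_gamma_ge0].
- by move=> t t0; apply: profile_cvg => //; exact: ltW.
Qed.

End forced_solution.

(** * Left endpoints of equivalence intervals *)

Section bounded_primitive.
Context (R : realType).
Notation mu := (@lebesgue_measure R).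
Variables (u : R -> R) (M : R).
Hypothesis mu_ : measurable_fun setT (causal u).
Hypothesis u0 : forall t, 0 < t -> 0 <= u t.
Hypothesis uM : forall t, 0 < t -> u t <= M.

Let uc0 t : 0 <= causal u t. Proof. exact: causal_ge0. Qed.

Lemma primitiveE t : primitive u t = \int[mu]_s (causal u s * (s < t)%R%:R).
Proof.
rewrite /primitive Rintegral_mkcond; apply: eq_I => s.
rewrite patchE mem_setE in_itv/= /causal.
by case: (ltP 0 s) => s0 /=; case: (ltP s t) => st; rewrite ?mulr1 ?mulr0 ?mul0r.
Qed.

Lemma L1_below t : L1 mu (fun s => causal u s * (s < t)%R%:R).
Proof.
have mb : measurable_fun setT (fun s => causal u s * (s < t)%R%:R).
  apply: measurable_funM => //; apply: measurable_natmul_bool.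
  exact: measurable_fun_ltr.
have [t0|t0] := leP t 0.
  rewrite (_ : (fun s => _) = fun=> 0); first exact: L1_0.
  apply/funext => s; rewrite /causal; case: (ltP 0 s) => s0; last by rewrite mul0r.
  by rewrite ltNge (le_trans t0 (ltW s0)) mulr0.
have [Lx _] := I_interval (ltW t0).
apply: (@L1_le _ _ _ mu _ _ mb _ (L1Z M Lx)) => s.
rewrite ger0_norm ?mulr_ge0// /causal; case: (ltP 0 s) => s0; last first.
  rewrite mul0r mulr_ge0//; exact: le_trans (u0 ltr01) (uM ltr01).
rewrite (ltW s0)/=; case: (s < t); rewrite ?mulr0// !mulr1; exact: uM.
Qed.

Lemma primitive_le_mono s t : s <= t -> primitive u s <= primitive u t.
Proof.
move=> st; rewrite !primitiveE; apply: le_I; [exact: L1_below|exact: L1_below|].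
move=> z; apply: ler_wpM2l => //; rewrite ler_nat.
by case: (ltP z s) => // zs; rewrite (lt_le_trans zs st).
Qed.

Lemma primitive_nonpos t : t <= 0 -> primitive u t = 0.
Proof.
move=> t0; rewrite /primitive set_itv_ge ?Rintegral_set0//.
by rewrite bnd_simp -leNgt.
Qed.

Lemma primitive_ge0 t : 0 <= primitive u t.
Proof. by rewrite primitiveE; apply: I_ge0 => s; rewrite mulr_ge0. Qed.

Lemma primitive_diff_ge (m s t : R) : 0 < s -> s <= t ->
  (forall z, s <= z -> z < t -> m <= u z) ->
  m * (t - s) <= primitive u t - primitive u s.
Proof.
move=> s0 st umz; have [Lst Ist] := I_interval st.
rewrite !primitiveE -IB; [|exact: L1_below|exact: L1_below].
rewrite -Ist -IZ//; apply: le_I; [exact: L1Z|by apply: L1B; exact: L1_below|].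
move=> z; rewrite -mulrBr; case: (leP s z) => sz /=; last first.
  by rewrite (lt_le_trans sz st) subrr !mulr0.
rewrite subr0 causalE ?(lt_le_trans s0 sz)//.
by case: (ltP z t) => zt; rewrite ?mulr0// !mulr1 umz.
Qed.

Lemma primitive_window t y : 0 <= y ->
  L1 mu (fun z => causal u (t - z) * (0 < z <= y)%R%:R) /\
  \int[mu]_z (causal u (t - z) * (0 < z <= y)%R%:R) = primitive u t - primitive u (t - y).
Proof.
move=> y0.
pose g s : R := causal u s * (s < t)%R%:R - causal u s * (s < t - y)%R%:R.
have L : L1 mu g := L1B (L1_below t) (L1_below (t - y)).
have E : (fun z => causal u (t - z) * (0 < z <= y)%R%:R) = (fun z => g (t - z)).
  apply/funext => z /=; rewrite /g -mulrBr; congr (_ * _).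
  rewrite ltrBlDr ltrDl ltrD2l ltrN2; case: (ltP 0 z) => z0 /=.
    by case: (leP z y); rewrite ?subr0 ?subrr.
  by rewrite ltNge (le_trans z0 y0) subrr.
rewrite E; split; first exact: L1_reflect.
by rewrite (I_reflect t L) !primitiveE IB//; exact: L1_below.
Qed.

End bounded_primitive.

Section gamma_smoothing.
Context (R : realType) (b s : R) (b0 : 0 < b) (s0 : 0 < s).
Notation mu := (@lebesgue_measure R).
Notation p := (gamma_density b s).
Variables (u : R -> R) (M : R).
Hypothesis mu_ : measurable_fun setT (causal u).
Hypothesis u0 : forall t, 0 < t -> 0 <= u t.
Hypothesis uM : forall t, 0 < t -> u t <= M.

Let uc0 t : 0 <= causal u t. Proof. exact: causal_ge0. Qed.

(** A probability density on the positive half-line only moves mass to later times. *)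
Lemma primitive_conv_gamma_le t :
  L1 mu ((conv (causal u) p) \_ `]0, t[) /\
  primitive (conv (causal u) p) t <= primitive u t.
Proof.
have Lu := L1_below mu_ u0 uM t; have Lp := L1_gamma_density b0 s0.
have [Lc Ic _] := conv_L1 Lu Lp.
have p0 y : 0 <= p y by exact: gamma_density_ge0.
have E z : ((conv (causal u) p) \_ `]0, t[) z =
    ((conv (fun s => causal u s * (s < t)%R%:R) p) \_ `]0, t[) z.
  rewrite !patchE; case: ifP => //; rewrite mem_setE in_itv/= => /andP[_ zt].
  apply: eq_I => y; have [y0|y0] := leP y 0; first by rewrite gamma_density0// !mulr0.
  by rewrite (_ : z - y < t) ?mulr1// ltrBlDr (lt_trans zt)// ltrDl.
have Lr : L1 mu ((conv (fun s => causal u s * (s < t)%R%:R) p) \_ `]0, t[).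
  by apply/L1_restrict => //; exact: integrableS Lc.
have -> : (conv (causal u) p) \_ `]0, t[ =
    (conv (fun s => causal u s * (s < t)%R%:R) p) \_ `]0, t[.
  by apply/funext => z; exact: E.
split; first exact: Lr.
have -> : primitive u t = \int[mu]_z conv (fun s => causal u s * (s < t)%R%:R) p z.
  by rewrite primitiveE Ic I_gamma_density// mulr1.
rewrite /primitive Rintegral_mkcond; under eq_I do rewrite E.
apply: le_I => // z; rewrite patchE; case: ifP => // _.
rewrite (_ : point = 0 :> R)//; apply: I_ge0 => y.
by apply: mulr_ge0 => //; exact: mulr_ge0.
Qed.

(** A step function below the density bounds the convolution from below in terms of the cumulated
    mass of [u] alone. This form survives limits in which only cumulated masses converge. *)
Lemma conv_gamma_ge_steps n (w y : nat -> R) t :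
  (forall k, 0 <= y k) ->
  (forall z, 0 < z -> \sum_(k < n) w k * (z <= y k)%R%:R <= p z) ->
  \sum_(k < n) w k * (primitive u t - primitive u (t - y k)) <= conv (causal u) p t.
Proof.
move=> y0 wp; have Lw k := (primitive_window mu_ u0 uM t (y0 k)).
have -> : \sum_(k < n) w k * (primitive u t - primitive u (t - y k)) =
    \int[mu]_z \sum_(k < n) w k * (causal u (t - z) * (0 < z <= y k)%R%:R).
  rewrite I_sum => [|k]; last exact: (Lw k).1.
  by apply: eq_bigr => k _; rewrite (Lw k).2.
apply: le_I.
- by apply: L1_sum => k; exact: (Lw k).1.
- exact: (L1_conv_gamma b0 s0 mu_ u0 uM).
move=> z; have [z0|z0] := leP z 0.
  under eq_bigr do rewrite /= !mulr0.
  by rewrite sumr_const mul0rn gamma_density0// mulr0.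
rewrite (_ : \sum_(k < n) _ = causal u (t - z) * \sum_(k < n) w k * (z <= y k)%R%:R).
  by apply: ler_wpM2l => //; exact: wp.
by rewrite mulr_sumr; apply: eq_bigr => k _ /=; rewrite mulrCA.
Qed.

End gamma_smoothing.

Section lower_steps.
Context (R : realType) (p : R -> R) (h : R) (h0 : 0 < h).
Hypothesis p_noninc : forall y z, 0 < y -> y <= z -> p z <= p y.
Hypothesis p_ge0 : forall y, 0 <= p y.

(** By telescoping, on the cell ending at h (k + 1) the value is p(h (k + 1)) - p(h (m + 1)). The
    combination of indicators with nonnegative coefficients is the shape that [conv_gamma_ge_steps]
    takes. *)
Definition lower_steps m z : R :=
  \sum_(k < m) (p (h * k.+1%:R) - p (h * k.+2%:R)) * (z <= h * k.+1%:R)%R%:R.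

Let y0 k : 0 < h * k.+1%:R. Proof. by rewrite mulr_gt0. Qed.

Let yS k : h * k.+2%:R = h * k.+1%:R + h.
Proof. by rewrite -[k.+2%:R]natr1 mulrDr mulr1. Qed.

Lemma lower_steps_bounds m z : 0 < z ->
  (p (z + h) - p (h * m.+1%:R)) * (z <= h * m.+1%:R)%R%:R <= lower_steps m z
  <= (p z - p (h * m.+1%:R)) * (z <= h * m.+1%:R)%R%:R.
Proof.
move=> z0; elim: m => [|m /andP[IH1 IH2]].
  rewrite /lower_steps big_ord0 mulr1; case: (leP z h) => zh; rewrite /= ?mulr1 ?mulr0 ?lexx//.
  rewrite subr_le0 subr_ge0; apply/andP; split; apply: p_noninc => //.
  by rewrite lerDr ltW.
rewrite /lower_steps big_ord_recr/= -/(lower_steps m z) yS.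
set y := h * m.+1%:R in IH1 IH2 *; have y_0 : 0 < y := y0 m.
move: IH1 IH2; case: (leP z y) => zy; rewrite /= ?mulr1 ?mulr0 ?addr0 => IH1 IH2.
  have -> : (z <= y + h) = true by rewrite (le_trans zy)// lerDl ltW.
  rewrite !mulr1; apply/andP; split; lra.
have -> : lower_steps m z = 0 by apply/eqP; rewrite eq_le IH1 IH2.
case: (leP z (y + h)) => zyh; rewrite /= ?mulr1 ?mulr0 ?lexx//.
rewrite subr_le0 subr_ge0; apply/andP; split; apply: p_noninc => //.
  by rewrite addr_gt0.
by rewrite lerD2r ltW.
Qed.

Lemma lower_steps_le m z : 0 < z -> lower_steps m z <= p z.
Proof.
move=> z0; have /andP[_] := lower_steps_bounds m z0.
move/le_trans; apply; case: (z <= h * m.+1%:R); rewrite /= ?mulr1 ?mulr0//.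
by rewrite gerBl.
Qed.

End lower_steps.

(** A Dini derivative argument by induction down from [T]. The infimum of the times [t] with G T - G
    t <= k (T - t) has the same property by control from the right; if it were positive, the second
    hypothesis would push it further down. *)
Lemma dini_decreasing (R : realType) (G : R -> R) (T : R) : 0 <= T ->
  (forall s e, 0 <= s -> s < T -> 0 < e ->
    exists2 tau, s < tau & forall t, s < t -> t < tau -> G t <= G s + e) ->
  (forall t k, 0 < t -> t <= T -> 0 < k ->
    exists y, [/\ 0 < y, y <= t & G t - G (t - y) <= k * y]) ->
  G T <= G 0.
Proof.
move=> T0 usc left; apply/ler_addgt0Pr => e e0.
(* At time 0 the accumulated loss k T is at most e. *)
pose k := e / (T + 1); have k0 : 0 < k by rewrite divr_gt0// ltr_wpDl.
pose Q := [set t | [/\ 0 <= t, t <= T & G T - G t <= k * (T - t)]].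
have QT : Q T by split => //; rewrite !subrr mulr0.
have Qlb : has_lbound Q by exists 0 => t [].
have hQ : has_inf Q by split => //; exists T.
set s := inf Q; have s0 : 0 <= s by apply: lb_le_inf; [exists T|move=> t []].
have sT : s <= T by apply: ge_inf.
have Qs : Q s.
  split => //; move: sT; rewrite le_eqVlt => /predU1P[->|sT].
    by rewrite !subrr mulr0.
  apply/ler_addgt0Pr => e' e'0; have [tau st H] := usc s e' s0 sT e'0.
  have tau_s : 0 < tau - s by rewrite subr_gt0.
  have [t Qt] := inf_adherent tau_s hQ; rewrite -/s addrC subrK => ttau.
  have st' : s <= t by exact: ge_inf.
  have [t0 tT Gt] := Qt; move: st'; rewrite le_eqVlt => /predU1P[ts|st'].
    by rewrite -ts in Gt; apply: (le_trans Gt); rewrite lerDl ltW.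
  have h1 := H t st' ttau; have : k * (T - t) <= k * (T - s).
    by apply: ler_wpM2l; [exact: ltW|rewrite lerB// ltW].
  by lra.
have [sz|sz] := leP s 0.
  have s_eq : s = 0 by apply/eqP; rewrite eq_le sz s0.
  have [_ _] := Qs; rewrite s_eq subr0 => h; rewrite -lerBlDl; apply: (le_trans h).
  by rewrite /k mulrAC ler_pdivrMr ?ltr_wpDl// ler_wpM2l ?(ltW e0)// lerDl ler01.
have [y [y0 ys Gy]] := left s k sz sT k0.
have : s <= s - y.
  apply: ge_inf => //; split; [by rewrite subr_ge0|by rewrite (le_trans _ sT)// gerBl ltW|].
  have [_ _] := Qs; rewrite (_ : T - (s - y) = (T - s) + y); last by ring.
  by rewrite mulrDr; lra.
by rewrite lerBrDr gerDl leNgt y0.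
Qed.

Lemma L1_log_tail_itv (R : realType) (b t : R) : 0 < b ->
  L1 (@lebesgue_measure R) (log_tail b \_ `]0, t[).
Proof.
move=> b0; have Lw := L1Z (expR t) (L1_weight_log_tail b0 (@ltr01 R)).
have E z : (log_tail b \_ `]0, t[) z = causal (log_tail b) z * (z < t)%R%:R.
  rewrite patchE mem_setE in_itv/= /causal.
  by case: (ltP 0 z) => z0 /=; case: (ltP z t) => zt; rewrite ?mulr1 ?mulr0 ?mul0r.
have c0 z : 0 <= causal (log_tail b) z by apply: causal_ge0 => y; exact: log_tail_ge0.
apply: (@L1_le _ _ _ (@lebesgue_measure R) _ _ _ _ Lw) => [|z].
  rewrite (_ : _ \_ _ = fun z => causal (log_tail b) z * (z < t)%R%:R); last first.
    by apply/funext => z; exact: E.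
  apply: measurable_funM; first exact: measurable_log_tail.
  by apply: measurable_natmul_bool; exact: measurable_fun_ltr.
rewrite E ger0_norm ?mulr_ge0// /weight mulrA -expRD mul1r mulrC; apply: ler_pM => //.
case: (ltP z t) => zt; last exact: expR_ge0.
by rewrite -expR0 ler_expR subr_ge0 ltW.
Qed.

Lemma I_interval_oc (R : realType) (x y : R) : x <= y ->
  L1 (@lebesgue_measure R) (fun z => (x < z <= y)%R%:R) /\
  \int[@lebesgue_measure R]_z ((x < z <= y)%R%:R : R) = y - x.
Proof.
move=> xy; have [L I] := I_interval xy.
pose g (z : R) : R := (x <= z < y)%R%:R.
have E : (fun z : R => (x < z <= y)%R%:R : R) = (fun z => g (x + y - z)).
  apply/funext => z /=; congr (_%:R); rewrite andbC.
  by congr (nat_of_bool (_ && _)); apply/idP/idP; lra.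
rewrite E; split; first exact: L1_reflect.
by rewrite (I_reflect (x + y) L).
Qed.

Lemma cvg_sum_ord (R : realType) (g : nat -> nat -> R) (l : nat -> R) n :
  (forall k, g k m @[m --> \oo] --> l k) ->
  \sum_(k < n) g k m @[m --> \oo] --> \sum_(k < n) l k.
Proof.
move=> gl; elim: n => [|n IH].
  by under eq_fun do rewrite big_ord0; rewrite big_ord0; exact: cvg_cst.
by under eq_fun do rewrite big_ord_recr/=; rewrite big_ord_recr/=; apply: cvgD.
Qed.

(** The right-hand side is the integral of [lower_steps], which is at least p(z + h) - p(eta) on
    []0, eta]]; the shift by h only loses the mass of []0, h]]. *)
Lemma lower_steps_integral (R : realType) (b s eta : R) N : 0 < b -> 0 < s -> s <= 1 ->
  0 < eta ->
  let p := gamma_density b s in let h := eta / N.+1%:R in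
  \int[@lebesgue_measure R]_z (p z * (h < z <= eta)%R%:R) - eta * p eta <=
  \sum_(k < N) (p (h * k.+1%:R) - p (h * k.+2%:R)) * (h * k.+1%:R).
Proof.
move=> b0 s0 s1 eta0 /=; pose mu := @lebesgue_measure R.
set p := gamma_density b s; set h := eta / N.+1%:R.
have h0 : 0 < h by rewrite divr_gt0.
have hN : h * N.+1%:R = eta by rewrite divfK.
have Lp : L1 mu p by exact: L1_gamma_density.
have p0 z : 0 <= p z by exact: gamma_density_ge0.
have pn y1 y2 : 0 < y1 -> y1 <= y2 -> p y2 <= p y1.
  by move=> *; exact: gamma_density_noninc.
have Lpi (A : R -> bool) : measurable_fun setT A -> L1 mu (fun z => p z * (A z)%:R).
  move=> mA; apply: (@L1_le _ _ _ mu _ _ _ _ Lp) => [|z].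
    by apply: measurable_funM; [exact: L1_meas Lp|exact: measurable_natmul_bool].
  rewrite normrM (ger0_norm (p0 z)) -[leRHS]mulr1.
  by apply: ler_wpM2l => //; exact: normr_natb_le1.
have mA (x y : R) : measurable_fun setT (fun z : R => x < z <= y).
  by apply: measurable_and; [exact: measurable_fun_ltr|exact: measurable_fun_ler].
have Li k := I_interval_oc (ltW (mulr_gt0 h0 (ltr0Sn R k))).
have -> : \sum_(k < N) (p (h * k.+1%:R) - p (h * k.+2%:R)) * (h * k.+1%:R) =
    \int[mu]_z \sum_(k < N) (p (h * k.+1%:R) - p (h * k.+2%:R)) *
      (0 < z <= h * k.+1%:R)%R%:R.
  rewrite I_sum => [|k]; last exact: (Li k).1.
  by apply: eq_bigr => k _; have := (Li k).2; rewrite subr0 => ->.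
have [Leta Ieta] := I_interval_oc (ltW eta0); rewrite subr0 in Ieta.
have -> : eta * p eta = \int[mu]_z (p eta * (0 < z <= eta)%R%:R).
  by rewrite IZ// Ieta mulrC.
pose g z := p z * (h < z <= eta + h)%R%:R.
have Lg : L1 mu g by exact: Lpi.
apply: (@le_trans _ _ (\int[mu]_z g z - \int[mu]_z (p eta * (0 < z <= eta)%R%:R))).
  rewrite lerD2r; apply: le_I => //; first exact: Lpi.
  move=> z; apply: ler_wpM2l => //; rewrite ler_nat.
  case: (ltP h z) => //= hz; case: (leP z eta) => // ze.
  by rewrite (le_trans ze)// lerDl ltW.
rewrite -(I_shift (- h) Lg) -IB; [|exact: L1_shift|exact: L1Z].
apply: le_I.
- by apply: L1B; [exact: L1_shift|exact: L1Z].
- by apply: L1_sum => k; exact: (Li k).1.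
move=> z; rewrite /g opprK ltrDr lerD2r -mulrBl; have [z0|z0] := leP z 0.
  by rewrite /= mulr0; under eq_bigr do rewrite mulr0; rewrite sumr_const mul0rn.
have /andP[+ _] := lower_steps_bounds h0 pn N z0.
by rewrite hN.
Qed.

(** As N grows, the integral exhausts the mass of []0, eta]], which is 1 minus the tail. *)
Lemma gamma_lower_limit (R : realType) (b s eta K Q : R) : 0 < b -> 0 < s ->
  0 < eta -> 0 < K ->
  let p := gamma_density b s in
  (forall N, K * (\int[@lebesgue_measure R]_z (p z * (eta / N.+1%:R < z <= eta)%R%:R)
     - eta * p eta) <= Q) ->
  K * (1 - markov_cst R * (s * log_tail b eta) - eta * p eta) <= Q.
Proof.
move=> b0 s0 eta0 K0 p H; pose mu := @lebesgue_measure R.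
have Lp : L1 mu p by exact: L1_gamma_density.
have p0 z : 0 <= p z by exact: gamma_density_ge0.
have mA (x y : R) : measurable_fun setT (fun z : R => x < z <= y).
  by apply: measurable_and; [exact: measurable_fun_ltr|exact: measurable_fun_ler].
have mpA x y : measurable_fun setT (fun z => p z * (x < z <= y)%R%:R).
  by apply: measurable_funM; [exact: L1_meas Lp|exact: measurable_natmul_bool].
have pA_le x y z : `|p z * (x < z <= y)%R%:R| <= p z.
  rewrite normrM (ger0_norm (p0 z)) -[leRHS]mulr1.
  by apply: ler_wpM2l => //; exact: normr_natb_le1.
have [||||LI cv] := @dct _ _ _ mu (fun N z => p z * (eta / N.+1%:R < z <= eta)%R%:R)
  (fun z => p z * (0 < z <= eta)%R%:R) p.
- by move=> n; exact: mpA.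
- by move=> n z; exact: pA_le.
- exact: Lp.
- move=> z; apply: cvgMr; have [z0|z0] := leP z 0.
    apply: cvg_near_cst; apply: nearW => n /=.
    by rewrite ltNge (le_trans z0)// divr_ge0// ltW.
  apply: cvg_near_cst; near=> n; rewrite (_ : eta / n.+1%:R < z)//.
  rewrite ltr_pdivrMr// -ltr_pdivrMl// mulrC.
  near: n; exists (Num.truncn (eta / z)) => // n /= hn.
  by apply: (lt_le_trans (truncnS_gt _)); rewrite ler_nat ltnS.
have tail := gamma_density_tail b0 s0 eta0; rewrite -/p in tail.
have Lt : L1 mu (p \_ `[eta, +oo[).
  by apply/L1_restrict => //; exact: integrableS Lp.
have I1 : 1 <= \int[mu]_z (p z * (0 < z <= eta)%R%:R) + \int[mu]_z (p \_ `[eta, +oo[) z.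
  apply: (@le_trans _ _ (\int[mu]_z p z)); first by rewrite (I_gamma_density b0 s0).
  rewrite -ID//; apply: le_I => //; first exact: L1D.
  move=> z; rewrite patchE mem_setE in_itv/= andbT.
  have [z0|z0] := leP z 0.
    rewrite mulr0 add0r (_ : p z = 0); last exact: gamma_density0.
    by case: ifP.
  case: (leP eta z) => ez; first by rewrite lerDr mulr_ge0.
  by rewrite (ltW ez) mulr1 lerDl.
have lim : K * (\int[mu]_z (p z * (eta / N.+1%:R < z <= eta)%R%:R) - eta * p eta)
    @[N --> \oo] --> K * (\int[mu]_z (p z * (0 < z <= eta)%R%:R) - eta * p eta).
  by apply: cvgMr; apply: cvgB => //; exact: cvg_cst.
have HQ : K * (\int[mu]_z (p z * (0 < z <= eta)%R%:R) - eta * p eta) <= Q.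
  by apply: (ler_cvg_to lim (cvg_cst Q)); exact: nearW.
apply: le_trans HQ; apply: ler_wpM2l; first exact: ltW.
by rewrite lerD2r lerBlDr; apply: (le_trans I1); rewrite lerD2l.
Unshelve. all: by end_near. Qed.

Lemma slice_lower (R : realType) (a b : R) (f : R -> R) (Cf : R) (r : R -> R -> R)
    (C : R -> R -> R -> R) (c t k : R) : forced_solution a b f Cf r C -> 0 <= c ->
  0 < t -> 0 < k ->
  exists2 eta, 0 < eta < t & forall z, t - eta <= z -> z < t -> r t c - k <= r z c.
Proof.
move=> S; rewrite le_eqVlt => /predU1P[<-|c0] t0 k0.
  have t2 : t / 2 < t by lra.
  exists (t / 2) => [|z tz _]; first by rewrite t2 divr_gt0.
  have z0 : 0 < z by apply: lt_le_trans tz; rewrite subr_gt0.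
  by rewrite !(fs_bd0 S)// sub0r oppr_le0 ltW.
have tP : t \in `]0, +oo[ by rewrite in_itv/= t0.
have := continuous_slice S c0 tP => /cvgrPdist_lt /(_ k k0)[e /= e0 He].
pose m := Num.min e t; have m0 : 0 < m by rewrite lt_min t0 e0.
have m2 : m / 2 < m by lra.
exists (m / 2); first by rewrite divr_gt0//= (lt_le_trans m2)// ge_min lexx orbT.
move=> z tz zt; have : `|r t c - r z c| < k.
  apply: He => /=; rewrite ger0_norm ?subr_ge0 ?(ltW zt)//.
  have : m <= e by rewrite ge_min lexx.
  by lra.
by rewrite ltr_norml => /andP[_]; lra.
Qed.

Section right_limit.
Context (R : realType) (a b : R) (f : R -> R) (Cf : R) (r : R -> R -> R)
  (C : R -> R -> R -> R) (S : forced_solution a b f Cf r C).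
Notation mu := (@lebesgue_measure R).
Let a0 := fs_a0 S.
Let b0 := fs_b0 S.
Variables c d : R.
Hypotheses (c0 : 0 <= c) (cd : c < d).
Hypothesis cdE : forall x y, c < x < d -> c < y < d -> eqv a b f r x y.

Let cumul x t := primitive (r ^~ x) t.

Let drift t := Cf * (markov_cst R * a) * primitive (log_tail b) t.

Let pos x : c < x -> 0 <= x. Proof. by move=> cx; exact: ltW (le_lt_trans c0 cx). Qed.

(** Convolution delays mass and the forcing adds at most (y - x) [drift t]. Hence cumulated mass
    minus x [drift t] is nonincreasing in [x], and has a limit as x decreases to [c]. *)
Lemma cumul_drift x y t : c < x -> x < y -> y < d ->
  cumul y t <= cumul x t + (y - x) * drift t.
Proof.
move=> cx xy yd; have x0 := pos cx; have y0 := pos (lt_trans cx xy).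
have h0 : 0 < y - x by rewrite subr_gt0.
have hy : y - x <= y by rewrite lerBlDr lerDl.
have s0 : 0 < a * (y - x) by rewrite mulr_gt0.
have [My My0 ryM] := slice_bound S y0; have [Mx Mx0 rxM] := slice_bound S x0.
have ry0 t' := @slice_ge0 _ _ _ _ _ _ _ S t' _ y0.
have rx0 t' := @slice_ge0 _ _ _ _ _ _ _ S t' _ x0.
have Ly := L1_below (measurable_slice S y0) ry0 ryM t.
have [Lx Ix] := primitive_conv_gamma_le b0 s0 (measurable_slice S x0) rx0 rxM t.
have Ll : L1 mu ((log_tail b) \_ `]0, t[) by exact: L1_log_tail_itv.
apply: (@le_trans _ _ (primitive (conv (causal (r ^~ x)) (gamma_density b (a * (y - x)))) t
    + (y - x) * drift t)); last by rewrite lerD2r.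
pose k := Cf * (markov_cst R * ((y - x) * a)).
have -> : (y - x) * drift t = \int[mu]_z (k * (log_tail b \_ `]0, t[) z).
  by rewrite IZ// -Rintegral_mkcond /drift /primitive /k; ring.
have pE u : primitive u t = \int[mu]_z (u \_ `]0, t[) z by exact: Rintegral_mkcond.
rewrite pE -ID//; last exact: L1Z.
rewrite /cumul primitiveE; apply: le_I => //; first by apply: L1D => //; exact: L1Z.
move=> z; rewrite !patchE mem_setE in_itv/=; case: (ltP 0 z) => z0 /=; last first.
  by rewrite causal0// mul0r mulr0 addr0.
rewrite causalE//; case: (ltP z t) => zt; last by rewrite !mulr0 addr0.
rewrite mulr1 (renewal S x0 xy)//; last first.
  by apply: cdE; rewrite ?cx ?(lt_trans xy yd) ?yd ?(lt_trans cx xy).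
rewrite lerD2l; apply: (le_trans (ler_norm _)); apply: (le_trans (fs_Cs S h0 hy z0)).
by rewrite /k !mulrA.
Qed.

Let x_ := right_seq c d.

Let x_itv n : c < x_ n < d. Proof. exact: right_seq_itv. Qed.

Let x_gt0 n : 0 < x_ n.
Proof. by have /andP[h _] := x_itv n; exact: le_lt_trans h. Qed.

Let x_cvg : x_ n @[n --> \oo] --> c. Proof. exact: cvg_right_seq. Qed.

(** The invariant at l = 1 is constant on []c, d[], and the source is bounded there. *)
Lemma lap_slice_bound : exists B, forall n, lap 1 (r ^~ (x_ n)) <= B.
Proof.
have F0 := Phi_gt0 a0 b0 (@ltr01 R); set F := Phi a b 1 in F0.
pose I := invariant a b f r 1 (x_ 0).
exists (`|I| + F * (expR (F * d) * Cf * d + `|source a b f 1 0|)) => n.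
have IE : invariant a b f r 1 (x_ n) = I by exact: cdE (lexx 1).
have Lge0 : 0 <= lap 1 (r ^~ (x_ n)).
  apply: I_ge0 => t; rewrite weight_causal causal_ge0// => s s0.
  by rewrite mulr_ge0 ?expR_ge0// (slice_ge0 S)// ltW.
have : lap 1 (r ^~ (x_ n)) <= expR (F * x_ n) * lap 1 (r ^~ (x_ n)).
  by rewrite ler_peMl// -expR0 ler_expR mulr_ge0// ltW.
move/le_trans; apply.
have -> : expR (F * x_ n) * lap 1 (r ^~ (x_ n)) = I + F * source a b f 1 (x_ n).
  by rewrite -IE /invariant -/F divr1 subrK.
apply: lerD; first exact: ler_norm.
apply: ler_wpM2l; first exact: ltW.
rewrite -lerBlDr; have /andP[_ xd] := x_itv n.
have h := source_le S (@ltr01 R) (lexx 0) (ltW (x_gt0 n)).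
apply: (@le_trans _ _ `|source a b f 1 (x_ n) - source a b f 1 0|).
  apply: le_trans (lerB_dist _ _); rewrite lerD2r; exact: ler_norm.
apply: (le_trans h); rewrite subr0; apply: ler_pM; rewrite ?(ltW (x_gt0 _)) ?(ltW xd)//.
  by rewrite mulr_ge0 ?expR_ge0 ?(fs_Cf0 S).
apply: ler_wpM2r; first exact: fs_Cf0 S.
by rewrite ler_expR; apply: ler_wpM2l; exact: ltW.
Qed.

Lemma cumul_le_lap x t : 0 <= x -> cumul x t <= expR t * lap 1 (r ^~ x).
Proof.
move=> x0; have [M M0 rM] := slice_bound S x0.
have rx0 t' := @slice_ge0 _ _ _ _ _ _ _ S t' _ x0.
have L := L1_slice S (@ltr01 R) x0.
rewrite /cumul primitiveE /lap -IZ//; apply: le_I.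
- exact: L1_below (measurable_slice S x0) rx0 rM t.
- exact: L1Z.
move=> s; rewrite /weight mulrA -expRD mul1r mulrC; apply: ler_pM => //.
- exact: causal_ge0.
case: (ltP s t) => st; last exact: expR_ge0.
by rewrite -expR0 ler_expR subr_ge0 ltW.
Qed.

Lemma cumul_cvg t : cvgn (fun n => cumul (x_ n) t).
Proof.
have E : (fun n => cumul (x_ n) t) =
    (fun n => (cumul (x_ n) t - x_ n * drift t) + x_ n * drift t).
  by apply/funext => n; rewrite subrK.
rewrite E; apply: is_cvgD; last first.
  by apply: is_cvgMl; apply: cvgP x_cvg.
apply: nondecreasing_is_cvgn.
  move=> n m nm; have := right_seq_ge (ltW cd) nm; rewrite -/(x_ n) -/(x_ m) le_eqVlt.
  move=> /predU1P[->//|mn]; have /andP[h1 h2] := x_itv m; have /andP[h3 h4] := x_itv n.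
  have := cumul_drift t h1 mn h4; rewrite mulrBl; lra.
have [B HB] := lap_slice_bound.
exists (expR t * B + d * `|drift t|) => _ [n _ <-].
apply: lerD.
  apply: (le_trans (cumul_le_lap _ (ltW (x_gt0 n)))).
  by apply: ler_wpM2l; [exact: expR_ge0|exact: HB].
have /andP[_ /ltW xd] := x_itv n.
apply: (le_trans (ler_norm _)); rewrite normrN normrM ler_wpM2r//.
by rewrite ger0_norm// ltW.
Qed.

(** The distribution function of the limit of the measures r(t, x_n) dt. The aim is that this limit
    is r(t, c) dt. *)
Let limc t := limn (fun n => cumul (x_ n) t).

Let limcE t : cumul (x_ n) t @[n --> \oo] --> limc t. Proof. exact: cumul_cvg. Qed.

Let slice0 n t : 0 < t -> 0 <= r t (x_ n).
Proof. by apply: (slice_ge0 S); exact: ltW. Qed.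

Let slice_m n : measurable_fun setT (causal (r ^~ (x_ n))).
Proof. by apply: (measurable_slice S); exact: ltW. Qed.

Let limc0 : limc 0 = 0.
Proof.
apply/cvg_lim; first exact: Rhausdorff.
rewrite [X in X @ _](_ : _ = fun=> 0); first exact: cvg_cst.
by apply/funext => n; rewrite /cumul primitive_nonpos.
Qed.

Let drift_ge0 t : 0 <= drift t.
Proof.
apply: mulr_ge0.
  by rewrite !mulr_ge0 ?(fs_Cf0 S)// ltW// markov_cst_gt0.
apply: Rintegral_ge0 => y /=; rewrite in_itv/= => /andP[y0 _].
exact: log_tail_ge0.
Qed.

Let cumul_le_limc n t : cumul (x_ n) t <= limc t + d * drift t.
Proof.
apply: (ler_cvg_to (cvg_cst (cumul (x_ n) t)) (cvgD (@limcE t) (cvg_cst (d * drift t)))).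
exists n => // m /= nm; have /andP[h1 h2] := x_itv m; have /andP[h3 h4] := x_itv n.
change (cumul (x_ n) t <= cumul (x_ m) t + d * drift t).
have := right_seq_ge (ltW cd) nm; rewrite -/(x_ n) -/(x_ m) le_eqVlt.
move=> /predU1P[->|mn].
  by rewrite lerDl mulr_ge0// (le_trans c0)// ltW.
apply: (le_trans (cumul_drift t h1 mn h4)); rewrite lerD2l.
apply: ler_wpM2r; first exact: drift_ge0.
by have := x_gt0 m; lra.
Qed.

(** Fatou's lemma, since profiles converge pointwise: mass can only be gained in the limit. The
    converse inequality [limc_le] is the difficult one. *)
Let limc_ge t : cumul c t <= limc t.
Proof.
apply/ler_addgt0Pr => e e0; have := @limcE t => /cvgrPdist_le /(_ e e0)[N _ HN].
have [||||_] := @fatou_real _ _ _ mu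
  (fun n s => causal (r ^~ (x_ (n + N)%N)) s * (s < t)%R%:R)
  (fun s => causal (r ^~ c) s * (s < t)%R%:R) (limc t + e).
- move=> n; have [M M0 rM] := slice_bound S (ltW (x_gt0 (n + N))).
  exact: L1_below (slice_m _) (@slice0 _) rM t.
- by move=> n s; rewrite mulr_ge0// causal_ge0// => z; exact: slice0.
- move=> s; apply: cvgMl; rewrite /causal; case: (ltP 0 s) => s0; last exact: cvg_cst.
  by rewrite (cvg_shiftn N (fun n => r s (x_ n))); exact: (profile_cvg S x_gt0 c0 x_cvg s0).
- move=> n; rewrite -primitiveE; have := HN (n + N)%N (leq_addl _ _).
  by rewrite /= distrC ler_norml => /andP[_]; rewrite lerBlDl.
by rewrite -primitiveE.
Qed.

(** Renewal from x_m to x_m + e: the left side converges through cumulated masses, the right side by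
    continuity of the profile at time [t]. As x_m <= c + (d - c) / 2, the bound on [e] keeps x_m + e
    below [d]. *)
Let profile_ge_steps e t B n (w y : nat -> R) : 0 < e -> e < (d - c) / 2 -> 0 < t ->
  (forall k, 0 <= y k) ->
  (forall z, 0 < z ->
    \sum_(k < n) w k * (z <= y k)%R%:R <= gamma_density b (a * e) z) ->
  (forall x, e <= x -> `|C x e t| <= B) ->
  \sum_(k < n) w k * (limc t - limc (t - y k)) - B <= r t (c + e).
Proof.
move=> e0 ed t0 y0 wp CB; have s0 : 0 < a * e by rewrite mulr_gt0.
have lhs : \sum_(k < n) w k * (cumul (x_ m) t - cumul (x_ m) (t - y k)) - B @[m --> \oo]
    --> \sum_(k < n) w k * (limc t - limc (t - y k)) - B.
  apply: cvgB; last exact: cvg_cst.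
  apply: (@cvg_sum_ord _ (fun k m => w k * (cumul (x_ m) t - cumul (x_ m) (t - y k)))
    (fun k => w k * (limc t - limc (t - y k)))) => k; apply: cvgMr; apply: cvgB; exact: limcE.
have xe : x_ m + e @[m --> \oo] --> c + e by apply: cvgD => //; exact: cvg_cst.
have rhs : r t (x_ m + e) @[m --> \oo] --> r t (c + e).
  apply: (profile_cvg S _ _ xe t0) => [m|]; last by rewrite addr_ge0// ltW.
  by rewrite addr_gt0.
apply: (ler_cvg_to lhs rhs); apply: nearW => m.
have /andP[h1 h2] := x_itv m.
have xed : x_ m + e < d.
  have : (d - c) / m.+2%:R <= (d - c) / 2.
    by rewrite ler_wpM2l ?subr_ge0 ?(ltW cd)// lef_pV2 ?posrE// ler_nat.
  rewrite /x_ /right_seq => hk.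
  apply: (@le_lt_trans _ _ (c + (d - c) / 2 + e)); first by rewrite lerD2r lerD2l.
  by lra.
have [M M0 rM] := slice_bound S (ltW (x_gt0 m)).
rewrite (@renewal _ _ _ _ _ _ _ S (x_ m))//; last 3 first.
- exact: ltW.
- by rewrite ltrDl.
- by apply: cdE; apply/andP; split => //; apply: (lt_trans h1); rewrite ltrDl.
rewrite [x_ m + e - _]addrC addKr.
have := conv_gamma_ge_steps b0 s0 (slice_m m) (@slice0 m) rM t y0 wp.
have := CB (x_ m + e); rewrite lerDr (ltW (x_gt0 m)) => /(_ isT).
rewrite ler_norml => /andP[+ _]; rewrite /cumul; lra.
Qed.

Let small_step : exists2 e0, 0 < e0 < (d - c) / 2 & a * e0 < 1.
Proof.
have dc : 0 < (d - c) / 2 by rewrite divr_gt0// subr_gt0.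
pose m := Num.min ((d - c) / 2) a^-1; have m0 : 0 < m by rewrite lt_min dc invr_gt0.
have m2 : m / 2 < m by lra.
exists (m / 2); first by rewrite divr_gt0//= (lt_le_trans m2)// ge_min lexx.
apply: (@lt_le_trans _ _ (a * m)); first by rewrite ltr_pM2l.
by rewrite -ler_pdivlMl// mulr1 ge_min lexx orbT.
Qed.

(** No atoms: if more than [e] of mass lay between s and t, the density near its singularity would
    give r(t, c + h) >= p(t - s) e - Cf, which exceeds the bound M of that slice once t is close to
    s. *)
Let limc_right s e : 0 <= s -> 0 < e ->
  exists2 tau, s < tau & forall t, s < t -> t < tau -> limc t <= limc s + e.
Proof.
move=> s0 e0; have [h /andP[h0 hd] ah] := small_step.
have ah0 : 0 < a * h by rewrite mulr_gt0.
have ch0 : 0 <= c + h by rewrite addr_ge0// ltW.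
have [M M0 rM] := slice_bound S ch0.
have [y0 y00 Hy] := gamma_density_pinfty ((M + Cf + 1) / e) b0 ah0 ah.
exists (s + y0) => [|t st ty]; first by rewrite ltrDl.
rewrite leNgt; apply/negP => jump.
have t0 : 0 < t by exact: le_lt_trans st.
have eta0 : 0 < t - s by rewrite subr_gt0.
pose p := gamma_density b (a * h).
have : p (t - s) * (limc t - limc s) - Cf <= r t (c + h).
  have := @profile_ge_steps h t Cf 1 (fun=> p (t - s)) (fun=> t - s) h0 hd t0
    (fun=> ltW eta0).
  rewrite big_ord1 subKr; apply => [z z0|x hx]; last exact: (fs_CC S).
  rewrite big_ord1; case: (leP z (t - s)) => zt; rewrite ?mulr1 ?mulr0.
    by apply: gamma_density_noninc => //; exact: ltW.
  exact: gamma_density_ge0.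
have h1 : (M + Cf + 1) / e <= p (t - s) by apply: Hy => //; rewrite ltrBlDl.
have h2 := rM t t0.
have : (M + Cf + 1) / e * e <= p (t - s) * (limc t - limc s).
  apply: ler_pM => //.
  - by rewrite divr_ge0 ?addr_ge0 ?(fs_Cf0 S)// ltW.
  - exact: ltW.
  - by rewrite lerBrDl ltW.
rewrite divfK ?gt_eqF//; move: h2.
by move: (p (t - s) * _) (r t (c + h)) => X Y; lra.
Qed.

(** No excess density: smoothing over a length e gives r(t, c + e) >= K (1 - O(e)) - O(e), because
    the gamma density of parameter a e keeps all its mass but O(e) within distance eta. Then e -> 0
    with [t] fixed. *)
Let limc_slope t eta K : 0 < t -> 0 < eta -> 0 < K ->
  (forall y, 0 < y -> y <= eta -> K * y <= limc t - limc (t - y)) -> K <= r t c.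
Proof.
move=> t0 eta0 K0 slope; have [e0 /andP[e00 ed] ae0] := small_step.
have [B HB] := gamma_density_small b0 eta0.
have key e : 0 < e -> e <= e0 ->
    K * (1 - markov_cst R * (a * e * log_tail b eta) - B * (a * e) * eta) -
      Cf * (markov_cst R * (e * (a * log_tail b t))) <= r t (c + e).
  move=> e_0 ee0; have s0 : 0 < a * e by rewrite mulr_gt0.
  have s1 : a * e <= 1.
    by apply: le_trans (ltW ae0); rewrite ler_pM2l.
  rewrite lerBlDr; pose p := gamma_density b (a * e).
  apply: (@le_trans _ _ (K * (1 - markov_cst R * (a * e * log_tail b eta) - eta * p eta))).
    apply: ler_wpM2l; first exact: ltW.
    by rewrite lerD2l lerN2 mulrC ler_wpM2r ?HB// ltW.
  apply: gamma_lower_limit => // N.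
  have h0 : 0 < eta / N.+1%:R by rewrite divr_gt0.
  pose h := eta / N.+1%:R; pose y k := h * k.+1%:R.
  have y0 k : 0 < y k by rewrite mulr_gt0.
  have pn y1 y2 : 0 < y1 -> y1 <= y2 -> p y2 <= p y1.
    by move=> *; exact: gamma_density_noninc.
  have p0 y1 : 0 <= p y1 by exact: gamma_density_ge0.
  rewrite -lerBlDr; apply: le_trans (@profile_ge_steps e t
    (Cf * (markov_cst R * (e * (a * log_tail b t)))) N
    (fun k => p (y k) - p (y k.+1)) y e_0 (le_lt_trans ee0 ed) t0 (fun k => ltW (y0 k))
    _ _); last 2 first.
  - by move=> z z0; exact: (lower_steps_le h0 pn p0 N z0).
  - by move=> x ex; exact: (fs_Cs S).
  rewrite lerD2r; apply: (le_trans (ler_wpM2l (ltW K0) (lower_steps_integral N b0 s0 s1 eta0))).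
  rewrite mulr_sumr; apply: ler_sum => k _; rewrite mulrCA; apply: ler_wpM2l.
    rewrite subr_ge0; apply: pn; first exact: y0.
    by apply: ler_wpM2l; [exact: ltW|rewrite ler_nat].
  apply: (slope (y k)); first exact: y0.
  apply: (@le_trans _ _ (h * N.+1%:R)); last by rewrite divfK.
  by apply: ler_wpM2l; [exact: ltW|rewrite ler_nat ltnS ltnW].
pose e_ := right_seq 0 e0.
have e_itv n : 0 < e_ n < e0 by exact: right_seq_itv.
have e_cvg : e_ n @[n --> \oo] --> 0 by exact: cvg_right_seq.
have ce_cvg : c + e_ n @[n --> \oo] --> c.
  by rewrite -[X in _ --> X]addr0; apply: cvgD => //; exact: cvg_cst.
have rhs : r t (c + e_ n) @[n --> \oo] --> r t c.
  apply: (profile_cvg S _ c0 ce_cvg t0) => n.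
  by have /andP[h _] := e_itv n; rewrite ltr_wpDl.
pose Q := K * (markov_cst R * (a * log_tail b eta) + B * a * eta) +
  Cf * (markov_cst R * (a * log_tail b t)).
have lhs : K - Q * e_ n @[n --> \oo] --> K.
  rewrite -[X in _ --> X]subr0; apply: cvgB; first exact: cvg_cst.
  by rewrite -(mulr0 Q); apply: cvgMr.
apply: (ler_cvg_to lhs rhs); apply: nearW => n; have /andP[h1 /ltW h2] := e_itv n.
apply: le_trans (key _ h1 h2); rewrite le_eqVlt; apply/orP; left; apply/eqP.
by rewrite /Q; ring.
Qed.

(** [dini_decreasing] applied to [limc] minus the cumulated mass of the slice at [c]: [limc_right]
    controls it from the right, [limc_slope] from the left. *)
Let limc_le T : 0 < T -> limc T <= cumul c T.
Proof.
move=> T0; have [M M0 rM] := slice_bound S c0.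
have mc := measurable_slice S c0; have rc0 t := @slice_ge0 _ _ _ _ _ _ _ S t _ c0.
have mono := primitive_le_mono mc rc0 rM.
suff : limc T - cumul c T <= limc 0 - cumul c 0.
  by rewrite limc0 /cumul [primitive _ 0]primitive_nonpos// subrr subr_le0.
apply: (@dini_decreasing _ (fun t => limc t - cumul c t)) => [|s e s0 sT e0|t k t0 tT k0].
- exact: ltW.
- have [tau st H] := limc_right s0 e0; exists tau => // t s_t ttau.
  have := H t s_t ttau; have := mono _ _ (ltW s_t); rewrite /cumul.
  move: (limc t) (limc s) (primitive (r ^~ c) t) (primitive (r ^~ c) s).
  by move=> *; lra.
apply: contrapT => H.
have [eta eta0 Heta] : exists2 eta, 0 < eta < t & forall z, t - eta <= z -> z < t ->
    r t c - k / 2 <= r z c.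
  by apply: slice_lower S c0 _ _; rewrite ?divr_gt0.
have /andP[eta_0 etat] := eta0.
(* On the window the slice stays above r(t, c) - k/2, so an excess slope above [k] would give [limc]
   at least the slope r(t, c) + k/2. *)
suff : r t c + k / 2 <= r t c by rewrite gerDl leNgt divr_gt0.
apply: (@limc_slope t eta) => // [|y y0 yeta].
  by rewrite ltr_wpDl ?rc0// divr_gt0.
have yt : y < t by exact: le_lt_trans etat.
have ty0 : 0 < t - y by rewrite subr_gt0.
have h1 : (r t c - k / 2) * (t - (t - y)) <= primitive (r ^~ c) t - primitive (r ^~ c) (t - y).
  apply: (primitive_diff_ge mc rc0 rM) => //; first by rewrite gerBl ltW.
  by move=> z tz zt; apply: Heta => //; apply: le_trans tz; rewrite lerB.
have h2 : k * y < limc t - cumul c t - (limc (t - y) - cumul c (t - y)).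
  rewrite ltNge; apply/negP => h; apply: H; exists y; split => //; exact: ltW.
move: h1 h2; rewrite subKr /cumul mulrBl mulrDl.
move: (limc t) (limc (t - y)) (primitive (r ^~ c) t) (primitive (r ^~ c) (t - y)) (r t c).
by move=> *; lra.
Qed.

(** The slices have no common bound near [c], but their primitives do, by [limc] and the drift.
    Hence dominated convergence is applied to primitives, and lap(u) = l lap(primitive u) brings the
    result back to slices. *)
Lemma eqv_right_limit x : c < x < d -> eqv a b f r c x.
Proof.
move=> cxd l l1; have l0 : 0 < l by exact: lt_le_trans l1.
have [M M0 rM] := slice_bound S c0.
have Lr n := L1_slice S l0 (ltW (x_gt0 n)).
have Ld := lap_primitive l0 (L1_weight_log_tail b0 l0).
have limc_eq t : 0 < t -> limc t = cumul c t.
  by move=> t0; apply/eqP; rewrite eq_le limc_ge limc_le.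
have Lc := lap_primitive l0 (L1_slice S l0 c0).
have Lg : L1 mu (weight l (fun t => cumul c t + d * drift t)).
  apply: (lapD Lc.1 _).1; apply: (lapZ _ _).1; apply: (lapZ _ _).1; exact: Ld.1.
have [|||_ cv] := @lap_dct _ l (fun n => cumul (x_ n)) (cumul c) _ Lg.
- by move=> n; apply: measurable_causal_weight; exact: L1_meas (lap_primitive l0 (Lr n)).1.
- move=> n t t0; rewrite ger0_norm; first by rewrite -limc_eq//; exact: cumul_le_limc.
  have [M' M'0 rM'] := slice_bound S (ltW (x_gt0 n)).
  exact: (primitive_ge0 (@slice0 n)).
- by move=> t t0; rewrite -limc_eq.
have lc : lap l (r ^~ (x_ n)) @[n --> \oo] --> lap l (r ^~ c).
  have E u : L1 mu (weight l u) -> lap l u = l * lap l (primitive u).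
    by move=> Lu; rewrite (lap_primitive l0 Lu).2 mulrCA divff ?mulr1// gt_eqF.
  rewrite (E _ (L1_slice S l0 c0)).
  rewrite [X in X @ _](_ : _ = fun n => l * lap l (cumul (x_ n))); last first.
    by apply/funext => n; rewrite E.
  exact: cvgMr.
have H := invariant_cvg S l0 x_gt0 c0 x_cvg lc.
apply: (cvg_unique (@Rhausdorff R) H).
by apply: cvg_near_cst; apply: nearW => n; exact: cdE l1.
Qed.

End right_limit.

(** * Baire category and chains of points *)

Lemma fubini_ge0 d1 d2 (T1 : measurableType d1) (T2 : measurableType d2)
    (R : realType) (m1 : {sigma_finite_measure set T1 -> \bar R})
    (m2 : {sigma_finite_measure set T2 -> \bar R}) (F : T1 * T2 -> R) (g : T2 -> R) :
  measurable_fun setT F -> (forall z, 0 <= F z) ->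
  (forall y, L1 m1 (fun x => F (x, y))) ->
  (forall y, \int[m1]_x F (x, y) <= g y) -> L1 m2 g ->
  [/\ L1 m1 (fun x => \int[m2]_y F (x, y)),
      \int[m1]_x \int[m2]_y F (x, y) <= \int[m2]_y g y &
      {ae m1, forall x, L1 m2 (fun y => F (x, y))}].
Proof.
move=> mF F0 LF Fg Lg; pose G y := \int[m1]_x F (x, y).
have G0 y : 0 <= G y by exact: I_ge0.
have mFE : measurable_fun setT (EFin \o F) by exact/measurable_EFinP.
have mG : measurable_fun setT G.
  have F0' z : (0 <= (EFin \o F) z)%E by rewrite lee_fin.
  have := @measurable_fun_fubini_tonelli_G _ _ _ _ _ m1 (EFin \o F) mFE F0'.
  by move=> h; apply: measurableT_comp => //.
have LG : L1 m2 G.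
  by apply: (@L1_le _ _ _ m2 _ _ mG _ Lg) => y; rewrite ger0_norm//; exact: Fg.
have [|L1F _ -> aeF] := @fubini_real _ _ _ _ R m1 m2 F mF LF.
  under eq_fun do (under eq_I do rewrite ger0_norm//); exact: LG.
by split => //; exact: le_I.
Qed.

Section real_line.
Context (R : realType).
Implicit Types (x y z : R) (Q : R -> Prop).

(** Real induction: at the supremum [s] of the points satisfying [Q], the step carries [Q] from just
    left of [s] to just right of it. *)
Lemma interval_induction Q x1 x2 : x1 <= x2 -> Q x1 ->
  (forall s, x1 <= s -> s <= x2 -> exists2 e, 0 < e &
    forall z z', x1 <= z -> s - e < z -> z <= s -> Q z ->
      z <= z' -> z' < s + e -> z' <= x2 -> Q z') -> Q x2.
Proof.
move=> x12 Q1 step; pose A := [set z | [/\ x1 <= z, z <= x2 & Q z]].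
have A1 : A x1 by [].
have Aub : has_ubound A by exists x2 => z [].
have hA : has_sup A by split => //; exists x1.
set s := sup A; have sx1 : x1 <= s by exact: ub_le_sup.
have sx2 : s <= x2 by apply: ge_sup; [exists x1|move=> z []].
have [e e0 He] := step s sx1 sx2.
have [z Az sez] := sup_adherent e0 hA; have [z1 z2 Qz] := Az.
have zs : z <= s by exact: ub_le_sup.
pose z' := Num.min x2 (s + e / 2).
have zz' : z <= z' by rewrite le_min z2 (le_trans zs)// lerDl divr_ge0// ltW.
have z'e : z' < s + e by rewrite gt_min; apply/orP; right; lra.
have z'2 : z' <= x2 by rewrite ge_min lexx.
have Qz' := He z z' z1 sez zs Qz zz' z'e z'2.
have : z' <= s by apply: ub_le_sup => //; split => //; exact: le_trans zz'.
rewrite ge_min => /orP[x2s|]; last by rewrite gerDl leNgt divr_gt0.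
by move: Qz'; rewrite (_ : z' = x2)//; apply/min_idPl; rewrite (le_trans x2s)// lerDl divr_ge0// ltW.
Qed.

Lemma locally_constant_interval (E : R -> R -> Prop) x1 x2 :
  (forall x, E x x) -> (forall x y z, E x y -> E y z -> E x z) ->
  x1 <= x2 ->
  (forall x, x1 <= x -> x <= x2 -> exists2 e, 0 < e &
    forall y z, x1 <= y -> y <= x2 -> x1 <= z -> z <= x2 ->
      `|y - x| < e -> `|z - x| < e -> E y z) -> E x1 x2.
Proof.
move=> Er Et x12 loc; apply: (@interval_induction (E x1) x1 x2) => // s s1 s2.
have [e e0 He] := loc s s1 s2; exists e => // z z' z1 sz zs Ez zz' z's z'2.
apply: Et Ez _; apply: He => //.
- exact: le_trans s2.
- exact: le_trans zz'.
- by rewrite ltr_norml; apply/andP; split; lra.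
- by rewrite ltr_norml; apply/andP; split; lra.
Qed.

(** Heine's theorem by real induction on the right end of the interval: past the old end [z], both
    points of a close pair are near [s], where continuity applies. *)
Lemma uniform_continuity (G : R -> R) x1 x2 : x1 <= x2 ->
  (forall x, x1 <= x -> x <= x2 -> {for x, continuous G}) ->
  forall e, 0 < e -> exists2 h, 0 < h &
    forall u v, x1 <= u -> u <= v -> v <= x2 -> v - u <= h -> `|G v - G u| <= e.
Proof.
move=> x12 cG e e0.
apply: (@interval_induction (fun x => exists2 h, 0 < h &
    forall u v, x1 <= u -> u <= v -> v <= x -> v - u <= h -> `|G v - G u| <= e) x1 x2) => //.
  exists 1 => // u v x1u uv vx _; have -> : v = u by lra.
  by rewrite subrr normr0 ltW.
move=> s s1 s2; have e2 : 0 < e / 2 by rewrite divr_gt0.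
have := cG s s1 s2 => /cvgrPdist_lt /(_ _ e2)[eta /= eta0 He].
exists (eta / 2); first by rewrite divr_gt0.
move=> z z' z1 sz zs [h h0 Hh] zz' z's z'2.
exists (Num.min h (eta / 2)); first by rewrite lt_min h0 divr_gt0.
move=> u v x1u uv vz'; rewrite le_min => /andP[uvh uve].
have [vz|zv] := leP v z; first exact: Hh.
have near w : s - eta < w -> w < s + eta -> `|G s - G w| < e / 2.
  by move=> h1 h2; apply: He => /=; rewrite ltr_norml; apply/andP; split; lra.
have hu : `|G s - G u| < e / 2 by apply: near; lra.
have hv : `|G s - G v| < e / 2 by apply: near; lra.
rewrite (_ : G v - G u = (G s - G u) - (G s - G v)); last by ring.
by apply: (le_trans (ler_normB _ _)); lra.
Qed.

(** Baire's theorem in the closed set [bad], covered by the closed sets [A n]. If none of them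
    contained a relative neighbourhood, nested balls centred in [bad], the n-th avoiding [A n],
    would shrink to a bad point outside every [A n]. *)
Lemma baire_interval (bad : R -> Prop) (A : nat -> R -> Prop) x0 : bad x0 ->
  (forall x, bad x -> 0 < x) ->
  (forall x, 0 < x -> (forall e, 0 < e -> exists2 y, bad y & `|y - x| < e) -> bad x) ->
  (forall n x, 0 < x -> (forall e, 0 < e -> exists2 y, A n y & 0 < y /\ `|y - x| < e) ->
    A n x) ->
  (forall x, 0 < x -> exists n, A n x) ->
  exists n x e, [/\ bad x, 0 < e & forall y, bad y -> `|y - x| < e -> A n y].
Proof.
move=> bad0 badp badc Ac Acov; apply: contrapT => H.
have step (q : nat * (R * R)) : exists q' : R * R, bad q.2.1 -> 0 < q.2.2 ->
    [/\ bad q'.1, 0 < q'.2, q'.2 <= q.1.+1%:R^-1, `|q'.1 - q.2.1| + q'.2 <= q.2.2 &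
      forall y, bad y -> `|y - q'.1| <= q'.2 -> ~ A q.1 y].
  case: q => n [x e] /=.
  have [bx|nb] := pselect (bad x); last by exists (x, e).
  have [e0|e0] := ltP 0 e; last by exists (x, e) => _; rewrite ltNge e0.
  have e2 : 0 < e / 2 by rewrite divr_gt0.
  have [y [yb yx nA]] : exists y, [/\ bad y, `|y - x| < e / 2 & ~ A n y].
    apply: contrapT => nH; apply: H; exists n, x, (e / 2); split => // y yb yx.
    by apply: contrapT => nA; apply: nH; exists y.
  have [e1 e10 He1] : exists2 e1, 0 < e1 & forall z, 0 < z -> `|z - y| < e1 -> ~ A n z.
    apply: contrapT => nH; apply: nA; apply: Ac; first exact: badp.
    move=> e1 e10; apply: contrapT => nE; apply: nH; exists e1 => // z z0 zy Az.
    by apply: nE; exists z.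
  pose m := Num.min (e1 / 2) (Num.min (e / 2) n.+1%:R^-1).
  have m0 : 0 < m by rewrite !lt_min !divr_gt0//= invr_gt0.
  have me1 : m <= e1 / 2 by rewrite ge_min lexx.
  have me : m <= e / 2 by rewrite !ge_min lexx orbT.
  have mn : m <= n.+1%:R^-1 by rewrite !ge_min lexx !orbT.
  exists (y, m) => _ _ /=; split => //; first by lra.
  move=> z zb zy; apply: He1; [exact: badp|by lra].
have [g Hg] := choice step.
(* The initial radius x0 / 2 keeps the limit point positive. *)
pose q := fix q n := if n is n'.+1 then g (n', q n') else (x0, x0 / 2).
have x00 := badp _ bad0.
have qP n : bad (q n).1 /\ 0 < (q n).2.
  elim: n => [|n [IH1 IH2]]; first by split => //=; rewrite divr_gt0.
  by have [h1 h2 _ _ _] := Hg (n, q n) IH1 IH2.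
have qS n : [/\ (q n.+1).2 <= n.+1%:R^-1, `|(q n.+1).1 - (q n).1| + (q n.+1).2 <= (q n).2 &
    forall y, bad y -> `|y - (q n.+1).1| <= (q n.+1).2 -> ~ A n y].
  by have [IH1 IH2] := qP n; have [_ _ h1 h2 h3] := Hg (n, q n) IH1 IH2.
have lo n m : (n <= m)%N -> (q n).1 - (q n).2 <= (q m).1 - (q m).2 /\
    (q m).1 + (q m).2 <= (q n).1 + (q n).2.
  move=> /subnKC <-; elim: (m - n)%N => [|k [IH1 IH2]]; first by rewrite addn0 !lexx.
  rewrite addnS; have [_ + _] := qS (n + k)%N.
  set u := (q _).1 - (q _).1 => h; have := ler_norm u; have := ler_norm (- u).
  rewrite normrN /u; split; lra.
pose B := [set z | exists n, z = (q n).1 - (q n).2].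
have Bub n : ubound B ((q n).1 + (q n).2).
  move=> _ [m ->]; have [h1 _] := lo m (maxn n m) (leq_maxr _ _).
  have [_ h2] := lo n (maxn n m) (leq_maxl _ _).
  have [_ h3] := qP (maxn n m); lra.
have B0 : B !=set0 by exists ((q 0).1 - (q 0).2); exists 0%N.
pose l := sup B.
have ll n : `|l - (q n).1| <= (q n).2.
  have h1 : (q n).1 - (q n).2 <= l.
    by apply: ub_le_sup; [exists ((q 0).1 + (q 0).2); exact: Bub|exists n].
  have h2 : l <= (q n).1 + (q n).2 by exact: ge_sup.
  by rewrite ler_norml; apply/andP; split; lra.
have l0 : 0 < l by have := ll 0%N; rewrite /= ler_norml => /andP[]; lra.
have bl : bad l.
  apply: badc => // e e0.
  have [N _ /(_ N (leqnn N)) /= HN] := near_infty_natSinv_lt (PosNum e0).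
  exists (q N.+1).1; first exact: (qP _).1.
  rewrite distrC; apply: (le_lt_trans (ll _)); apply: le_lt_trans HN.
  by have [] := qS N.
have [n An] := Acov l l0.
by have [_ _ /(_ l bl (ll _))] := qS n.
Qed.

End real_line.

Section chains.
Context (R : realType).
Variables (bad : R -> Prop) (x1 x2 : R).
Hypotheses (x1_gt0 : 0 < x1) (x12 : x1 < x2) (bad1 : bad x1) (bad2 : bad x2).
Hypothesis bad_closed : forall x, 0 < x ->
  (forall e, 0 < e -> exists2 y, bad y & `|y - x| < e) -> bad x.

(* A subdivision of [x1, x2] by bad points: [p k, m k] is short and the open
   interval from [m k] to [p k.+1] contains no bad point. *)
Definition chain N (p m : nat -> R) := [/\ p 0%N = x1, p N = x2 &
  forall k, [/\ bad (p k) /\ bad (m k), x1 <= p k <= x2, p k <= m k <= p k.+1,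
    m k - p k <= (x2 - x1) / N%:R & forall z, m k < z -> z < p k.+1 -> ~ bad z]].

Lemma next_bad y : x1 <= y -> y <= x2 -> exists u, [/\ bad u, y <= u, u <= x2 &
  forall z, y <= z -> z < u -> ~ bad z].
Proof.
move=> y1 y2; pose A := [set z | [/\ bad z, y <= z & z <= x2]].
have A2 : A x2 by [].
have Alb : has_lbound A by exists y => z [].
have hA : has_inf A by split => //; exists x2.
set u := inf A; have yu : y <= u by apply: lb_le_inf; [exists x2|move=> z []].
have u2 : u <= x2 by exact: ge_inf.
exists u; split => //.
  apply: bad_closed; first exact: lt_le_trans (le_trans y1 yu).
  move=> e e0; have [z Az ze] := inf_adherent e0 hA; have [zb yz z2] := Az.
  exists z => //; have uz : u <= z by exact: ge_inf.
  by rewrite ger0_norm ?subr_ge0// ltrBlDl.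
move=> z yz zu zb; have z2 : z <= x2 by exact: ltW (lt_le_trans zu u2).
by move: zu; rewrite ltNge => /negP; apply; exact: ge_inf.
Qed.

Lemma previous_bad y : x1 <= y -> y <= x2 -> exists v, [/\ bad v, x1 <= v, v <= y &
  forall z, v < z -> z <= y -> ~ bad z].
Proof.
move=> y1 y2; pose A := [set z | [/\ bad z, x1 <= z & z <= y]].
have A1 : A x1 by [].
have Aub : has_ubound A by exists y => z [].
have hA : has_sup A by split => //; exists x1.
set v := sup A; have vy : v <= y by apply: ge_sup; [exists x1|move=> z []].
have v1 : x1 <= v by exact: ub_le_sup.
exists v; split => //.
  apply: bad_closed; first exact: lt_le_trans v1.
  move=> e e0; have [z Az ze] := sup_adherent e0 hA; have [zb z1 zy] := Az.
  exists z => //; have zv : z <= v by exact: ub_le_sup.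
  rewrite -/v in ze; by rewrite ler0_norm ?subr_le0// opprB; lra.
move=> z vz zy zb; have z1 : x1 <= z by exact: ltW (le_lt_trans v1 vz).
by move: vz; rewrite ltNge => /negP; apply; exact: ub_le_sup.
Qed.

(** Over a uniform grid, [p k] is the first bad point from the k-th grid point on and [m k] the last
    one up to the next grid point. The grid is cut off at x2, so the conditions hold for every
    [k]. *)
Lemma chain_exists N : (0 < N)%N -> exists p m, chain N p m.
Proof.
move=> N0; have Nr : 0 < N%:R :> R by rewrite ltr0n.
have /choice[U HU] : forall y, exists u, x1 <= y -> y <= x2 ->
    [/\ bad u, y <= u, u <= x2 & forall z, y <= z -> z < u -> ~ bad z].
  move=> y; have [y1|y1] := leP x1 y; last by exists y.
  have [y2|y2] := leP y x2; last by exists y.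
  by have [u Hu] := next_bad y1 y2; exists u.
have /choice[V HV] : forall y, exists v, x1 <= y -> y <= x2 ->
    [/\ bad v, x1 <= v, v <= y & forall z, v < z -> z <= y -> ~ bad z].
  move=> y; have [y1|y1] := leP x1 y; last by exists y.
  have [y2|y2] := leP y x2; last by exists y.
  by have [u Hu] := previous_bad y1 y2; exists u.
pose st := (x2 - x1) / N%:R; have st0 : 0 < st by rewrite divr_gt0// subr_gt0.
pose y k := Num.min (x1 + k%:R * st) x2.
have y1 k : x1 <= y k by rewrite le_min (ltW x12) andbT lerDl mulr_ge0// ltW.
have y2 k : y k <= x2 by rewrite ge_min lexx orbT.
have ykS k : y k <= y k.+1 /\ y k.+1 - y k <= st.
  rewrite /y -natr1 mulrDl mul1r addrA; set w := x1 + k%:R * st.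
  by rewrite /Num.min; case: (ltP w x2) => h1; case: (ltP (w + st) x2) => h2; split; lra.
pose p k := U (y k).
(* When the cell contains no bad point, [m k] collapses onto [p k]. *)
pose m k := if p k <= y k.+1 then V (y k.+1) else p k.
have Up k := HU (y k) (y1 k) (y2 k); have Vp k := HV (y k) (y1 k) (y2 k).
exists p, m; split.
- have [h1 h2 h3 h4] := Up 0%N; rewrite -/(p 0%N) in h1 h2 h3 h4.
  have y0 : y 0%N = x1 by rewrite /y mul0r addr0; apply/min_idPl; exact: ltW.
  apply/eqP; rewrite eq_le -{2}y0 h2 andbT leNgt; apply/negP => h.
  by apply: (h4 x1) => //; rewrite y0.
- have [h1 h2 h3 h4] := Up N; rewrite -/(p N) in h1 h2 h3 h4.
  have yN : y N = x2.
    by apply/min_idPr; rewrite /st mulrC divfK ?gt_eqF// addrC subrK.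
  by apply/eqP; rewrite eq_le h3 -{1}yN.
move=> k; have [h1 h2 h3 h4] := Up k; have [g1 g2 g3 g4] := Up k.+1.
have [v1 v2 v3 v4] := Vp k.+1; have [yk yks] := ykS k.
rewrite -/(p k) in h1 h2 h3 h4; rewrite -/(p k.+1) in g1 g2 g3 g4.
have pk1 : x1 <= p k <= x2 by rewrite h3 (le_trans (y1 k) h2).
rewrite /m -/st; case: (leP (p k) (y k.+1)) => pky.
  have pv : p k <= V (y k.+1).
    by rewrite leNgt; apply/negP => h; exact: (v4 _ h pky).
  split => //.
  - by rewrite pv (le_trans v3 g2).
  - lra.
  - move=> z vz zp; have [zy|yz] := leP z (y k.+1); first exact: v4.
    by apply: g4 => //; exact: ltW.
(* The first bad point after [y k] lies beyond [y k.+1], so it is also the first one after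
   [y k.+1]. *)
have pp : p k.+1 = p k.
  apply/eqP; rewrite eq_le; apply/andP; split; rewrite leNgt; apply/negP => h.
    by apply: (g4 (p k)) => //; exact: ltW.
  by apply: (h4 (p k.+1)) => //; exact: le_trans g2.
split => //; first by rewrite pp lexx.
  by rewrite subrr ltW.
by move=> z h h'; move: (lt_trans h h'); rewrite pp ltxx.
Qed.

(** Exact increments of [G] over the gaps, linear approximations over the short stretches between
    bad points; [D] stands for the derivative of [G]. *)
Definition chain_sum N (p m : nat -> R) (G D : R -> R) : R :=
  \sum_(k < N) ((G (p k.+1) - G (m k)) + (m k - p k) * D (p k)).

Lemma chain_sum_near N p m G D e : chain N p m ->
  (forall k, `|G (m k) - G (p k) - (m k - p k) * D (p k)| <= e * (m k - p k)) ->
  0 <= e -> `|G x2 - G x1 - chain_sum N p m G D| <= e * (x2 - x1).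
Proof.
move=> [p0 pN H] HG e0.
have tel (g : nat -> R) : \sum_(k < N) (g k.+1 - g k) = g N - g 0%N.
  by rewrite -(big_mkord xpredT (fun k => g k.+1 - g k)) telescope_sumr.
rewrite -pN -p0 -(tel (fun k => G (p k))) -(tel p) /chain_sum -sumrB mulr_sumr.
apply: (le_trans (ler_norm_sum _ _ _)); apply: ler_sum => k _.
have [_ _ /andP[h1 h2] _ _] := H k.
rewrite (_ : _ - _ = G (m k) - G (p k) - (m k - p k) * D (p k)); last by ring.
by apply: (le_trans (HG k)); rewrite ler_wpM2l// lerD2r.
Qed.

Lemma chain_sum_cvg (p m : nat -> nat -> R) G D :
  (forall n, chain n.+1 (p n) (m n)) ->
  (forall e, 0 < e -> exists2 h, 0 < h & forall u v, x1 <= u -> u <= v -> v <= x2 ->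
    v - u <= h -> `|G v - G u - (v - u) * D u| <= e * (v - u)) ->
  chain_sum n.+1 (p n) (m n) G D @[n --> \oo] --> G x2 - G x1.
Proof.
move=> ch HG; apply/cvgrPdist_le => e e0.
have L0 : 0 < x2 - x1 by rewrite subr_gt0.
have eL : 0 < e / (x2 - x1) by rewrite divr_gt0.
have [h h0 Hh] := HG _ eL.
near=> n; rewrite -[leRHS](divfK (lt0r_neq0 L0)).
apply: chain_sum_near => [|k|]; [exact: ch| |exact: ltW].
have [_ _ H] := ch n; have [_ /andP[q1 q2] /andP[h1 h2] h3 _] := H k.
have [_ /andP[q3 q4] _ _ _] := H k.+1.
apply: Hh => //; first exact: le_trans q4.
apply: (le_trans h3); rewrite ler_pdivrMr// mulrC -ler_pdivrMr//.
near: n; exists (Num.truncn ((x2 - x1) / h)) => // n /= hn.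
by apply/ltW/(lt_le_trans (truncnS_gt _)); rewrite ler_nat ltnS.
Unshelve. all: by end_near. Qed.

End chains.

Lemma sum_cauchy_schwarz (R : realType) N (al v : nat -> R) : (forall k, 0 <= al k) ->
  (\sum_(k < N) al k * v k) ^+ 2 <= (\sum_(k < N) al k) * \sum_(k < N) al k * v k ^+ 2.
Proof.
move=> al0; elim: N => [|N IH]; first by rewrite !big_ord0 expr0n mul0r.
rewrite !big_ord_recr/=; set X := \sum_(k < N) al k * v k in IH *.
have A0 : 0 <= \sum_(k < N) al k by apply: sumr_ge0.
set A := \sum_(k < N) al k in IH A0 *.
set B := \sum_(k < N) al k * v k ^+ 2 in IH *.
have B0 : 0 <= B by apply: sumr_ge0 => k _; rewrite mulr_ge0// sqr_ge0.
have c0 := al0 N; set c := al N in c0 *; set w := v N.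
(* From X^2 <= A B: the square of 2 X w is at most 4 (A w^2) B, hence at most (A w^2 + B)^2. *)
have key : 2 * X * w <= A * w ^+ 2 + B.
  have : (2 * X * w) ^+ 2 <= (A * w ^+ 2 + B) ^+ 2.
    have h1 : 0 <= w ^+ 2 by exact: sqr_ge0.
    have h2 : X ^+ 2 * w ^+ 2 <= A * B * w ^+ 2 by exact: ler_wpM2r.
    have h3 : 0 <= (A * w ^+ 2 - B) ^+ 2 by exact: sqr_ge0.
    rewrite !exprMn; nra.
  move=> h; have [//|h'] := leP (2 * X * w) (A * w ^+ 2 + B).
  have s0 : 0 <= A * w ^+ 2 + B by rewrite addr_ge0// mulr_ge0// sqr_ge0.
  by move: h; rewrite leNgt ltrXn2r// => /negP; case; rewrite ltrXn2r.
have : c * (2 * X * w) <= c * (A * w ^+ 2 + B) by exact: ler_wpM2l.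
rewrite (_ : (X + c * w) ^+ 2 = X ^+ 2 + c * (2 * X * w) + c * (c * w ^+ 2)); last by ring.
rewrite (_ : (A + c) * (B + c * w ^+ 2) = A * B + c * (A * w ^+ 2 + B) + c * (c * w ^+ 2)); last by ring.
lra.
Qed.

Lemma derivative_uniform (R : realType) (G dG : R -> R) (x1 x2 : R) : x1 <= x2 ->
  (forall x : R, x1 <= x -> x <= x2 -> is_derive x 1 G (dG x)) ->
  (forall x, x1 <= x -> x <= x2 -> {for x, continuous dG}) ->
  forall e, 0 < e -> exists2 h, 0 < h & forall u v, x1 <= u -> u <= v -> v <= x2 ->
    v - u <= h -> `|G v - G u - (v - u) * dG u| <= e * (v - u).
Proof.
move=> x12 dGP cG e e0; have [h h0 Hh] := uniform_continuity x12 cG e0.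
exists h => // u v x1u uv vx2 vuh.
have cG' : {within `[u, v], continuous G}.
  apply: continuous_in_subspaceT => x; rewrite inE/= in_itv/= => /andP[ux xv].
  have [dx _] := dGP x (le_trans x1u ux) (le_trans xv vx2).
  exact/differentiable_continuous/derivable1_diffP.
have dG' : forall x, x \in `]u, v[ -> is_derive x (1 : R) G (dG x).
  move=> x; rewrite in_itv/= => /andP[ux xv].
  by apply: dGP; [exact: le_trans (ltW ux)|exact: le_trans (ltW xv) _].
have [z zP ->] := MVT_segment uv dG' cG'.
rewrite in_itv/= in zP; have /andP[uz zv] := zP.
rewrite mulrC -mulrBr normrM mulrC [X in _ * X]ger0_norm ?subr_ge0//.
apply: ler_wpM2r; first by rewrite subr_ge0.
by apply: Hh => //; [exact: le_trans vx2|lra].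
Qed.

(** * Points with controlled slices, and the L2 cost of smoothing *)

Section tame_points.
Context (R : realType) (a b : R) (f : R -> R) (Cf : R) (r : R -> R -> R)
  (C : R -> R -> R -> R) (S : forced_solution a b f Cf r C).
Notation mu := (@lebesgue_measure R).
Let a0 := fs_a0 S.
Let b0 := fs_b0 S.

Definition translation h x t := if h < t then `|r t x - r (t - h) x| else 0.

(** Three quantities finite at each point and lower semicontinuous in [x], so that these sets are
    closed and cover the half-line, as Baire's theorem requires. *)
Definition tame n x := [/\ forall t, 0 < t -> r t x <= n%:R,
  \int[mu]_t weight 1 (fun t => derive1 (r t) x ^+ 2) t <= n%:R &
  forall h, 0 < h -> \int[mu]_t translation h x t <= n%:R * h].

Lemma eq_weight l (u v : R -> R) : (forall t, 0 < t -> u t = v t) -> weight l u = weight l v.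
Proof.
move=> uv; apply/funext => t; rewrite !weight_causal /causal.
by case: ltP => // t0; rewrite uv.
Qed.

(** The equation turns the space derivative into the Caputo operator, to which [caputo_L2]
    applies. *)
Lemma L1_dx_sq x : 0 < x -> L1 mu (weight 1 (fun t => derive1 (r t) x ^+ 2)).
Proof.
move=> x0; have := caputo_L2 (fs_rt S x0) (fs_rL1 S x0) (fs_init S x0) (ltW a0) b0.
congr (L1 mu _); apply: eq_weight => t t0.
by rewrite (fs_eq S)// sqrrN.
Qed.

Lemma lap_dx l x : 0 < l -> 0 < x -> L1 mu (weight l (fun t => derive1 (r t) x)) /\
  lap l (fun t => derive1 (r t) x) =
    Phi a b l / l * f x - Phi a b l * lap l (r ^~ x).
Proof.
move=> l0 x0.
have [L I] := lap_caputo (fs_rt S x0) (fs_rL1 S x0) (fs_init S x0) a b0 l0.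
have E : weight l (fun t => derive1 (r t) x) =
    weight l (fun t => (-1) * caputo_dzherbashian a b (r ^~ x) t).
  by apply: eq_weight => t t0; rewrite (fs_eq S)// mulN1r opprK.
have [L' I'] := lapZ (-1) L.
rewrite E; split => //.
transitivity (lap l (fun t => (-1) * caputo_dzherbashian a b (r ^~ x) t)).
  by rewrite /lap E.
by rewrite I' I; field; rewrite gt_eqF.
Qed.

Lemma translationP x h : 0 < x -> 0 < h -> L1 mu (translation h x) /\
  \int[mu]_t translation h x t <= (\int[mu]_t `|causal (derive1 (r ^~ x)) t|) * h.
Proof.
by move=> x0 h0; exact: (C1_translation (fs_rt S x0) (fs_rL1 S x0) h0).
Qed.

Lemma tame_exists x : 0 < x -> exists n, tame n x.
Proof.
move=> x0; have [M M0 rM] := slice_bound S (ltW x0).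
set I := \int[mu]_t weight 1 (fun t => derive1 (r t) x ^+ 2) t.
set V := \int[mu]_t `|causal (derive1 (r ^~ x)) t|.
have V0 : 0 <= V by exact: I_ge0.
have I0 : 0 <= I.
  apply: I_ge0 => t; rewrite weight_causal; apply: causal_ge0 => s _.
  by rewrite mulr_ge0 ?expR_ge0 ?sqr_ge0.
have := truncnS_gt (M + I + V); set n := (Num.truncn _).+1 => /ltW nP.
exists n; split => [t t0||h h0].
- by have := rM t t0; lra.
- by rewrite -/I; lra.
- apply: (le_trans (translationP x0 h0).2); apply: ler_wpM2r; first exact: ltW.
  by rewrite -/V; lra.
Qed.

(** For each [t], r(t, .) is C1, so the slices and their space derivatives converge pointwise;
    Fatou's lemma then passes the two integral bounds to the limit. *)
Lemma tame_closed n x : 0 < x ->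
  (forall e, 0 < e -> exists2 y, tame n y & 0 < y /\ `|y - x| < e) -> tame n x.
Proof.
move=> x0 H.
have /choice[y_ Hy] : forall k : nat, exists y, [/\ tame n y, 0 < y & `|y - x| < k.+1%:R^-1].
  by move=> k; have [|y h1 [h2 h3]] := H k.+1%:R^-1; [rewrite invr_gt0|exists y].
have y0 k : 0 < y_ k by have [] := Hy k.
have ycvg : y_ k @[k --> \oo] --> x.
  apply/cvgrPdist_lt => e e0; have := near_infty_natSinv_lt (PosNum e0).
  by apply: filterS => k /=; rewrite distrC; have [_ _] := Hy k; exact: lt_trans.
have rcvg t : 0 < t -> r t (y_ k) @[k --> \oo] --> r t x.
  by move=> t0; apply: (profile_cvg S y0 (ltW x0) ycvg t0).
split => [t t0||h h0].
- apply: (ler_cvg_to (rcvg t t0) (cvg_cst (n%:R : R))); apply: nearW => k.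
  by have [[h _ _] _ _] := Hy k; exact: h.
- have [||||//] := @fatou_real _ _ _ mu
    (fun k => weight 1 (fun t => derive1 (r t) (y_ k) ^+ 2))
    (weight 1 (fun t => derive1 (r t) x ^+ 2)) n%:R.
  + by move=> k; exact: L1_dx_sq.
  + move=> k t; rewrite weight_causal; apply: causal_ge0 => s _.
    by rewrite mulr_ge0 ?expR_ge0 ?sqr_ge0.
  + move=> t; rewrite /weight /causal; case: (ltP 0 t) => t0; last exact: cvg_cst.
    have xP : x \in `]0, +oo[ by rewrite in_itv/= x0.
    have dcvg : derive1 (r t) (y_ k) @[k --> \oo] --> derive1 (r t) x.
      exact: (@cvg_comp _ _ _ y_ (derive1 (r t)) _ _ _ ycvg ((fs_rx S t0).2 x xP)).
    by apply: cvgMr; apply: cvgM.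
  + by move=> k; have [[_ h _] _ _] := Hy k.
- have [||||//] := @fatou_real _ _ _ mu (fun k => translation h (y_ k))
    (translation h x) (n%:R * h).
  + by move=> k; exact: (translationP (y0 k) h0).1.
  + by move=> k t; rewrite /translation; case: ifP.
  + move=> t; rewrite /translation; case: (ltP h t) => ht; last exact: cvg_cst.
    apply: cvg_norm; apply: cvgB; apply: rcvg; first exact: lt_trans h0 ht.
    by rewrite subr_gt0.
  + by move=> k; have [[_ _ h'] _ _] := Hy k; exact: h'.
Qed.

(* Cauchy-Schwarz with the weight [sqrt y * p y] turns the bound [n * h] on
   translations into a quadratic one. *)
Lemma smoothing_L2 n x s A : 0 < x -> tame n x -> 0 < s ->
  let p := gamma_density b s in
  L1 mu (fun y => Num.sqrt y * p y) -> \int[mu]_y (Num.sqrt y * p y) <= A ->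
  let d t := conv (causal (r ^~ x)) p t - r t x in
  L1 mu (weight 1 (fun t => d t ^+ 2)) /\
  \int[mu]_t weight 1 (fun t => d t ^+ 2) t <= 2 * n%:R ^+ 2 * A ^+ 2.
Proof.
move=> x0 [rn _ trn] s0 p Lsp IA d.
have u0 t := @slice_ge0 _ _ _ _ _ _ _ S t _ (ltW x0).
have mu_ := measurable_slice S (ltW x0).
have p0 y : 0 <= p y by exact: gamma_density_ge0.
have n0 : 0 <= n%:R :> R by [].
set u := causal (r ^~ x) in mu_ *.
have uc0 t : 0 <= u t by exact: causal_ge0.
have ucn t : u t <= n%:R by rewrite /u /causal; case: ltP => // /rn.
have A0 : 0 <= A.
  by apply: le_trans IA; apply: I_ge0 => y; rewrite mulr_ge0// sqrtr_ge0.
pose e t : R := causal (fun t => expR (- (1 * t))) t.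
have e0 t : 0 <= e t by apply: causal_ge0 => z _; exact: expR_ge0.
have Le : L1 mu e by exact: (expR_halfline ltr01).1.
(* This is y^(-1/2): the density is split as q times the weight [sqrt y * p y], and the square of q
   times that weight, times y, gives the weight back. *)
pose q (y : R) : R := expR (- (2^-1 * ln y)).
have mq : measurable_fun setT q.
  apply: measurableT_comp => //; apply: measurableT_comp => //.
  by apply: measurable_funM => //; exact: measurable_ln.
pose F (z : R * R) : R := e z.1 * ((u (z.1 - z.2) - u z.1) * q z.2) ^+ 2 *
  (Num.sqrt z.2 * p z.2).
have sq y : 0 < y -> Num.sqrt y * q y = 1.
  move=> y0; have -> : Num.sqrt y = expR (2^-1 * ln y).
    by rewrite -powR12_sqrt ?ltW// /powR gt_eqF.
  by rewrite /q -expRD subrr expR0.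
have msp : measurable_fun setT (fun y : R => Num.sqrt y * p y) by exact: L1_meas Lsp.
have mdiff : measurable_fun setT (fun z : R * R => (u (z.1 - z.2) - u z.1) * q z.2).
  apply: measurable_funM; last exact: measurableT_comp.
  apply: measurable_funB; last exact: measurableT_comp.
  by apply: measurableT_comp => //; exact: measurable_funB.
have mF : measurable_fun setT F.
  apply: measurable_funM; last exact: (measurableT_comp msp).
  apply: measurable_funM; last exact: measurable_funX.
  exact: (measurableT_comp (L1_meas Le)).
have F0 z : 0 <= F z.
  apply: mulr_ge0; last by apply: mulr_ge0 => //; exact: sqrtr_ge0.
  by apply: mulr_ge0 => //; exact: sqr_ge0.
(* Bounding one factor of the square by n, times t > y contribute n times the translation bound n y,
   and times t <= y at most n^2 over a length y. *)
pose G y t : R := e t * (u (t - y) - u t) ^+ 2.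
have GP y : 0 < y -> L1 mu (G y) /\ \int[mu]_t G y t <= 2 * n%:R ^+ 2 * y.
  move=> y0; have [Lt _] := translationP x0 y0; have It := trn y y0.
  have [Ly Iy] := I_interval_oc (ltW y0); rewrite subr0 in Iy.
  have Lb : L1 mu (fun t => n%:R * translation y x t + n%:R ^+ 2 * (0 < t <= y)%R%:R).
    by apply: L1D; exact: L1Z.
  have Gle t : `|G y t| <= n%:R * translation y x t + n%:R ^+ 2 * (0 < t <= y)%R%:R.
    rewrite ger0_norm; last by apply: mulr_ge0 => //; exact: sqr_ge0.
    rewrite /G /e.
    have [t0|t0] := leP t 0.
      rewrite causal0// mul0r /= mulr0 addr0 mulr_ge0//.
      by rewrite /translation; case: ifP.
    rewrite causalE// mul1r.
    have e1 : expR (- t) <= 1 by rewrite -expR0 ler_expR oppr_le0 ltW.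
    apply: (@le_trans _ _ ((u (t - y) - u t) ^+ 2)).
      by rewrite ler_piMl ?sqr_ge0.
    have dn : `|u (t - y) - u t| <= n%:R.
      have := uc0 t; have := ucn t; have := uc0 (t - y); have := ucn (t - y).
      by rewrite ler_norml => *; apply/andP; split; lra.
    rewrite -real_normK ?num_real// expr2 /translation /=; case: (leP t y) => ty.
      by rewrite mulr0 add0r mulr1 expr2; exact: ler_pM.
    rewrite mulr0 addr0 (_ : `|r t x - r (t - y) x| = `|u (t - y) - u t|).
      exact: ler_wpM2r.
    by rewrite distrC /u !causalE ?subr_gt0.
  have mG : measurable_fun setT (G y).
    apply: measurable_funM; first exact: L1_meas Le.
    apply: measurable_funX; apply: measurable_funB => //.
    by apply: measurableT_comp => //; exact: measurable_funB.
  split; first exact: (@L1_le _ _ _ mu _ _ mG Gle Lb).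
  apply: (le_trans (ler_norm _)); apply: (le_trans (@I_bound _ _ _ mu _ _ mG Gle Lb)).
  rewrite ID; [|exact: L1Z|exact: L1Z].
  rewrite !IZ// Iy; have := ler_wpM2l n0 It.
  by rewrite mulrA -expr2; lra.
have FE y t : 0 < y -> F (t, y) = q y ^+ 2 * (Num.sqrt y * p y) * G y t.
  by move=> _; rewrite /F /G /= exprMn; ring.
have F_0 y t : y <= 0 -> F (t, y) = 0.
  by move=> y0; rewrite /F /= ler0_sqrtr// mul0r mulr0.
have LF y : L1 mu (fun t => F (t, y)).
  have [y0|y0] := leP y 0.
    by under eq_fun do rewrite F_0//; exact: L1_0.
  by under eq_fun do rewrite FE//; apply: L1Z; exact: (GP y y0).1.
have Fg y : \int[mu]_t F (t, y) <= 2 * n%:R ^+ 2 * (Num.sqrt y * p y).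
  have [y0|y0] := leP y 0.
    by under eq_I do rewrite F_0//; rewrite I_0 ler0_sqrtr// mul0r mulr0.
  under eq_I do rewrite FE//; rewrite IZ; last exact: (GP y y0).1.
  have := (GP y y0).2; have c0 : 0 <= q y ^+ 2 * (Num.sqrt y * p y).
    apply: mulr_ge0; first exact: sqr_ge0.
    by apply: mulr_ge0 => //; exact: sqrtr_ge0.
  move/(ler_wpM2l c0)/le_trans; apply; rewrite le_eqVlt; apply/orP; left; apply/eqP.
  have qy : q y ^+ 2 * y = 1.
    by rewrite -{2}[y](sqr_sqrtr (ltW y0)) -exprMn mulrC sq// expr1n.
  transitivity (q y ^+ 2 * y * (2 * n%:R ^+ 2 * (Num.sqrt y * p y))); first by ring.
  by rewrite qy mul1r.
have [Lint Iint aeF] := @fubini_ge0 _ _ _ _ R mu mu F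
  (fun y => 2 * n%:R ^+ 2 * (Num.sqrt y * p y)) mF F0 LF Fg (L1Z _ Lsp).
have mconv : measurable_fun setT (causal (conv u p)).
  apply: measurable_causal_weight.
  exact: L1_meas (lap_conv_gamma b0 s0 mu_ u0 rn ltr01).1.
have mw : measurable_fun setT (weight 1 (fun t => d t ^+ 2)).
  apply: measurable_weight.
  rewrite (_ : causal _ = fun t => (causal (conv u p) t - u t) ^+ 2).
    by apply: measurable_funX; exact: measurable_funB.
  apply/funext => t; rewrite /u /causal; case: (ltP 0 t) => // _.
  by rewrite subrr expr0n.
have [||||Lw Iw] := @le_I_ae _ _ _ mu (weight 1 (fun t => d t ^+ 2))
  (fun t => A * \int[mu]_y F (t, y)) mw.
- move=> t; rewrite weight_causal; apply: causal_ge0 => z _.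
  by rewrite mulr_ge0 ?expR_ge0 ?sqr_ge0.
- by move=> t; rewrite mulr_ge0//; exact: I_ge0.
- exact: L1Z.
- apply: (ae_imp aeF) => t LFt; have [t0|t0] := leP t 0.
    by rewrite weight_causal causal0// mulr_ge0//; exact: I_ge0.
  pose g y := (u (t - y) - u t) * q y.
  have mg : measurable_fun setT g.
    apply: measurable_funM => //; apply: measurable_funB => //.
    by apply: measurableT_comp => //; exact: measurable_funB.
  have et : e t = expR (- (1 * t)) by rewrite /e causalE.
  have et0 : 0 < e t by rewrite et expR_gt0.
  have Lg2 : L1 mu (fun y => g y ^+ 2 * (Num.sqrt y * p y)).
    have := L1Z (e t)^-1 LFt; congr (L1 mu _); apply/funext => y.
    by rewrite /F /= -/(g y) -[e t * _ * _]mulrA mulKf// gt_eqF.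
  have sp0 y : 0 <= Num.sqrt y * p y by rewrite mulr_ge0// sqrtr_ge0.
  have WCS := @weighted_cauchy_schwarz _ _ _ mu g (fun y => Num.sqrt y * p y) mg Lsp sp0 Lg2.
  have -> : \int[mu]_y F (t, y) = e t * \int[mu]_y (g y ^+ 2 * (Num.sqrt y * p y)).
    by rewrite -IZ//; apply: eq_I => y; rewrite /F /g /= mulrA.
  rewrite weight_causal causalE// -et [leRHS]mulrCA; apply: ler_wpM2l; first exact: ltW.
  have -> : d t = \int[mu]_y (g y * (Num.sqrt y * p y)).
    have Lc := L1_conv_gamma b0 s0 mu_ u0 rn t.
    rewrite /d -[r t x]mulr1 -(I_gamma_density b0 s0) -IZ; last exact: L1_gamma_density.
    rewrite /conv -IB//; last by apply: L1Z; exact: L1_gamma_density.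
    apply: eq_I => y; rewrite -/p -mulrBl /g; have [y0|y0] := leP y 0.
      by rewrite /p gamma_density0// !mulr0.
    rewrite [u t]causalE// -[in RHS]mulrA [q y * _]mulrA [q y * _]mulrC sq// mul1r.
    by [].
  apply: (le_trans WCS); apply: ler_wpM2r => //.
  by apply: I_ge0 => y; rewrite mulr_ge0// sqr_ge0.
split => //; apply: (le_trans Iw); rewrite IZ// [A ^+ 2]expr2 mulrA mulrC; apply: ler_wpM2r => //.
apply: (le_trans Iint); rewrite IZ//.
by apply: ler_wpM2l => //; rewrite mulr_ge0// sqr_ge0.
Qed.

End tame_points.

Lemma mul_sqr_ge0 (R : realType) (x y : R) : 0 <= x -> 0 <= x * y ^+ 2.
Proof. by move=> x0; rewrite mulr_ge0// sqr_ge0. Qed.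

Lemma sqrD_le (R : realType) (x y : R) : (x + y) ^+ 2 <= 2 * x ^+ 2 + 2 * y ^+ 2.
Proof. by have := sqr_ge0 (x - y); rewrite sqrrB sqrrD; lra. Qed.

Section gap_estimate.
Context (R : realType) (a b : R) (f : R -> R) (Cf : R) (r : R -> R -> R)
  (C : R -> R -> R -> R) (S : forced_solution a b f Cf r C).
Notation mu := (@lebesgue_measure R).
Let a0 := fs_a0 S.
Let b0 := fs_b0 S.

(** By renewal the difference is a smoothing error plus a forcing. Each is O(d - c) in L2: the first
    by the moment of order 1/2, the second because the forcing is O((d - c) [log_tail]) and
    [log_tail] is square integrable against e^(-t). *)
Lemma slice_sub_L2 n : exists2 K, 0 <= K & forall c d, 0 < c -> c < d ->
  a * (d - c) <= 1 -> tame r n c -> eqv a b f r c d ->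
  L1 mu (weight 1 (fun t => (r t d - r t c) ^+ 2)) /\
  \int[mu]_t weight 1 (fun t => (r t d - r t c) ^+ 2) t <= K * (d - c) ^+ 2.
Proof.
have [A HA] := gamma_density_sqrt_moment b0.
have Ll := L1_weight_log_tail_sq b0 (@ltr01 R).
pose La := \int[mu]_t weight 1 (fun t => log_tail b t ^+ 2) t.
have La0 : 0 <= La.
  apply: I_ge0 => t; rewrite weight_causal; apply: causal_ge0 => z _.
  by rewrite mulr_ge0 ?expR_ge0 ?sqr_ge0.
pose k := Cf * (markov_cst R * a).
exists (4 * n%:R ^+ 2 * (A * a) ^+ 2 + 2 * k ^+ 2 * La).
  by rewrite addr_ge0 ?mul_sqr_ge0// mulr_ge0// mul_sqr_ge0.
move=> c d c0 cd acd tc cdE.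
have h0 : 0 < d - c by rewrite subr_gt0.
have hd : d - c <= d by rewrite lerBlDr lerDl ltW.
have s0 : 0 < a * (d - c) by rewrite mulr_gt0.
have [Ls Is] := HA _ s0 acd.
pose D t := conv (causal (r ^~ c)) (gamma_density b (a * (d - c))) t - r t c.
have [Ld Id] := smoothing_L2 S c0 tc s0 Ls Is.
rewrite -/D in Ld Id.
have Lb : L1 mu (fun t => 2 * weight 1 (fun t => D t ^+ 2) t +
    2 * (k * (d - c)) ^+ 2 * weight 1 (fun t => log_tail b t ^+ 2) t).
  by apply: L1D; exact: L1Z.
have m : measurable_fun setT (weight 1 (fun t => (r t d - r t c) ^+ 2)).
  apply: measurable_weight.
  rewrite (_ : causal _ = fun t => (causal (r ^~ d) t - causal (r ^~ c) t) ^+ 2).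
    apply: measurable_funX; apply: measurable_funB; apply: (measurable_slice S).
      exact: ltW (lt_trans c0 cd).
    exact: ltW.
  by apply/funext => t; rewrite /causal; case: (ltP 0 t) => // _; rewrite subrr expr0n.
have le t : `|weight 1 (fun t => (r t d - r t c) ^+ 2) t| <=
    2 * weight 1 (fun t => D t ^+ 2) t +
    2 * (k * (d - c)) ^+ 2 * weight 1 (fun t => log_tail b t ^+ 2) t.
  rewrite !weight_causal; have [t0|t0] := leP t 0.
    by rewrite !(causal0 _ t0) normr0 !mulr0 addr0.
  rewrite !(causalE _ t0) ger0_norm; last by rewrite mulr_ge0 ?expR_ge0 ?sqr_ge0.
  rewrite [2 * _]mulrCA [2 * _ * _]mulrCA -mulrDr; apply: ler_wpM2l; first exact: expR_ge0.
  have -> : r t d - r t c = D t + C d (d - c) t.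
    by rewrite (renewal S (ltW c0) cd cdE t0) /D; ring.
  have hC := fs_Cs S h0 hd t0.
  have hC2 : C d (d - c) t ^+ 2 <= (k * (d - c)) ^+ 2 * log_tail b t ^+ 2.
    have E : k * (d - c) * log_tail b t =
        Cf * (markov_cst R * ((d - c) * (a * log_tail b t))) by rewrite /k; ring.
    rewrite -exprMn E -[leLHS]real_normK ?num_real//; apply: lerXn2r => //.
    rewrite nnegrE; exact: le_trans hC.
  apply: (le_trans (sqrD_le _ _)); rewrite lerD2l -mulrA.
  by apply: ler_wpM2l.
split; first exact: (@L1_le _ _ _ mu _ _ m le Lb).
apply: (le_trans (ler_norm _)); apply: (le_trans (@I_bound _ _ _ mu _ _ m le Lb)).
rewrite ID; [|exact: L1Z|exact: L1Z].
rewrite !IZ// -/La.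
have -> : (4 * n%:R ^+ 2 * (A * a) ^+ 2 + 2 * k ^+ 2 * La) * (d - c) ^+ 2 =
    2 * (2 * n%:R ^+ 2 * (A * (a * (d - c))) ^+ 2) + 2 * (k * (d - c)) ^+ 2 * La by ring.
by rewrite lerD2r; apply: ler_wpM2l.
Qed.

Lemma expR_sub_le (F X c d : R) : 0 <= F -> c <= d -> d <= X ->
  0 <= expR (F * d) - expR (F * c) <= expR (F * X) * (F * (d - c)).
Proof.
move=> F0 cd dX; have h1 : F * c <= F * d by exact: ler_wpM2l.
have h2 : expR (F * d) <= expR (F * X) by rewrite ler_expR ler_wpM2l.
rewrite subr_ge0 ler_expR h1/=.
have := expR_ge1Dx (- (F * (d - c))).
have -> : expR (F * c) = expR (F * d) * expR (- (F * (d - c))).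
  by rewrite -expRD; congr expR; ring.
move/(ler_wpM2l (expR_ge0 (F * d))) => h.
have h3 : expR (F * d) * (F * (d - c)) <= expR (F * X) * (F * (d - c)).
  by rewrite ler_wpM2r// mulr_ge0// subr_ge0.
lra.
Qed.

(** For F = Phi(l) this is the integrating factor of the equation in Laplace variables. *)
Definition tilt F x t := expR (F * x) * r t x.

Definition tilt_dx F x t := expR (F * x) * (F * r t x + derive1 (r t) x).

Lemma L1_weight_sq_le n c : 0 < c -> tame r n c ->
  L1 mu (weight 1 (fun t => r t c ^+ 2)) /\
  \int[mu]_t weight 1 (fun t => r t c ^+ 2) t <= n%:R ^+ 2.
Proof.
move=> c0 [rn _ _].
have m : measurable_fun setT (causal (fun t => r t c ^+ 2)).
  rewrite (_ : causal _ = fun t => causal (r ^~ c) t ^+ 2).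
    by apply: measurable_funX; exact: measurable_slice S _ (ltW c0).
  by apply/funext => t; rewrite /causal; case: (ltP 0 t) => // _; rewrite expr0n.
have bnd t : 0 < t -> `|r t c ^+ 2| <= n%:R ^+ 2.
  move=> t0; rewrite ger0_norm ?sqr_ge0//; apply: lerXn2r; rewrite ?nnegrE ?rn//.
  by apply: (slice_ge0 S) => //; exact: ltW.
have L := L1_weight ltr01 m bnd.
split => //; rewrite -[leRHS]divr1 -(lap_cst _ (@ltr01 R)).
apply: le_I => //; first exact: L1_weight_cst.
move=> t; rewrite !weight_causal /causal; case: (ltP 0 t) => // t0.
apply: ler_wpM2l; first exact: expR_ge0.
exact: le_trans (ler_norm _) (bnd t t0).
Qed.

Lemma tilt_sub_L2 n F X : 0 <= F -> exists2 K, 0 <= K & forall c d, 0 < c -> c < d -> d <= X ->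
  a * (d - c) <= 1 -> tame r n c -> eqv a b f r c d ->
  L1 mu (weight 1 (fun t => (tilt F d t - tilt F c t) ^+ 2)) /\
  \int[mu]_t weight 1 (fun t => (tilt F d t - tilt F c t) ^+ 2) t <= K * (d - c) ^+ 2.
Proof.
move=> F0; have [K K0 HK] := slice_sub_L2 n.
exists (2 * expR (F * X) ^+ 2 * K + 2 * (expR (F * X) * F) ^+ 2 * n%:R ^+ 2).
  by rewrite addr_ge0 ?mul_sqr_ge0// mulr_ge0// mul_sqr_ge0.
move=> c d c0 cd dX acd tc cdE; have [L I] := HK c d c0 cd acd tc cdE.
have [Lc Ic] := L1_weight_sq_le c0 tc.
pose A := 2 * expR (F * X) ^+ 2; pose B := 2 * (expR (F * X) * F) ^+ 2 * (d - c) ^+ 2.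
have A0 : 0 <= A by exact: mul_sqr_ge0.
have B0 : 0 <= B by do 2!apply: mul_sqr_ge0.
have Lb : L1 mu (fun t => A * weight 1 (fun t => (r t d - r t c) ^+ 2) t +
    B * weight 1 (fun t => r t c ^+ 2) t) by apply: L1D; exact: L1Z.
have m : measurable_fun setT (weight 1 (fun t => (tilt F d t - tilt F c t) ^+ 2)).
  apply: measurable_weight.
  rewrite (_ : causal _ = fun t =>
      (expR (F * d) * causal (r ^~ d) t - expR (F * c) * causal (r ^~ c) t) ^+ 2).
    apply: measurable_funX; apply: measurable_funB; apply: measurable_funM => //;
      apply: (measurable_slice S).
      exact: ltW (lt_trans c0 cd).
    exact: ltW.
  apply/funext => t; rewrite /causal; case: (ltP 0 t) => // _.
  by rewrite !mulr0 subrr expr0n.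
have le t : `|weight 1 (fun t => (tilt F d t - tilt F c t) ^+ 2) t| <=
    A * weight 1 (fun t => (r t d - r t c) ^+ 2) t + B * weight 1 (fun t => r t c ^+ 2) t.
  rewrite !weight_causal; have [t0|t0] := leP t 0.
    by rewrite !(causal0 _ t0) normr0 !mulr0 addr0.
  rewrite !(causalE _ t0) ger0_norm; last by rewrite mulr_ge0 ?expR_ge0 ?sqr_ge0.
  rewrite [A * _]mulrCA [B * _]mulrCA -mulrDr; apply: ler_wpM2l; first exact: expR_ge0.
  have /andP[e0 e1] := expR_sub_le F0 (ltW cd) dX.
  have -> : tilt F d t - tilt F c t = expR (F * d) * (r t d - r t c) +
      (expR (F * d) - expR (F * c)) * r t c by rewrite /tilt; ring.
  set u := r t d - r t c; set v := r t c; set e := _ - _ in e0 e1 *.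
  have h1 : (e * v) ^+ 2 <= (expR (F * X) * (F * (d - c))) ^+ 2 * v ^+ 2.
    by rewrite exprMn; apply: ler_wpM2r; [exact: sqr_ge0|apply: lerXn2r => //; rewrite nnegrE// (le_trans e0)].
  have h2 : (expR (F * d) * u) ^+ 2 <= expR (F * X) ^+ 2 * u ^+ 2.
    rewrite exprMn; apply: ler_wpM2r; first exact: sqr_ge0.
    by apply: lerXn2r; rewrite ?nnegrE ?expR_ge0// ler_expR ler_wpM2l.
  apply: (le_trans (sqrD_le _ _)).
  have -> : B * v ^+ 2 = 2 * ((expR (F * X) * (F * (d - c))) ^+ 2 * v ^+ 2) by rewrite /B; ring.
  by rewrite /A; lra.
split; first exact: (@L1_le _ _ _ mu _ _ m le Lb).
apply: (le_trans (ler_norm _)); apply: (le_trans (@I_bound _ _ _ mu _ _ m le Lb)).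
rewrite ID; [|exact: L1Z|exact: L1Z].
rewrite !IZ//.
have -> : (2 * expR (F * X) ^+ 2 * K + 2 * (expR (F * X) * F) ^+ 2 * n%:R ^+ 2) * (d - c) ^+ 2 =
    A * (K * (d - c) ^+ 2) + B * n%:R ^+ 2 by rewrite /A /B; ring.
by apply: lerD; exact: ler_wpM2l.
Qed.

Lemma tilt_dx_L2 n F X : 0 <= F -> exists2 K, 0 <= K & forall c, 0 < c -> c <= X -> tame r n c ->
  L1 mu (weight 1 (fun t => tilt_dx F c t ^+ 2)) /\
  \int[mu]_t weight 1 (fun t => tilt_dx F c t ^+ 2) t <= K.
Proof.
move=> F0; exists (2 * expR (F * X) ^+ 2 * (F ^+ 2 * n%:R ^+ 2 + n%:R)).
  by rewrite mulr_ge0 ?mul_sqr_ge0// addr_ge0// mul_sqr_ge0// sqr_ge0.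
move=> c c0 cX tc; have [Lc Ic] := L1_weight_sq_le c0 tc.
have Ld := L1_dx_sq S c0; have [_ Id _] := tc.
pose A := 2 * expR (F * X) ^+ 2; have A0 : 0 <= A by exact: mul_sqr_ge0.
have Lb : L1 mu (fun t => A * (F ^+ 2 * weight 1 (fun t => r t c ^+ 2) t +
    weight 1 (fun t => derive1 (r t) c ^+ 2) t)).
  by apply: L1Z; apply: L1D => //; exact: L1Z.
have m : measurable_fun setT (weight 1 (fun t => tilt_dx F c t ^+ 2)).
  apply: measurable_weight.
  rewrite (_ : causal _ = fun t => (expR (F * c) * (F * causal (r ^~ c) t +
      causal (fun t => derive1 (r t) c) t)) ^+ 2).
    apply: measurable_funX; apply: measurable_funM => //; apply: measurable_funD.
      by apply: measurable_funM => //; apply: (measurable_slice S); exact: ltW.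
    apply: measurable_causal_weight; exact: L1_meas (lap_dx S (@ltr01 R) c0).1.
  apply/funext => t; rewrite /causal; case: (ltP 0 t) => // _.
  by rewrite !mulr0 addr0 mulr0 expr0n.
have le t : `|weight 1 (fun t => tilt_dx F c t ^+ 2) t| <=
    A * (F ^+ 2 * weight 1 (fun t => r t c ^+ 2) t +
    weight 1 (fun t => derive1 (r t) c ^+ 2) t).
  rewrite !weight_causal; have [t0|t0] := leP t 0.
    by rewrite !(causal0 _ t0) normr0 !mulr0 addr0 mulr0.
  rewrite !(causalE _ t0) ger0_norm; last by rewrite mulr_ge0 ?expR_ge0 ?sqr_ge0.
  rewrite [F ^+ 2 * _]mulrCA -mulrDr [A * _]mulrCA; apply: ler_wpM2l; first exact: expR_ge0.
  rewrite /tilt_dx exprMn /A -[leRHS]mulrA [leRHS]mulrCA; apply: ler_pM.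
  - exact: sqr_ge0.
  - exact: sqr_ge0.
  - by apply: lerXn2r; rewrite ?nnegrE ?expR_ge0// ler_expR ler_wpM2l.
  set u := r t c; set v := derive1 _ _.
  by apply: (le_trans (sqrD_le _ _)); rewrite exprMn mulrDr.
split; first exact: (@L1_le _ _ _ mu _ _ m le Lb).
apply: (le_trans (ler_norm _)); apply: (le_trans (@I_bound _ _ _ mu _ _ m le Lb)).
rewrite IZ; last by apply: L1D => //; exact: L1Z.
apply: ler_wpM2l => //; rewrite ID//; last exact: L1Z.
rewrite IZ//; apply: lerD => //; apply: ler_wpM2l => //; exact: sqr_ge0.
Qed.

End gap_estimate.

Section laplace_sums.
Context (R : realType).
Notation mu := (@lebesgue_measure R).

Lemma lap_sum_ord l n (u : nat -> R -> R) : (forall k, L1 mu (weight l (u k))) ->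
  L1 mu (weight l (fun t => \sum_(k < n) u k t)) /\
  lap l (fun t => \sum_(k < n) u k t) = \sum_(k < n) lap l (u k).
Proof.
move=> Lu; elim: n => [|n [IH1 IH2]].
  have E : weight l (fun t => \sum_(k < 0) u k t) = fun=> 0.
    by apply/funext => t; rewrite /weight /causal big_ord0 if_same mulr0.
  by rewrite /lap E big_ord0 I_0; split => //; exact: L1_0.
have E : (fun t => \sum_(k < n.+1) u k t) = (fun t => \sum_(k < n) u k t + u n t).
  by apply/funext => t; rewrite big_ord_recr.
by have [h1 h2] := lapD IH1 (Lu n); rewrite E big_ord_recr/= -IH2.
Qed.

(** After dividing [dv k] by [al k], the sum is a combination, with weights of total at most L, of
    functions bounded in L2. Cauchy-Schwarz over the indices then gives a bound that does not depend
    on the number of terms. *)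
Lemma weighted_sum_L2 n (al be : nat -> R) (dv dw : nat -> R -> R) (L Kv Kw : R) :
  0 <= L -> (forall k, 0 <= al k) -> (forall k, 0 <= be k) ->
  \sum_(k < n) al k <= L -> \sum_(k < n) be k <= L -> 0 <= Kv -> 0 <= Kw ->
  (forall k, al k = 0 -> forall t, dv k t = 0) ->
  (forall k, measurable_fun setT (causal (dv k))) ->
  (forall k, measurable_fun setT (causal (dw k))) ->
  (forall k, L1 mu (weight 1 (fun t => dv k t ^+ 2)) /\
    \int[mu]_t weight 1 (fun t => dv k t ^+ 2) t <= Kv * al k ^+ 2) ->
  (forall k, L1 mu (weight 1 (fun t => dw k t ^+ 2)) /\
    \int[mu]_t weight 1 (fun t => dw k t ^+ 2) t <= Kw) ->
  L1 mu (weight 1 (fun t => (\sum_(k < n) (dv k t + be k * dw k t)) ^+ 2)) /\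
  \int[mu]_t weight 1 (fun t => (\sum_(k < n) (dv k t + be k * dw k t)) ^+ 2) t
    <= 2 * L ^+ 2 * (Kv + Kw).
Proof.
move=> L0 al0 be0 alL beL Kv0 Kw0 dv0 mdv mdw Hv Hw.
set Sn := fun t => \sum_(k < n) (dv k t + be k * dw k t).
(* For [al k] = 0 the inverse is 0, and [dv k] vanishes by hypothesis. *)
pose v k t := (al k)^-1 * dv k t.
have Lv k : L1 mu (weight 1 (fun t => v k t ^+ 2)) /\
    \int[mu]_t weight 1 (fun t => v k t ^+ 2) t <= Kv.
  have [L1v Iv] := lapZ ((al k)^-1 ^+ 2) (Hv k).1.
  have E : (fun t => v k t ^+ 2) = (fun t => (al k)^-1 ^+ 2 * dv k t ^+ 2).
    by apply/funext => t; rewrite exprMn.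
  rewrite E; split => //; rewrite -/(lap 1 _) Iv.
  apply: (@le_trans _ _ ((al k)^-1 ^+ 2 * (Kv * al k ^+ 2))).
    by apply: ler_wpM2l; [exact: sqr_ge0|exact: (Hv k).2].
  have [->|ak] := eqVneq (al k) 0; first by rewrite invr0 expr0n mul0r.
  by rewrite mulrCA -exprMn mulVf// expr1n mulr1.
have SE t : Sn t = \sum_(k < n) al k * v k t + \sum_(k < n) be k * dw k t.
  rewrite -big_split/=; apply: eq_bigr => k _; congr (_ + _); rewrite /v.
  have [ak|ak] := eqVneq (al k) 0; first by rewrite dv0// mulr0 mulr0.
  by rewrite mulrA divff// mul1r.
pose Bv t := \sum_(k < n) al k * weight 1 (fun t => v k t ^+ 2) t.
pose Bw t := \sum_(k < n) be k * weight 1 (fun t => dw k t ^+ 2) t.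
have LBv : L1 mu Bv by apply: L1_sum => k; exact: (Lv k).1.
have LBw : L1 mu Bw by apply: L1_sum => k; exact: (Hw k).1.
have IBv : \int[mu]_t Bv t <= L * Kv.
  rewrite I_sum => [|k]; last exact: (Lv k).1.
  apply: (@le_trans _ _ (\sum_(k < n) al k * Kv)).
    by apply: ler_sum => k _; apply: ler_wpM2l => //; exact: (Lv k).2.
  by rewrite -mulr_suml ler_wpM2r.
have IBw : \int[mu]_t Bw t <= L * Kw.
  rewrite I_sum => [|k]; last exact: (Hw k).1.
  apply: (@le_trans _ _ (\sum_(k < n) be k * Kw)).
    by apply: ler_sum => k _; apply: ler_wpM2l => //; exact: (Hw k).2.
  by rewrite -mulr_suml ler_wpM2r.
have m : measurable_fun setT (weight 1 (fun t => Sn t ^+ 2)).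
  apply: measurable_weight.
  rewrite (_ : causal _ = fun t =>
      (\sum_(k < n) (causal (dv k) t + be k * causal (dw k) t)) ^+ 2).
    apply: measurable_funX; apply: measurable_sum => k.
    by apply: measurable_funD => //; exact: measurable_funM.
  apply/funext => t; rewrite /causal /Sn; case: (ltP 0 t) => // _.
  by rewrite big1 ?expr0n// => k _; rewrite mulr0 addr0.
have le t : `|weight 1 (fun t => Sn t ^+ 2) t| <= 2 * L * (Bv t + Bw t).
  have [t0|t0] := leP t 0.
    rewrite weight_causal causal0// normr0 mulr_ge0 ?mulr_ge0//.
    rewrite addr_ge0// sumr_ge0// => k _; rewrite mulr_ge0// weight_causal causal_ge0// => s _.
      by rewrite mulr_ge0 ?expR_ge0 ?sqr_ge0.
    by rewrite mulr_ge0 ?expR_ge0 ?sqr_ge0.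
  have wE (u : R -> R) : weight 1 u t = expR (- (1 * t)) * u t.
    by rewrite weight_causal causalE.
  rewrite wE ger0_norm; last by rewrite mulr_ge0 ?expR_ge0 ?sqr_ge0.
  have -> : 2 * L * (Bv t + Bw t) = expR (- (1 * t)) *
     (2 * (L * \sum_(k < n) al k * v k t ^+ 2) + 2 * (L * \sum_(k < n) be k * dw k t ^+ 2)).
    have BvE : Bv t = expR (- (1 * t)) * \sum_(k < n) al k * v k t ^+ 2.
      by rewrite mulr_sumr; apply: eq_bigr => k _; rewrite wE mulrCA.
    have BwE : Bw t = expR (- (1 * t)) * \sum_(k < n) be k * dw k t ^+ 2.
      by rewrite mulr_sumr; apply: eq_bigr => k _; rewrite wE mulrCA.
    by rewrite BvE BwE; ring.
  apply: ler_wpM2l; first exact: expR_ge0.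
  rewrite SE; apply: (le_trans (sqrD_le _ _)); apply: lerD; apply: ler_wpM2l => //.
    apply: (le_trans (sum_cauchy_schwarz n (v ^~ t) al0)); apply: ler_wpM2r => //.
    by apply: sumr_ge0 => k _; exact: mul_sqr_ge0.
  apply: (le_trans (sum_cauchy_schwarz n (dw ^~ t) be0)); apply: ler_wpM2r => //.
  by apply: sumr_ge0 => k _; exact: mul_sqr_ge0.
have LB : L1 mu (fun t => 2 * L * (Bv t + Bw t)) by apply: L1Z; exact: L1D.
split; first exact: (@L1_le _ _ _ mu _ _ m le LB).
apply: (le_trans (ler_norm _)); apply: (le_trans (@I_bound _ _ _ mu _ _ m le LB)).
rewrite IZ; last exact: L1D.
rewrite ID// [2 * L ^+ 2](_ : _ = 2 * L * L); last by rewrite expr2 mulrA.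
rewrite -[leRHS]mulrA [L * (_ + _)]mulrDr; apply: ler_wpM2l; first by rewrite mulr_ge0.
exact: lerD.
Qed.

End laplace_sums.

(** * Equivalence of all points *)

Section equivalence.
Context (R : realType) (a b : R) (f : R -> R) (Cf : R) (r : R -> R -> R)
  (C : R -> R -> R -> R) (S : forced_solution a b f Cf r C).
Notation mu := (@lebesgue_measure R).
Notation eqv := (eqv a b f r).
Notation tame := (tame r).
Notation tilt := (tilt r).
Notation tilt_dx := (tilt_dx r).
Let a0 := fs_a0 S.
Let b0 := fs_b0 S.

Definition bad x := 0 < x /\ ~ exists2 e, 0 < e &
  forall y z, 0 < y -> 0 < z -> `|y - x| < e -> `|z - x| < e -> eqv y z.

Lemma bad_closed x : 0 < x -> (forall e, 0 < e -> exists2 y, bad y & `|y - x| < e) -> bad x.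
Proof.
move=> x0 H; split => // -[e e0 He]; have e2 : 0 < e / 2 by rewrite divr_gt0.
have [y [y0 by_] yx] := H _ e2; apply: by_; exists (e / 2) => // u v u0 v0 uy vy.
have near w : `|w - y| < e / 2 -> `|w - x| < e.
  move=> wy; rewrite (_ : w - x = (w - y) + (y - x)); last by ring.
  by apply: (le_lt_trans (ler_normD _ _)); lra.
by apply: He => //; exact: near.
Qed.

(** Local equivalence spreads through the open gap by real induction; [eqv_left_limit] and
    [eqv_right_limit] add the two endpoints. *)
Lemma gap_eqv c d : 0 <= c -> c < d -> (forall z, c < z -> z < d -> ~ bad z) -> eqv c d.
Proof.
move=> c0 cd nb.
have mid y z : c < y -> y <= z -> z < d -> eqv y z.
  move=> cy yz zd; apply: locally_constant_interval => //.
    by move=> ? ? ?; exact: eqv_trans.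
  move=> x yx xz; have x0 : 0 < x by apply: le_lt_trans c0 _; exact: lt_le_trans yx.
  have [e e0 He] : exists2 e, 0 < e &
      forall y z, 0 < y -> 0 < z -> `|y - x| < e -> `|z - x| < e -> eqv y z.
    apply: contrapT => H; apply: (nb x) => //; first exact: lt_le_trans yx.
    exact: le_lt_trans zd.
  have y0 : 0 < y by exact: le_lt_trans cy.
  by exists e => // u v yu _ yv _; apply: He; exact: lt_le_trans y0 _.
have cdE x y : c < x < d -> c < y < d -> eqv x y.
  move=> /andP[cx xd] /andP[cy yd]; have [xy|/ltW yx] := leP x y; first exact: mid.
  by apply: eqv_sym; exact: mid.
apply: (eqv_left_limit S c0 cd) => x; rewrite le_eqVlt => /predU1P[<- _ //|cx xd].
by apply: (eqv_right_limit S c0 cd cdE); rewrite cx.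
Qed.

Lemma lap_tilt l F x : 0 < l -> 0 < x -> L1 mu (weight l (tilt F x)) /\
  lap l (tilt F x) = expR (F * x) * lap l (r ^~ x).
Proof. by move=> l0 x0; apply: lapZ; apply: (L1_slice S) => //; exact: ltW. Qed.

(** The terms in [r] cancel against the integrating factor, leaving only the initial datum. *)
Lemma lap_tilt_dx l x : 0 < l -> 0 < x ->
  L1 mu (weight l (tilt_dx (Phi a b l) x)) /\
  lap l (tilt_dx (Phi a b l) x) = Phi a b l / l * (expR (Phi a b l * x) * f x).
Proof.
move=> l0 x0; have [Ld Id] := lap_dx S l0 x0.
have [Lr Ir] := lapZ (Phi a b l) (L1_slice S l0 (ltW x0)).
have [Ls Is] := lapD Lr Ld; have [L I] := lapZ (expR (Phi a b l * x)) Ls.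
by split => //; rewrite I Is Ir Id; ring.
Qed.

Lemma source_uniform l x1 x2 : 0 < l -> 0 < x1 -> x1 <= x2 ->
  forall e, 0 < e -> exists2 h, 0 < h & forall u v, x1 <= u -> u <= v -> v <= x2 ->
    v - u <= h ->
    `|source a b f l v - source a b f l u - (v - u) * (expR (Phi a b l * u) * f u)|
      <= e * (v - u).
Proof.
move=> l0 x10 x12 e e0; set F := Phi a b l.
have cG x : x1 <= x -> x <= x2 -> {for x, continuous (fun z => expR (F * z) * f z)}.
  move=> xx1 _; have xP : x \in `]0, +oo[ by rewrite in_itv/= (lt_le_trans x10).
  apply: cvgM; last exact: (fs_cf S xP).
  apply: continuous_comp; last exact: continuous_expR.
  exact: mulrl_continuous.
have [h h0 Hh] := uniform_continuity x12 cG e0.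
exists h => // u v x1u uv vx2 vuh; have [Luv Iuv] := I_interval uv.
have u0 : 0 < u by exact: lt_le_trans x1u.
pose H w z := expR (F * z) * causal f z * (z < w)%R%:R.
have LH w : L1 mu (H w) by exact: (@L1_source _ _ _ _ _ _ _ S l w l0).
have LI : L1 mu (fun z => (expR (F * u) * f u) * (u <= z < v)%R%:R) by exact: L1Z.
rewrite /source -IB; [|exact: LH|exact: LH].
rewrite -{1}Iuv mulrC -IZ// -IB//; last by apply: L1B; exact: LH.
rewrite -Iuv -IZ//; apply: (@I_bound _ _ _ mu) => [|z|]; last exact: L1Z.
  by apply: measurable_funB; [apply: measurable_funB; exact: L1_meas (LH _)|exact: L1_meas LI].
rewrite /H -mulrBr; case: (leP u z) => uz /=; last first.
  by rewrite (lt_le_trans uz uv) subrr !mulr0 subrr normr0.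
rewrite subr0 causalE ?(lt_le_trans u0 uz)// -mulrBl normrM (@ger0_norm _ _%:R)//.
case: (ltP z v) => zv; last by rewrite !mulr0.
rewrite !mulr1; apply: Hh => //; first exact: le_trans (ltW zv) vx2.
by lra.
Qed.

Lemma tilt_uniform F x1 x2 t : 0 < t -> 0 < x1 -> x1 <= x2 ->
  forall e, 0 < e -> exists2 h, 0 < h & forall u v, x1 <= u -> u <= v -> v <= x2 ->
    v - u <= h ->
    `|tilt F v t - tilt F u t - (v - u) * tilt_dx F u t| <= e * (v - u).
Proof.
move=> t0 x10 x12.
apply: (@derivative_uniform R (fun x => tilt F x t) (fun x => tilt_dx F x t)) => // x xx1 _.
  have x0 : 0 < x by exact: lt_le_trans xx1.
  have xP : x \in `]0, +oo[ by rewrite in_itv/= x0.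
  have [dr _] := fs_rx S t0.
  have dre : is_derive x (1 : R) (r t) (derive1 (r t) x).
    by rewrite derive1E; apply: derivableP; exact: dr.
  have de : is_derive x (1 : R) (fun x => expR (F * x)) (F * expR (F * x)).
    by apply: is_derive_eq; rewrite /GRing.scale/=; ring.
  rewrite /tilt /tilt_dx; apply: is_derive_eq.
  rewrite /GRing.scale/=; ring.
have x0 : 0 < x by exact: lt_le_trans xx1.
have xP : x \in `]0, +oo[ by rewrite in_itv/= x0.
apply: cvgM.
  apply: continuous_comp; last exact: continuous_expR.
  exact: mulrl_continuous.
apply: cvgD; last exact: (fs_rx S t0).2.
by apply: cvgMr; exact: (continuous_profile S t0 xP).
Qed.

(** The chain sums of [tilt] converge at each [t] to its increment from x1 to x2, while their
    transforms are those of the source and converge to its increment. The L2 bound, uniform along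
    chains of tame points, allows the limit to pass through the transform. *)
Lemma bad_eqv n x1 x2 : bad x1 -> bad x2 -> x1 < x2 -> a * (x2 - x1) <= 1 ->
  (forall y, bad y -> x1 <= y -> y <= x2 -> tame n y) -> eqv x1 x2.
Proof.
move=> bad1 bad2 x12 ax12 tn l l1; have x10 : 0 < x1 by case: bad1.
have x20 : 0 < x2 by case: bad2.
have l0 : 0 < l by exact: lt_le_trans l1.
have F0 := Phi_gt0 a0 b0 l0; set F := Phi a b l in F0 *.
pose L := x2 - x1; have L0 : 0 < L by rewrite subr_gt0.
pose hh z := expR (F * z) * f z.
have /choice[pm Hpm] : forall N : nat, exists pm : (nat -> R) * (nat -> R),
    chain bad x1 x2 N.+1 pm.1 pm.2.
  move=> N; have [p [m pmP]] := chain_exists x10 x12 bad1 bad2 bad_closed (ltn0Sn N).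
  by exists (p, m).
pose p N := (pm N).1; pose m N := (pm N).2.
have ch N : chain bad x1 x2 N.+1 (p N) (m N) by exact: Hpm.
have link N k : [/\ [/\ 0 < p N k, tame n (p N k) & p N k <= x2],
    [/\ 0 < m N k, tame n (m N k) & a * (p N k.+1 - m N k) <= 1],
    p N k <= m N k <= p N k.+1, 0 < p N k.+1 <= x2 & eqv (m N k) (p N k.+1)].
  have [_ _ H] := ch N; have [[b1 b2] /andP[h1 h2] /andP[h3 h4] _ h5] := H k.
  have [_ /andP[g1 g2] _ _ _] := H k.+1.
  have m0 : 0 < m N k by apply: (lt_le_trans x10); exact: le_trans h3.
  have p1m : p N k.+1 - m N k <= x2 - x1 by lra.
  split; rewrite ?h3 ?h4//.
  - by split => //; [exact: lt_le_trans h1|exact: tn].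
  - split => //; first by apply: tn => //; [exact: le_trans h3|exact: le_trans g2].
    by apply: le_trans ax12; rewrite ler_pM2l.
  - by rewrite g2 (lt_le_trans x10 g1).
  - move: h4; rewrite le_eqVlt => /predU1P[->//|h4]; exact: gap_eqv (ltW m0) h4 h5.
pose Sn N t := chain_sum N.+1 (p N) (m N) (fun x => tilt F x t) (fun x => tilt_dx F x t).
pose G t := tilt F x2 t - tilt F x1 t.
have Scvg t : 0 < t -> Sn N t @[N --> \oo] --> G t.
  move=> t0; exact: (chain_sum_cvg x12 ch (tilt_uniform F t0 x10 (ltW x12))).
have source_cvg : chain_sum N.+1 (p N) (m N) (source a b f l) hh @[N --> \oo] -->
    source a b f l x2 - source a b f l x1.
  exact: (chain_sum_cvg x12 ch (source_uniform l0 x10 (ltW x12))).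
(* An exact identity, not an approximation: the gap terms match because gap endpoints are
   equivalent, the derivative terms by [lap_tilt_dx]. *)
have lapS N : L1 mu (weight l (Sn N)) /\
    lap l (Sn N) = F / l * chain_sum N.+1 (p N) (m N) (source a b f l) hh.
  have Lk k : L1 mu (weight l (fun t => (tilt F (p N k.+1) t - tilt F (m N k) t) +
      (m N k - p N k) * tilt_dx F (p N k) t)) /\
      lap l (fun t => (tilt F (p N k.+1) t - tilt F (m N k) t) +
      (m N k - p N k) * tilt_dx F (p N k) t) =
      F / l * ((source a b f l (p N k.+1) - source a b f l (m N k)) +
        (m N k - p N k) * hh (p N k)).
    have [[pk0 _ _] [mk0 _ _] _ /andP[pk10 _] mpE] := link N k.
    have [Lp Ip] := lap_tilt F l0 pk10; have [Lm Im] := lap_tilt F l0 mk0.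
    have [Ld Id] := lap_tilt_dx l0 pk0.
    have [Lm' Im'] := lapZ (-1) Lm; have [Ld' Id'] := lapZ (m N k - p N k) Ld.
    have [Lpm Ipm] := lapD Lp Lm'; have [Lall Iall] := lapD Lpm Ld'.
    have E : (fun t => (tilt F (p N k.+1) t - tilt F (m N k) t) +
        (m N k - p N k) * tilt_dx F (p N k) t) =
        (fun t => tilt F (p N k.+1) t + -1 * tilt F (m N k) t +
        (m N k - p N k) * tilt_dx F (p N k) t).
      by apply/funext => t; rewrite mulN1r.
    rewrite E; split => //; rewrite Iall Ipm Im' Id' Id Ip Im -/F.
    have := mpE l l1; rewrite /invariant -/F /hh => H.
    set X := expR (F * p N k.+1) * _ in H *; set Y := expR (F * m N k) * _ in H *.
    rewrite mulrDr mulrBr (_ : X + -1 * Y = F / l * source a b f l (p N k.+1) -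
      F / l * source a b f l (m N k)); last by lra.
    by congr (_ + _); ring.
  have [h1 h2] := lap_sum_ord N.+1 (fun k => (Lk k).1).
  split; first exact: h1.
  by rewrite h2 /chain_sum mulr_sumr; apply: eq_bigr => k _; exact: (Lk k).2.
have [Kg Kg0 HKg] := tilt_sub_L2 S n x2 (ltW F0).
have [Kd Kd0 HKd] := tilt_dx_L2 S n x2 (ltW F0).
have SL2 N : L1 mu (weight 1 (fun t => Sn N t ^+ 2)) /\
    \int[mu]_t weight 1 (fun t => Sn N t ^+ 2) t <= 2 * L ^+ 2 * (Kg + Kd).
  have [pN0 pNN _] := ch N.
  have tel : \sum_(k < N.+1) (p N k.+1 - p N k) = L.
    rewrite -(big_mkord xpredT (fun k => p N k.+1 - p N k)) telescope_sumr//.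
    by rewrite pNN pN0.
  have Lt x : 0 < x -> L1 mu (weight 1 (tilt F x)).
    by move=> x0; exact: (lap_tilt F ltr01 x0).1.
  rewrite /Sn /chain_sum; apply: (@weighted_sum_L2 _ N.+1 (fun k => p N k.+1 - m N k) (fun k => m N k - p N k)
    (fun k t => tilt F (p N k.+1) t - tilt F (m N k) t) (fun k t => tilt_dx F (p N k) t) L Kg Kd).
  - exact: ltW.
  - by move=> k; have [_ _ /andP[_ h] _ _] := link N k; rewrite subr_ge0.
  - by move=> k; have [_ _ /andP[h _] _ _] := link N k; rewrite subr_ge0.
  - rewrite -tel; apply: ler_sum => k _; have [_ _ /andP[h _] _ _] := link N k.
    by rewrite lerB.
  - rewrite -tel; apply: ler_sum => k _; have [_ _ /andP[_ h] _ _] := link N k.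
    by rewrite lerB.
  - exact: Kg0.
  - exact: Kd0.
  - by move=> k /eqP; rewrite subr_eq0 => /eqP -> t; rewrite subrr.
  - move=> k; have [_ [mk0 _ _] _ /andP[pk0 _] _] := link N k.
    rewrite (_ : causal _ = fun t => causal (tilt F (p N k.+1)) t - causal (tilt F (m N k)) t).
      by apply: measurable_funB; apply: measurable_causal_weight; exact: L1_meas (Lt _ _).
    by apply/funext => t; rewrite /causal; case: ifP => // _; rewrite subr0.
  - move=> k; have [[pk0 tp px] _ _ _ _] := link N k.
    apply: measurable_causal_weight; exact: L1_meas (lap_tilt_dx l0 pk0).1.
  - move=> k; have [_ [mk0 tm am] /andP[_ h] /andP[pk0 px] E] := link N k.
    move: h; rewrite le_eqVlt => /predU1P[h|h]; last exact: HKg.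
    have Z : weight 1 (fun t => (tilt F (p N k.+1) t - tilt F (m N k) t) ^+ 2) = fun=> 0.
      by apply/funext => t; rewrite h /weight /causal subrr expr0n if_same mulr0.
    by rewrite Z I_0 h subrr expr0n mulr0; split => //; exact: L1_0.
  - by move=> k; have [[pk0 tp px] _ _ _ _] := link N k; exact: HKd.
pose w t : R := causal (fun t => expR (- (l * t))) t.
have w0 t : 0 <= w t by apply: causal_ge0 => s _; exact: expR_ge0.
have Lw : L1 mu w by exact: (expR_halfline l0).1.
have wE (u : R -> R) t : causal u t * w t = weight l u t.
  by rewrite /w /weight /causal; case: ifP => _; rewrite ?mul0r ?mulr0// mulrC.
have mS N : measurable_fun setT (causal (Sn N)).
  by apply: measurable_causal_weight; exact: L1_meas (lapS N).1.
(* Uses l >= 1: the weight e^(-lt) is dominated by e^(-t). *)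
have sq_le N t : 0 <= causal (Sn N) t ^+ 2 * w t <= weight 1 (fun t => Sn N t ^+ 2) t.
  rewrite mulr_ge0 ?sqr_ge0//= /w /weight /causal; case: (ltP 0 t) => t0; last by rewrite !mulr0.
  by rewrite mulrC ler_wpM2r ?sqr_ge0// ler_expR lerN2 ler_wpM2r// ltW.
have LS2 N : L1 mu (fun t => causal (Sn N) t ^+ 2 * w t).
  apply: (@L1_le _ _ _ mu _ _ _ _ (SL2 N).1) => [|t].
    by apply: measurable_funM; [exact: (measurable_funX _ (mS N))|exact: L1_meas Lw].
  by have /andP[h1 h2] := sq_le N t; rewrite ger0_norm.
have [|t|_ cv] := @uniformly_integrable_cvg _ _ _ mu w (fun N => causal (Sn N)) (causal G)
  (2 * L ^+ 2 * (Kg + Kd)) Lw w0 mS LS2.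
- move=> N; apply: le_trans (SL2 N).2; apply: le_I => //; first exact: (SL2 N).1.
  by move=> t; have /andP[] := sq_le N t.
- rewrite /causal; case: (ltP 0 t) => t0; last exact: cvg_cst.
  exact: Scvg.
have lapG : lap l G = F / l * (source a b f l x2 - source a b f l x1).
  have lim1 : lap l (Sn N) @[N --> \oo] --> lap l G.
    rewrite (_ : lap l G = \int[mu]_t (causal G t * w t)); last first.
      by apply: eq_I => t; rewrite wE.
    rewrite (_ : (fun N => lap l (Sn N)) = fun N => \int[mu]_t (causal (Sn N) t * w t)) //.
    by apply/funext => N; apply: eq_I => t; rewrite wE.
  have lim2 : lap l (Sn N) @[N --> \oo] -->
      F / l * (source a b f l x2 - source a b f l x1).
    rewrite (_ : (fun N => lap l (Sn N)) =
        fun N => F / l * chain_sum N.+1 (p N) (m N) (source a b f l) hh); last first.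
      by apply/funext => N; rewrite (lapS N).2.
    exact: cvgMr.
  exact: (cvg_unique (@Rhausdorff R) lim1 lim2).
have [L2 I2] := lap_tilt F l0 x20; have [L1' I1] := lap_tilt F l0 x10.
have : lap l G = expR (F * x2) * lap l (r ^~ x2) - expR (F * x1) * lap l (r ^~ x1).
  rewrite -I2 -I1 /lap -IB//; apply: eq_I => t.
  by rewrite /weight /causal /G; case: ifP => _; rewrite ?mulr0 ?subr0// mulrBr.
by rewrite lapG /invariant -/F; lra.
Qed.

(** Near the point given by Baire's theorem any two bad points are equivalent by [bad_eqv]. A nearby
    point which is not bad is joined by a gap to the closest bad point on the side of x0. So x0 has
    an equivalence neighbourhood, against its being bad. *)
Lemma no_bad x : ~ bad x.
Proof.
move=> bx.
have [n [x0 [e [bx0 e0 He]]]] := @baire_interval R bad tame x bx (fun y => @proj1 _ _)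
  bad_closed (fun n x x0 => @tame_closed _ _ _ _ _ _ _ S n x x0)
  (fun x x0 => tame_exists S x0).
have x00 : 0 < x0 by case: bx0.
(* Lengths up to 1 / a keep the gamma parameter at most 1, as the moment estimate requires. *)
pose q := Num.min e a^-1; have q0 : 0 < q by rewrite lt_min e0 invr_gt0.
have qe : q <= e by rewrite ge_min lexx.
have qa : a * q <= 1 by rewrite -ler_pdivlMl// mulr1 ge_min lexx orbT.
have badE y z : bad y -> bad z -> y <= z -> `|y - x0| < q -> `|z - x0| < q ->
    z - y <= q -> eqv y z.
  move=> yb zb; rewrite le_eqVlt => /predU1P[->//|yz] yx zx zyq.
  apply: (bad_eqv (n := n)) => //.
    by apply: le_trans qa; rewrite ler_pM2l.
  move=> u ub yu uz; apply: He => //; apply: lt_le_trans qe.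
  move: yx zx; rewrite !ltr_norml => /andP[h1 h2] /andP[h3 h4]; apply/andP; split; lra.
have key y : 0 < y -> `|y - x0| < q -> eqv y x0.
  move=> y0 yx; have xx : `|x0 - x0| < q by rewrite subrr normr0.
  have [xy|yx'] := leP x0 y.
    move: xy; rewrite le_eqVlt => /predU1P[->//|xy].
    have [v [vb xv vy nb]] := previous_bad x00 bx0 bad_closed (ltW xy) (lexx y).
    have yxn : y - x0 < q by move: yx; rewrite ger0_norm // subr_ge0 ltW.
    have h1 : eqv x0 v.
      by apply: badE => //; [rewrite ger0_norm ?subr_ge0//|]; lra.
    apply: eqv_sym; apply: eqv_trans h1 _.
    move: vy; rewrite le_eqVlt => /predU1P[->//|vy].
    apply: gap_eqv => //; first exact: le_trans (ltW x00) xv.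
    by move=> z vz zy; apply: nb => //; exact: ltW.
  have [u [ub yu ux nb]] := next_bad y0 bx0 bad_closed (lexx y) (ltW yx').
  have yxn : x0 - y < q by move: yx; rewrite distrC ger0_norm // subr_ge0 ltW.
  have h1 : eqv u x0.
    by apply: badE => //; [rewrite distrC ger0_norm ?subr_ge0//|]; lra.
  apply: eqv_trans _ h1.
  move: yu; rewrite le_eqVlt => /predU1P[->//|yu].
  apply: gap_eqv => //; first exact: ltW.
  by move=> z yz zu; apply: nb => //; exact: ltW.
case: bx0 => _; apply; exists q => // y z y0 z0 yx zx.
by apply: (eqv_trans (key y y0 yx)); apply: eqv_sym; exact: key.
Qed.

(** Renewal from 0, where the slice vanishes and so does its convolution. *)
Lemma solution_eq_forcing t x : 0 < t -> 0 < x -> r t x = C x x t.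
Proof.
move=> t0 x0; have E : eqv 0 x by apply: gap_eqv => // z _ _; exact: no_bad.
rewrite (renewal S (lexx 0) x0 E t0) subr0 (slice0 S) /conv.
under eq_I do rewrite mul0r.
by rewrite I_0 add0r.
Qed.

End equivalence.

(** * Conclusion *)

Section subordinator_version.
Context (R : realType) (a b : R) (ha : 0 < a) (hb : 0 < b).
Context (d : measure_display) (Omega : measurableType d) (P : probability Omega R).
Context (H : R -> {RV P >-> R}) (hH : gamma_subordinator a b H).

Lemma subordinator_laplace t l : 0 <= t -> 0 <= l ->
  L1 P (fun w => expR (- (l * H t w))) /\
  \int[P]_w expR (- (l * H t w)) = expR (- (t * Phi a b l)).
Proof.
move=> t0 l0; have [_ _ _ Hl] := hH.
have E : (\int[P]_w (expR (- (l * H t w)))%:E)%E = (expR (- (t * Phi a b l)))%:E.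
  by rewrite -(Hl t l t0 l0) unlock.
have m : measurable_fun setT (fun w => expR (- (l * H t w))).
  apply: measurableT_comp => //; apply: measurableT_comp => //.
  exact: measurable_funM.
have [|L _] := @L1_bound _ _ _ P _ (expR (- (t * Phi a b l))) m (fun=> expR_ge0 _).
  by rewrite E.
by split => //; rewrite /Rintegral E.
Qed.

(** The indicator of H_s <= 0 is at most e^(-l H_s), of expectation e^(-s Phi(l)), and Phi is
    unbounded: l = b (e^M - 1) gives Phi(l) = a M. *)
Lemma subordinator_gt0_ae s : 0 < s -> {ae P, forall w, 0 < H s w}.
Proof.
move=> s0.
have mA : measurable_fun setT (fun w => (H s w <= 0)%R%:R : R).
  by apply: measurable_natmul_bool; exact: measurable_fun_ler.
have LA : L1 P (fun w => (H s w <= 0)%R%:R : R).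
  by apply: (@L1_probability _ _ _ _ _ 1) => // w; exact: normr_natb_le1.
have le M : 0 < M -> \int[P]_w ((H s w <= 0)%R%:R : R) <= expR (- (s * (a * M))).
  move=> M0; pose l := b * (expR M - 1).
  have l0 : 0 <= l by rewrite mulr_ge0 ?subr_ge0 ?(ltW hb)// -expR0 ler_expR ltW.
  have -> : s * (a * M) = s * Phi a b l.
    by rewrite /Phi /l mulrAC divff ?gt_eqF// mul1r addrC subrK expRK.
  have [Le <-] := subordinator_laplace (ltW s0) l0.
  apply: le_I => // w; case: (leP (H s w) 0) => Hs; last exact: expR_ge0.
  by rewrite -expR0 ler_expR -mulrN mulr_ge0// oppr_ge0.
have I0 : \int[P]_w ((H s w <= 0)%R%:R : R) = 0.
  apply/eqP; rewrite eq_le I_ge0// andbT; apply/ler_addgt0Pr => e e0.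
  rewrite add0r; pose M := Num.max 1 (- ln e / (s * a)).
  have M0 : 0 < M by rewrite lt_max ltr01.
  apply: (le_trans (le M M0)); rewrite -[leRHS](lnK e0) ler_expR lerNl mulrA.
  by rewrite mulrC -ler_pdivrMr ?mulr_gt0// le_max lexx orbT.
apply: (ae_imp (I_eq0_ae LA (fun w => ler0n _ _) I0)) => w /eqP.
by rewrite pnatr_eq0 eqb0 -ltNge.
Qed.

(** Positivity at the times 1 / (n + 1), a countable family, extends to all positive times by
    monotonicity; so a single null set carries every exception. *)
Lemma subordinator_version : exists (N : set Omega) (K : R -> Omega -> R),
  [/\ measurable N, P N = 0%E, forall s w, ~ N w -> K s w = H s w,
    (forall s, measurable_fun setT (K s)) /\ (forall w, K 0 w = 0) &
    [/\ forall w s t, 0 <= s -> s <= t -> K s w <= K t w,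
     forall w s, 0 < s -> 0 < K s w &
     forall u l, 0 <= u -> 0 <= l ->
       \int[P]_w expR (- (l * K u w)) = expR (- (u * Phi a b l))]].
Proof.
have [Hae _ _ _] := hH.
have pos : {ae P, forall w, forall n : nat, 0 < H n.+1%:R^-1 w}.
  by apply/ae_foralln => n; apply: subordinator_gt0_ae; rewrite invr_gt0.
have [N [mN N0 HN]] := ae_imp2 Hae pos (fun w h1 h2 => conj h1 h2).
have good w : ~ N w -> [/\ H 0 w = 0,
    forall s t : R, 0 <= s -> s <= t -> H s w <= H t w & forall s, 0 < s -> 0 < H s w].
  move=> nNw; have [[h1 h2 _] h3] : [/\ H 0 w = 0,
        forall s t : R, 0 <= s -> s <= t -> H s w <= H t w &
        forall s : R, 0 <= s -> H u w @[u --> s^'+] --> H s w] /\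
      (forall n : nat, 0 < H n.+1%:R^-1 w).
    by apply: contrapT => h; apply: nNw; exact: HN.
  split => // s s0; have [M _ /(_ M (leqnn M)) /= HM] := near_infty_natSinv_lt (PosNum s0).
  by apply: (lt_le_trans (h3 M)); apply: h2; [rewrite invr_ge0|exact: ltW].
(* On the null set the path is replaced by the identity, which is increasing and positive at
   positive times. *)
exists N, (fun s w => if w \in N then s else H s w).
have mK s : measurable_fun setT (fun w => if w \in N then s else H s w).
  rewrite (_ : (fun w => _) = fun w => s * \1_N w + H s w * \1_(~` N) w).
    apply: measurable_funD; apply: measurable_funM => //; apply: measurable_indic => //.
    exact: measurableC.
  apply/funext => w; rewrite !indicE in_setC; case: (w \in N);
    by rewrite /= ?mulr1 ?mulr0 ?addr0 ?add0r.
have nN w : (w \in N) = false -> ~ N w by move=> /negP h Nw; apply: h; exact: mem_set.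
split => //; first by move=> s w nNw; rewrite memNset.
  split => // w; case: ifPn => // /negbTE/nN/good[]//.
split => [w s t s0 st|w s s0|u l u0 l0].
- by case: ifPn => // /negbTE/nN/good[_ h _]; exact: h.
- by case: ifPn => // /negbTE/nN/good[_ _ h]; exact: h.
have [L <-] := subordinator_laplace u0 l0.
apply: eq_I_ae.
- apply: measurableT_comp => //; apply: measurableT_comp => //.
  exact: measurable_funM.
- exact: L1_meas L.
exists N; split => // w /= h; apply: contrapT => nNw; apply: h.
by rewrite memNset.
Qed.

End subordinator_version.

Lemma inf_positive (R : realType) : inf [set s : R | 0 < s] = 0.
Proof.
apply/eqP; rewrite eq_le; apply/andP; split; last first.
  by apply: lb_le_inf => [|s /ltW//]; exists 1; exact: ltr01.
apply/ler_addgt0Pr => e e0; rewrite add0r; apply: ge_inf => //.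
by exists 0 => s /ltW.
Qed.

Theorem theorem3 (R : realType) (a b : R) (ha : 0 < a) (hb : 0 < b)
    (d : measure_display) (Omega : measurableType d) (P : probability Omega R)
    (H : R -> {RV P >-> R}) (hH : gamma_subordinator a b H)
    (f : R -> R) (hf : Cb f)
    (r : R -> R -> R) (hr : C11_AC r) (hrL : laplace_class r)
    (hsol : solves_cauchy_problem a b f r) :
  forall t x : R, 0 <= t -> 0 < x ->
    (r t x)%:E =
      expectation_on P (fun w => f (x - inverse_process H t w))
        [set w | t < H x w].
Proof.
move=> t x t0 x0.
have [N [K [mN N0 KH [mK K0] [K_mono K_gt0 K_lap]]]] := subordinator_version ha hb hH.
have [cf [Cf fC]] := hf; have [r0 rt rx rAC] := hr; have [rB _] := hrL.
have [req rinit rbd] := hsol.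
rewrite /expectation_on unlock.
move: t0; rewrite le_eqVlt => /predU1P[<-|t0].
  rewrite (rinit x x0).1 -[f x](I_probability_cst P) -integral_EFin; last first.
    exact: finite_measure_integrable_cst.
  apply: (null_integral_eq mN N0) => w nNw; congr (_%:E).
  have -> : inverse_process H 0 w = 0.
    rewrite -[RHS](inf_positive R); congr inf; apply/seteqP; split => s /= [] //.
    by move=> s0; split => //; rewrite in_itv/= => /andP[h1 h2]; move: (lt_trans h1 h2); rewrite ltxx.
  rewrite subr0 indicE mem_set ?mulr1//= -(KH x w nNw).
  exact: K_gt0.
(* The forcing over a length h at position y is E[f(y - L_t), t <= K_h]. *)
have S : forced_solution a b f Cf r (forcing P K f).
  split => //.
  - by move=> y y0; apply/L1_causal; have [] := rAC y y0.
  - by move=> y y0; have [_ [M HM]] := rB y y0; exists M.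
  - by move=> y y0; have [] := rinit y y0.
  - by move=> s s0; have [h _] := rbd s s0; exact: h (lexx 0).
  - by move=> s s0; have [] := rbd s s0.
  - by move=> y h h0 hy; have [] := lap_forcing ha hb mK K0 K_mono K_gt0 K_lap cf fC h0 hy ltr01.
  - move=> y h s h0 hy s0; apply: (le_trans (forcing_le P mK K0 K_mono K_gt0 cf fC y h s)).
    rewrite -[leRHS]mulr1; apply: ler_wpM2l; last exact: survival_le1.
    exact: le_trans (normr_ge0 _) (fC _ ltr01).
  - move=> y h s h0 hy s0; apply: (le_trans (forcing_le P mK K0 K_mono K_gt0 cf fC y h s)).
    apply: ler_wpM2l; first exact: le_trans (normr_ge0 _) (fC _ ltr01).
    exact: survival_le mK K0 K_mono K_lap _ _ (ltW h0) s0.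
  - by move=> y h s h0 hy s0; exact: (forcing_left_continuous ha hb mK K0 K_mono K_gt0 K_lap cf fC).
  - by move=> y h l h0 hy l0; have [] := lap_forcing ha hb mK K0 K_mono K_gt0 K_lap cf fC h0 hy l0.
rewrite (solution_eq_forcing S t0 x0) /forcing -integral_EFin; last first.
  exact: (L1_forcing_integrand P mK K0 K_mono K_gt0 cf fC).
(* Off this second null set K_x differs from [t], so [t <= K_x] means [t < K_x]; moreover L_t < x on
   that event, so [f] is evaluated at a positive point, where its extension by 0 agrees with it. *)
have [N' [mN' N'0 HN']] := ae_imp2 (no_atom ha hb mK K0 K_mono K_lap x0 t0)
  (first_passage_lt_ae ha hb mK K0 K_mono K_lap x0 t0) (fun w h1 h2 => conj h1 h2).
have NN0 : P (N `|` N') = 0%E by rewrite measureU0.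
apply: (null_integral_eq (measurableU _ _ mN mN') NN0) => w /not_orP[nN nN'].
congr (_%:E).
have [Kt Lx] : K x w <> t /\ (t <= K x w -> first_passage K t w < x).
  by apply: contrapT => h; apply: nN'; exact: HN'.
have -> : inverse_process H t w = first_passage K t w.
  by congr inf; apply/seteqP; split => s /= [s0 h]; split => //; rewrite ?KH// -?KH.
have KHw := KH x w nN; rewrite indicE.
have [tK|tK] := ltP t (K x w).
  rewrite (ltW tK) mem_set/=; last by rewrite -KHw.
  by rewrite causalE// subr_gt0; exact: Lx (ltW tK).
rewrite memNset/=; last by rewrite -KHw ltNge tK.
rewrite (_ : t <= K x w = false) ?mulr0//.
by apply/negP => tK'; apply: Kt; apply/eqP; rewrite eq_le tK.
Qed.
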